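(* Let $n\ge0$ be an integer, let $m\ge0$ be an even integer, and let $0<\kappa<8/(2n+3m+1)$. Let $\sigma\in\{-1,1\}$ and let $g_\tau(z)=z+a_1z^{-1}+a_2z^{-2}+\cdots$ be the expansion at $\infty$ of the stopped Loewner map of SLE$_\kappa(\kappa-6)$ started from $X_0=\sigma$, $Y_0=-\sigma$, stopped at $\tau=\inf\{t\ge0:|Y_s-X_s|\to0\text{ as }s\nearrow t\}$. Then $$\mathbb{E}[a_1^na_2^m]=\frac{2^{3n+3m}\left(\frac{\kappa}{6}\right)^{m/2}\frac{m!}{(m/2)!}}{(8-3\kappa)(8-5\kappa)\cdots(8-(2n+3m+1)\kappa)},$$ where the denominator is the product of $8-(2j+1)\kappa$ over $1\le j\le n+\tfrac{3m}{2}$.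
   Context: SLE$_\kappa(\rho)$ started from $(x,y)$ (here with $\rho=\kappa-6$, $x=\sigma$, $y=-\sigma$): let $B_t$ be a standard one-dimensional Brownian motion and let $(X_t,Y_t)$ solve, for $t<\tau$, $$dX_t=\sqrt{\kappa}\,dB_t+\frac{\rho\,dt}{X_t-Y_t},\qquad dY_t=\frac{2\,dt}{Y_t-X_t},\qquad X_0=x,\ Y_0=y,$$ where $\tau=\inf\{t\ge0:|Y_s-X_s|\to0 \text{ as } s\nearrow t\}$. The Loewner maps $g_t$ solve $$\partial_t g_t(z)=\frac{2}{g_t(z)-X_t},\qquad g_0(z)=z,\quad z\in\mathbb{H}=\{z\in\mathbb{C}:\mathrm{Im}(z)>0\},$$ so $g_t$ maps $\mathbb{H}\setminus K_t$ conformally onto $\mathbb{H}$ with $g_t(z)=z+2t/z+\cdots$ at $\infty$, where $K_t$ is the set of $z\in\mathbb{H}$ for which the solution does not exist up to and including time $t$. For $\rho=\kappa-6$ and $0<\kappa<8$ one has $\tau<\infty$ almost surely and $g_\tau$ is well-defined. An empty product equals $1$. *)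

(* Defs.v *)
From HB Require Import structures.
From mathcomp Require Import all_boot all_order all_algebra.
From mathcomp Require Import complex.
From mathcomp Require Import all_classical all_reals all_analysis.

Set Implicit Arguments.
Unset Strict Implicit.
Unset Printing Implicit Defensive.

Import Order.TTheory GRing.Theory Num.Theory.
Import numFieldNormedType.Exports.

Local Open Scope classical_set_scope.
Local Open Scope ring_scope.
Local Open Scope complex_scope.

(* Taking some of the sets A i to be setT gives the product rule for every
   subfamily. *)
Definition mutually_independent (d : measure_display) (T : measurableType d)
    (R : realType) (P : probability T R) (k : nat) (Z : 'I_k -> T -> R) : Prop :=
  forall A : 'I_k -> set R, (forall i, measurable (A i)) ->
    P (\bigcap_i (Z i @^-1` A i)) = (\prod_(i < k) P (Z i @^-1` A i))%E.

(* Time is indexed by R; only the times t >= 0 are constrained. The second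
   argument of normal_prob is the standard deviation. *)
Definition brownian_motion (d : measure_display) (T : measurableType d)
    (R : realType) (P : probability T R) (B : R -> {RV P >-> R}) : Prop :=
  [/\ {ae P, forall w, B 0 w = 0},
      {ae P, forall w, {within `[0, +oo[, continuous (fun t => B t w)}},
      forall s t, 0 <= s -> s < t -> forall A : set R, measurable A ->
        P ((fun w => B t w - B s w) @^-1` A) =
        normal_prob 0 (Num.sqrt (t - s)) A
    & forall (k : nat) (t : nat -> R),
        0 <= t 0%N -> (forall i, t i <= t i.+1) ->
        mutually_independent P
          (fun (i : 'I_k) w => B (t i.+1) w - B (t i) w)].

Definition collision_times (R : realType) (X Y : R -> R) : set R :=
  [set t | 0 < t /\ `|Y s - X s| @[s --> t^'-] --> 0].

Definition collision_time (R : realType) (X Y : R -> R) : \bar R :=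
  ereal_inf [set t%:E | t in collision_times X Y].

(* Pathwise form of
     dX = sqrt kappa dB + rho dt / (X - Y),   dY = 2 dt / (Y - X),
     X_0 = x,  Y_0 = y,   for t < tau.
   The noise is additive, so the stochastic integral equation only involves
   the values of the driving path b and ordinary integrals.
   X and Y are total functions whose values after tau are meaningless; the
   last clause (the infimum defining a finite tau is attained) prevents those
   values from stopping the evolution early. *)
Definition sle_kappa_rho (R : realType) (kappa rho x y : R)
    (b X Y : R -> R) : Prop :=
  let tau := collision_time X Y in
  [/\ {within [set t | 0 <= t /\ (t%:E < tau)%E], continuous X},
      {within [set t | 0 <= t /\ (t%:E < tau)%E], continuous Y},
      forall t, 0 <= t -> (t%:E < tau)%E ->
        X t = x + Num.sqrt kappa * b t
              + \int[lebesgue_measure]_(s in `[0, t]) (rho / (X s - Y s)),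
      forall t, 0 <= t -> (t%:E < tau)%E ->
        Y t = y + \int[lebesgue_measure]_(s in `[0, t]) (2 / (Y s - X s))
    & (tau < +oo)%E -> collision_times X Y (fine tau)].

(* h is the solution, up to and including time T, of
     h'(t) = 2 / (h(t) - W(t)),  h(0) = z,
   in the upper half-plane, the derivative being taken componentwise. For a
   point of the upper half-plane, the solution h exists up to and including T
   iff it stays in the open half-plane on [0, T]. The driving function W is
   evaluated only on ]0, T[, so that it may be undefined at T. *)
Definition loewner_flow (R : realType) (W : R -> R) (T : R) (z : R[i])
    (h : R -> R[i]) : Prop :=
  [/\ h 0 = z,
      forall t, 0 <= t <= T -> 0 < complex.Im (h t),
      {within `[0, T], continuous (fun t => complex.Re (h t))},
      {within `[0, T], continuous (fun t => complex.Im (h t))}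
    & forall t, 0 < t < T ->
        is_derive t 1 (fun s => complex.Re (h s))
          (complex.Re (2 / (h t - (W t)%:C))) /\
        is_derive t 1 (fun s => complex.Im (h s))
          (complex.Im (2 / (h t - (W t)%:C)))].

(* g_t; the value 0 is a default on the hull K_t, where no solution exists. *)
Definition loewner_map (R : realType) (W : R -> R) (t : R) (z : R[i]) : R[i] :=
  xget 0 [set h t | h in loewner_flow W t z].

(* f(z) = z + a_1 z^-1 + a_2 z^-2 + ... for z in the upper half-plane with
   |z| large; the value a 0 is irrelevant. *)
Definition expansion_at_infinity (R : realType) (f : R[i] -> R[i])
    (a : nat -> R) : Prop :=
  exists M : R, forall z : R[i], 0 < complex.Im z -> M%:C < `|z| ->
    (fun N : nat => z + \sum_(1 <= k < N) (a k)%:C * z ^- k) @ \oo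
      --> (f z : R[i]^o).

(* Main.v *)
Require Import Defs.
From HB Require Import structures.
From mathcomp Require Import all_boot all_order all_algebra.
From mathcomp Require Import complex ring lra zify.
From mathcomp Require Import all_classical all_reals all_analysis measurable_realfun.

Set Implicit Arguments.
Unset Strict Implicit.
Unset Printing Implicit Defensive.

Import Order.TTheory GRing.Theory Num.Theory.
Import numFieldNormedType.Exports.

Local Open Scope classical_set_scope.
Local Open Scope ring_scope.

(* With sigma B as driving noise put u = sigma (X - Y), s = int_0^t dr / u and
   a = 2 int_0^t sigma X. Then u is 2 + sqrt kappa sigma B - (4 - kappa) s, and
   comparing the Loewner flow from z = i y with its driving function as
   y -> +oo gives a_1 = 2 tau and a_2 = sigma a_tau.

   The conditional expectation of a_1^n (sigma a_2)^m given the state at time t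
   is an explicit polynomial Phi in (t, a, u, s). Heuristically, given the
   remaining lifetime X, the remaining increment of a is Gaussian with mean
   2 c X, c = u / 2 - 1 - 2 s, and variance kappa X^3 / 3, while X has i-th
   moment u^(2 i) / prod_(1 <= j <= i) (8 - (2 j + 1) kappa). Phi is killed by
   the generator, equals a_1^n (sigma a_2)^m at u = 0, and takes the claimed
   value at the starting point.

   Stochastic integrals are avoided by an Euler scheme driven by the Brownian
   increments and stopped when u <= eps: an exact one-step Taylor expansion
   shows that the expectation of Phi changes by O(del) in total, and Lyapunov
   functions bound its moments uniformly in del and eps. Off a null set the
   scheme converges to the SLE path stopped at tau /\ K, first in del -> 0 and
   then in eps -> 0, which yields E Phi = Phi_0 at the fixed horizon K. Finally
   K -> +oo, using that (t + beta u^2)^q is a supermartingale for an exponent q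
   slightly above p = n + 3 m / 2. *)

(** * Gaussian moments *)

(** The singular drift [1 / u] shapes the proof. The remainders of the expansions have constants
    that blow up as [eps] goes to 0, so [del] must go to 0 before [eps]; the moment bounds that
    survive both limits use [del <= eps < u] instead, since the drift then moves [u] by at most
    [4 * del] in a step. These bounds grow like a power of the horizon [K], and the tail of the
    collision time has to pay for that growth. By Brownian scaling [a_1] is of the order of a time
    and [a_2] of its power 3/2, whence the degree [p]. The hypothesis on [kappa] reads
    [8 - (2 * p + 1) * kappa > 0]; being strict, it persists for an exponent slightly above [p],
    which gives uniform integrability and the almost sure finiteness of the collision time. The
    variance of the remaining increment is forced by the heat equation: [2 * c] has quadratic
    variation [kappa dt], so the variance must have derivative [kappa X^2] in the lifetime [X]. The
    sample functions [X], [Y] and [a] carry no measurability; limits are taken of the Euler chain,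
    which is measurable, and transferred almost surely. *)

Section normal_density_integral.
Context {R : realType} (s : R).
Local Notation mu := lebesgue_measure.
Local Notation phi := (normal_pdf 0 s).
Local Open Scope ereal_scope.

Let integral_normal_indic (E : set (measurableTypeR R)) : measurable E ->
  \int[normal_prob 0 s]_x (\1_E x)%:E = \int[mu]_x ((\1_E x)%:E * (phi x)%:E).
Proof.
move=> mE; rewrite integral_indic//= /normal_prob setIT.
rewrite [LHS]integral_mkcond/=.
apply: eq_integral => x _; rewrite patchE indicE; case: ifPn => xE.
  by rewrite mul1e.
by rewrite mul0e.
Qed.

Import HBNNSimple.

Let mphi : measurable_fun setT (fun x : measurableTypeR R => (phi x)%:E).
Proof. by apply/measurable_EFinP; exact: measurable_normal_pdf. Qed.

Let integral_normal_nnsfun (f : {nnsfun _ >-> R}) :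
  \int[normal_prob 0 s]_x (f x)%:E = \int[mu]_x ((f x)%:E * (phi x)%:E).
Proof.
under [LHS]eq_integral do rewrite fimfunE -fsumEFin//.
rewrite [LHS]ge0_integral_fsum//; last 2 first.
  - by move=> r; exact/measurable_EFinP/measurableT_comp.
  - by move=> n x _; rewrite EFinM nnfun_muleindic_ge0.
under [RHS]eq_integral.
  move=> x xD; rewrite fimfunE -fsumEFin// muleC ge0_mule_fsumr; last first.
    by move=> r; rewrite EFinM nnfun_muleindic_ge0.
  over.
rewrite [RHS]ge0_integral_fsum//; last 2 first.
  - move=> r; apply: emeasurable_funM => //.
    by apply/measurable_EFinP; do 2 apply/measurableT_comp => //.
  - move=> n x _; rewrite EFinM mule_ge0//; last by rewrite nnfun_muleindic_ge0.
    by rewrite lee_fin normal_pdf_ge0.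
apply: eq_fsbigr => r _.
under [RHS]eq_integral do rewrite EFinM muleCA.
under [LHS]eq_integral do rewrite EFinM.
have [r0|r0] := leP 0%R r.
  rewrite [LHS]ge0_integralZl//; last first.
    by apply/measurable_EFinP; exact: measurable_indic.
  rewrite [RHS]ge0_integralZl//; last 2 first.
    - by apply: (emeasurable_funM mphi); exact/measurable_EFinP/measurable_indic.
    - by move=> x _; rewrite mule_ge0// lee_fin// normal_pdf_ge0.
  rewrite integral_normal_indic//; congr (_ * _).
  by apply: eq_integral => x _; rewrite muleC.
rewrite preimage_nnfun0//.
under eq_integral do rewrite indic0 mule0.
under [RHS]eq_integral do rewrite indic0 mule0 mule0.
by rewrite !integral0.
Qed.

(** Extension from indicators to simple functions and, by monotone convergence, to nonnegative
    measurable functions. *)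
Lemma ge0_integral_normal_prob (f : _ -> \bar R) :
  measurable_fun setT f -> (forall x, 0 <= f x) ->
  \int[normal_prob 0 s]_x f x = \int[mu]_x (f x * (phi x)%:E).
Proof.
move=> mf f0.
pose f_ := nnsfun_approx measurableT mf.
transitivity (lim (\int[normal_prob 0%R s]_x (f_ n x)%:E @[n --> \oo])).
  rewrite -monotone_convergence//=.
  - apply: eq_integral => ? /[!inE] xD; apply/esym/cvg_lim => //=.
    exact: cvg_nnsfun_approx.
  - by move=> n; exact/measurable_EFinP/measurable_funTS.
  - by move=> n ? _; rewrite lee_fin.
  - by move=> ? _ ? ? mn; rewrite lee_fin; exact/lefP/nd_nnsfun_approx.
rewrite [RHS](_ : _ = lim
    (\int[mu]_x ((f_ n x)%:E * (phi x)%:E) @[n --> \oo])); last first.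
  rewrite -monotone_convergence//=.
  - apply: eq_integral => x _; apply/esym/cvg_lim => //=.
    apply: cvgeZr => //; exact: cvg_nnsfun_approx.
  - move=> n; apply: emeasurable_funM => //.
    by exact/measurable_EFinP/measurable_funTS.
  - by move=> n x _; rewrite mule_ge0// lee_fin ?normal_pdf_ge0.
  - move=> x _ a b ab; rewrite lee_wpmul2r ?lee_fin ?normal_pdf_ge0//.
    exact/lefP/nd_nnsfun_approx.
by apply: congr_lim; apply/funext => n /=; exact: integral_normal_nnsfun.
Qed.

End normal_density_integral.

Section normal_moments.
Context {R : realType} (s : R).
Hypothesis s0 : 0 < s.
Local Notation mu := lebesgue_measure.
Local Notation phi := (normal_pdf 0 s).

Let sN0 : s != 0. Proof. by rewrite gt_eqF. Qed.

Lemma is_derive_normal_pdf (x : R) : is_derive x 1 phi (- (x / s ^+ 2) * phi x).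
Proof.
rewrite normal_pdfE// /normal_fun.
have -> : (fun x => normal_peak s * expR (- (x - 0) ^+ 2 / (s ^+ 2 *+ 2))) =
  (fun x => normal_peak s * expR (- x ^+ 2 / (s ^+ 2 *+ 2))).
  by apply/funext => y; rewrite subr0.
rewrite subr0; apply: is_derive_eq.
move: (expR _) => e; rewrite /GRing.scale/= !mulr2n.
by field; rewrite sN0 -mulr2n mulrn_eq0/= expf_eq0/= sN0.
Qed.

(** On a compact interval the fundamental theorem of calculus applies and every moment is finite;
    the full moments are reached by monotone convergence in [cvg_truncated]. *)
Definition truncated_moment (k : nat) (a : R) : \bar R :=
  (\int[mu]_(x in `[(- a)%R, a%R]) (x ^+ k * phi x)%:E)%E.

Lemma continuous_moment k : continuous (fun x : R => x ^+ k * phi x).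
Proof.
move=> x; apply: cvgM; first exact: exprn_continuous.
exact: continuous_normal_pdf.
Qed.

(** Integration by parts: since [phi' = - (x / s ^+ 2) * phi], the integrand is the derivative of
    [s ^+ 2 * x ^+ k.+1 * phi x]. *)
Lemma truncated_momentS (k : nat) (a : R) : 0 < a ->
  (\int[mu]_(x in `[(- a)%R, a%R])
     ((k.+1%:R * s ^+ 2 * x ^+ k - x ^+ k.+2) * phi x)%:E =
  (s ^+ 2 * (a ^+ k.+1 - (- a) ^+ k.+1) * phi a)%:E)%E.
Proof.
move=> a0.
have phiN x : phi (- x) = phi x.
  by rewrite normal_pdfE// /normal_fun !subr0 sqrrN.
pose F (x : R) := s ^+ 2 * (x ^+ k.+1 * phi x).
have dF (x : R) : is_derive x 1 F
    ((k.+1%:R * s ^+ 2 * x ^+ k - x ^+ k.+2) * phi x).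
  have := is_derive_normal_pdf x => dphi.
  have dX := @is_deriveX R R id k.+1 x 1 1 (is_derive_id x 1).
  have dM := @is_deriveM _ _ _ phi x 1 _ _ dX dphi.
  have dZ := @is_deriveZ _ _ _ _ (s ^+ 2) x 1 _ dM.
  have -> : F = s ^+ 2 \*: (id ^+ k.+1 * phi).
    by apply/funext => y; rewrite /F/= mulrfctE exprfctE.
  apply: (is_derive_eq dZ).
  have -> : (id ^+ k.+1) x = x ^+ k.+1 by rewrite exprfctE.
  rewrite /GRing.scale/= (exprS x k.+1) (exprS x k); field.
  by [].
rewrite (@continuous_FTC2 _ _ F).
- rewrite /F -EFinB phiN; congr EFin; ring.
- by rewrite ltrNl (lt_trans _ a0)// oppr_lt0.
- apply: continuous_subspaceT => x; apply: cvgM.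
    apply: cvgB; last exact: exprn_continuous.
    apply: cvgM; [exact: cvg_cst|exact: exprn_continuous].
  exact: continuous_normal_pdf.
- split.
  + by move=> x _; have := dF x => -[].
  + apply: cvg_at_right_filter; apply: differentiable_continuous.
    by apply/derivable1_diffP; have := dF (- a) => -[].
  + apply: cvg_at_left_filter; apply: differentiable_continuous.
    by apply/derivable1_diffP; have := dF a => -[].
- by move=> x _; rewrite derive1E; have := dF x => -[].
Qed.

Let normal_pdfN x : phi (- x) = phi x.
Proof. by rewrite normal_pdfE// /normal_fun !subr0 sqrrN. Qed.

Let integrable_moment (k : nat) (a : R) : mu.-integrable `[(- a)%R, a%R] (fun x => (x ^+ k * phi x)%:E).
Proof.
apply: continuous_compact_integrable; first exact: segment_compact.
by apply: continuous_subspaceT; exact: continuous_moment.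
Qed.

Lemma integrable_truncated_moment (k : nat) (a : R) :
  mu.-integrable `[(- a)%R, a%R] (fun x => (x ^+ k * phi x)%:E).
Proof. exact: integrable_moment. Qed.

Lemma truncated_moment_rec (k : nat) (a : R) : 0 < a ->
  truncated_moment k.+2 a =
  ((k.+1%:R * s ^+ 2)%:E * truncated_moment k a
   - (s ^+ 2 * (a ^+ k.+1 - (- a) ^+ k.+1) * phi a)%:E)%E.
Proof.
move=> a0; rewrite -truncated_momentS//.
under [X in (_ - X)%E]eq_integral.
  move=> x _; rewrite mulrBl -(mulrA (_ * _)) EFinB EFinM; over.
rewrite integralB//=; last by apply: integrableZl => //; exact: integrable_moment.
rewrite integralZl//.
have fin j : truncated_moment j a \is a fin_num.
  by apply: integrable_fin_num => //; exact: integrable_moment.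
rewrite -/(truncated_moment k a) -/(truncated_moment k.+2 a).
rewrite -(fineK (fin k)) -(fineK (fin k.+2)) -!EFinM -!EFinB; congr EFin; ring.
Qed.

(** For an even exponent the boundary term of the recursion is nonnegative, so dropping it gives a
    double factorial bound that is uniform in [a]. *)
Lemma even_truncated_moment_le (k : nat) (a : R) : 0 < a ->
  (truncated_moment k.*2 a <= ((\prod_(i < k) i.*2.+1)%:R * s ^+ k.*2)%:E)%E.
Proof.
move=> a0; elim: k => [|k IHk].
  rewrite big_ord0 expr0 mulr1 /truncated_moment -(integral_normal_pdf 0 s).
  rewrite [leLHS](_ : _ = \int[mu]_(x in `[(- a)%R, a%R]) (phi x)%:E)%E; last first.
    by apply: eq_integral => x _; rewrite expr0 mul1r.
  apply: ge0_subset_integral => //.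
  - by apply/measurable_EFinP; exact: measurable_normal_pdf.
  - by move=> x _; rewrite lee_fin normal_pdf_ge0.
rewrite doubleS truncated_moment_rec// big_ord_recr/=.
apply: (@le_trans _ _ ((k.*2.+1%:R * s ^+ 2)%:E * truncated_moment k.*2 a)%E).
  rewrite -[leRHS]adde0 leeD2l// lee_fin oppr_le0 mulr_ge0 ?normal_pdf_ge0// mulr_ge0 ?sqr_ge0//.
  rewrite exprS [(- a) ^+ _]exprS.
  have -> : (- a) ^+ k.*2 = a ^+ k.*2 by rewrite -!mul2n !exprM sqrrN.
  have := exprn_ge0 k.*2 (ltW a0); rewrite mulNr opprK => ?; by rewrite addr_ge0// mulr_ge0// ltW.
apply: (@le_trans _ _ ((k.*2.+1%:R * s ^+ 2)%:E *
    ((\prod_(i < k) i.*2.+1)%:R * s ^+ k.*2)%:E)%E).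
  by apply: lee_wpmul2l => //; rewrite lee_fin mulr_ge0// sqr_ge0.
by rewrite -EFinM lee_fin natrM -[(k.*2.+2)]addn2 exprD le_eqVlt; apply/orP; left;
  apply/eqP; ring.
Qed.

Lemma cvg_truncated (f : R -> R) : measurable_fun setT f -> (forall x, 0 <= f x) ->
  (\int[mu]_(x in `[(- n.+1%:R)%R, n.+1%:R%R]) (f x * phi x)%:E @[n --> \oo] -->
   \int[mu]_x (f x * phi x)%:E)%E.
Proof.
move=> mf f0.
have <- : \bigcup_n `[(- n.+1%:R : R), n.+1%:R]%classic = setT.
  apply/seteqP; split => // x _.
  exists (Num.truncn `|x|) => //=; rewrite in_itv/= -ler_norml.
  by rewrite ltW// truncnS_gt.
apply: ge0_nondecreasing_set_cvg_integral => //.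
- move=> i j ij; apply/subsetPset; apply: subset_itv; rewrite bnd_simp.
    by rewrite lerN2 ler_nat ltnS.
  by rewrite ler_nat ltnS.
- move=> i; apply/measurable_EFinP; apply: measurable_funTS.
  by apply: measurable_funM => //; exact: measurable_normal_pdf.
- by move=> i x _; rewrite lee_fin mulr_ge0// normal_pdf_ge0.
Qed.

Lemma truncated_moment1 (a : R) : 0 < a -> truncated_moment 1 a = 0%E.
Proof.
move=> a0; rewrite /truncated_moment.
pose F (x : R) := - s ^+ 2 * phi x.
have dF (x : R) : is_derive x 1 F (x ^+ 1 * phi x).
  have dphi := is_derive_normal_pdf x.
  have dZ := @is_deriveZ _ _ _ _ (- s ^+ 2) x 1 _ dphi.
  have -> : F = (- s ^+ 2) \*: (phi : R -> R) by apply/funext.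
  apply: (is_derive_eq dZ); rewrite /GRing.scale/=; field.
  exact: sN0.
rewrite (@continuous_FTC2 _ _ F).
- by rewrite /F normal_pdfN subee.
- by rewrite ltrNl (lt_trans _ a0)// oppr_lt0.
- by apply: continuous_subspaceT; exact: continuous_moment.
- split.
  + by move=> x _; have := dF x => -[].
  + apply: cvg_at_right_filter; apply: differentiable_continuous.
    by apply/derivable1_diffP; have := dF (- a) => -[].
  + apply: cvg_at_left_filter; apply: differentiable_continuous.
    by apply/derivable1_diffP; have := dF a => -[].
- by move=> x _; rewrite derive1E; have := dF x => -[].
Qed.
End normal_moments.

(** * Moments of a centred Gaussian random variable *)

Section gaussian_random_variable.
Context d (Omega : measurableType d) (R : realType) (P : probability Omega R).
Variables (xi : {RV P >-> R}) (s : R).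
Hypothesis s0 : 0 < s.
Hypothesis xi_normal :
  forall A : set R, measurable A -> P (xi @^-1` A) = normal_prob 0 s A.
Local Notation mu := lebesgue_measure.
Local Notation phi := (normal_pdf 0 s).

Let cvg_gaussian (f : R -> R) : measurable_fun setT f -> (forall x, 0 <= f x) ->
  (\int[mu]_(x in `[(- n.+1%:R)%R, n.+1%:R%R]) (f x * phi x)%:E @[n --> \oo] -->
   \int[P]_w (f (xi w))%:E)%E.
Proof.
move=> mf f0.
have mEf : measurable_fun setT (fun x : measurableTypeR R => (f x)%:E).
  exact/measurable_EFinP.
have mxi : measurable_fun setT (xi : Omega -> measurableTypeR R).
  exact: (measurable_funP xi).
have <- : (\int[mu]_x (f x * phi x)%:E = \int[P]_w (f (xi w))%:E)%E.
  have := @ge0_integral_pushforward _ _ _ _ _ _ mxi P setT (fun x => (f x)%:E).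
  rewrite preimage_setT /comp => <-//; last by move=> y _; rewrite lee_fin.
  rewrite [RHS](@eq_measure_integral _ _ _ setT (normal_prob 0 s)); last first.
    by move=> A mA _; exact: xi_normal.
  by rewrite ge0_integral_normal_prob.
exact: cvg_truncated.
Qed.

Lemma gaussian_even_moment_le k :
  (\int[P]_w (xi w ^+ k.*2)%:E <= ((\prod_(i < k) i.*2.+1)%:R * s ^+ k.*2)%:E)%E.
Proof.
have x0 (x : R) : 0 <= x ^+ k.*2 by rewrite -muln2 exprM sqr_ge0.
have h := cvg_gaussian (exprn_measurable k.*2) x0.
rewrite -(cvg_lim _ h)//; apply: lime_le; first exact: cvgP h.
by apply: nearW => n; exact: even_truncated_moment_le.
Qed.

Lemma gaussian_integrable k : P.-integrable setT (fun w => (xi w ^+ k)%:E).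
Proof.
have mX j : measurable_fun setT (fun w => (xi w ^+ j)%:E).
  by apply/measurable_EFinP; exact: measurable_funX.
have x0 (x : R) : 0 <= x ^+ k.*2 by rewrite -muln2 exprM sqr_ge0.
apply: (@le_integrable _ _ _ P setT measurableT _ (fun w => (1 + xi w ^+ k.*2)%:E)) => //.
  move=> w _; rewrite /= lee_fin [leRHS]ger0_norm ?addr_ge0//.
  rewrite normrX -mul2n mulnC exprM -real_normK ?num_real//.
  rewrite -normrX; move: (`|_|) (normr_ge0 (xi w ^+ k)) => y y0; nra.
have -> : (fun w => (1 + xi w ^+ k.*2)%:E) = (fun w => 1%:E + (xi w ^+ k.*2)%:E)%E by [].
apply: integrableD => //; first exact: finite_measure_integrable_cst.
apply/integrableP; split => //.
under eq_integral do rewrite abse_EFin ger0_norm//.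
by apply: le_lt_trans (gaussian_even_moment_le k) _; rewrite ltry.
Qed.

(** The exact value, unlike the upper bounds above, requires the boundary term [a * phi a] to vanish
    in the limit. *)
Lemma gaussian_variance : (\int[P]_w (xi w ^+ 2)%:E = (s ^+ 2)%:E)%E.
Proof.
have x0 (x : R) : 0 <= x ^+ 2 by rewrite sqr_ge0.
have h := cvg_gaussian (exprn_measurable 2) x0.
have h1 : (truncated_moment s 0 n.+1%:R @[n --> \oo] --> 1)%E.
  have x00 (x : R) : 0 <= x ^+ 0 by rewrite expr0.
  have := cvg_gaussian (exprn_measurable 0) x00.
  have -> : (\int[P]_w (xi w ^+ 0)%:E = 1)%E.
    under eq_integral do rewrite expr0.
    by rewrite integral_cst// mul1e; exact: probability_setT.
  by [].
(* Decay is obtained without estimating the exponential: the truncated fourth moment is nonnegative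
   and the second is at most [s ^+ 2], so the recursion gives [2 * a ^+ 3 * phi a <= 3 * s ^+ 2]. *)
have tail : n.+1%:R * phi n.+1%:R @[n --> \oo] --> (0 : R).
  apply: (@squeeze_cvgr _ _ _ _ (cst 0) (fun n => (3 / 2 * s ^+ 2) * harmonic n)).
  - near=> n; rewrite mulr_ge0 ?normal_pdf_ge0//= /harmonic.
    have n0 : (0 : R) < n.+1%:R by [].
    have := @even_truncated_moment_le _ s s0 1 _ n0.
    have := truncated_moment_rec s0 2 n0.
    have : (0 <= truncated_moment s 4 n.+1%:R)%E.
      apply: integral_ge0 => x _; rewrite lee_fin mulr_ge0 ?normal_pdf_ge0//.
      by rewrite (exprM x 2 2) sqr_ge0.
    move=> + E4; rewrite E4 => A +.
    have : (0 <= truncated_moment s 2 n.+1%:R)%E.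
      by apply: integral_ge0 => x _; rewrite lee_fin mulr_ge0 ?normal_pdf_ge0.
    move: A; rewrite -[1.*2]/2%N.
    case: (truncated_moment s 2 n.+1%:R) => [r| |]//=.
    rewrite -EFinM -EFinB !lee_fin => A r0 B; move: A r0 B.
    rewrite big_ord_recr big_ord0/= !mul1n !mul1r.
    move: (phi _) (normal_pdf_ge0 0 s n.+1%:R) => p p0 A r0 B.
    have n1 : (1 : R) <= n.+1%:R by rewrite ler1n.
    move: (n.+1%:R : R) n0 n1 A => N N0 N1 A.
    have s2 : 0 < s ^+ 2 by rewrite exprn_gt0.
    rewrite ler_pdivlMr//.
    have E : s ^+ 2 * (N ^+ 3 - (- N) ^+ 3) * p = s ^+ 2 * (2 * N ^+ 3 * p) by ring.
    move: A; rewrite E => A.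
    have : 2 * N ^+ 3 * p <= 3 * s ^+ 2.
      rewrite -(ler_pM2l s2); nra.
    rewrite !exprS expr0 mulr1; nra.
  - exact: cvg_cst.
  - rewrite -[X in _ --> X](mulr0 (3 / 2 * s ^+ 2)).
    by apply: cvgM; [exact: cvg_cst|exact: cvg_harmonic].
apply: (cvg_unique _ h) => //.
have -> : (fun n => \int[mu]_(x in `[(- n.+1%:R)%R, n.+1%:R%R]) (x ^+ 2 * phi x)%:E)%E =
  (fun n => (s ^+ 2)%:E * truncated_moment s 0 n.+1%:R
    + ((- 2 * s ^+ 2) * (n.+1%:R * phi n.+1%:R))%:E)%E.
  apply/funext => n; rewrite -/(truncated_moment s 2 n.+1%:R) truncated_moment_rec//.
  by rewrite mul1r; congr (_ + _)%E; rewrite -EFinN; congr EFin; ring.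
have -> : (s ^+ 2)%:E = ((s ^+ 2)%:E * 1 + 0)%E by rewrite mule1 adde0.
have T0 : ((- 2 * s ^+ 2) * (n.+1%:R * phi n.+1%:R))%:E @[n --> \oo] --> 0%E.
  apply/fine_cvgP; split; first by apply: nearW.
  have := cvgM (@cvg_cst _ (- 2 * s ^+ 2) _ _ _) tail; rewrite mulr0; exact.
rewrite (_ : (fun n => _) = (fun n : nat => (s ^+ 2)%:E * truncated_moment s 0 n.+1%:R
    + ((- 2 * s ^+ 2) * (n.+1%:R * phi n.+1%:R))%:E)%E); last first.
  by apply/funext => n; rewrite mule1 adde0.
by apply: cvgeD => //; apply: cvgeZl.
Unshelve. all: by end_near.
Qed.

(** [cvg_gaussian] covers nonnegative integrands only, so the mean is extracted from the square
    [(x + 1) ^+ 2], whose cross term has truncated integral 0. *)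
Lemma gaussian_mean : (\int[P]_w (xi w)%:E = 0)%E.
Proof.
have x0 (x : R) : 0 <= (x + 1) ^+ 2 by rewrite sqr_ge0.
have m1 : measurable_fun setT (fun x : R => (x + 1) ^+ 2).
  by apply: measurable_funX; exact: measurable_funD.
have h := cvg_gaussian m1 x0.
have h2 := cvg_gaussian (exprn_measurable 2) (fun x => sqr_ge0 x).
have x00 (x : R) : 0 <= x ^+ 0 by rewrite expr0.
have h0 := cvg_gaussian (exprn_measurable 0) x00.
have im (k : nat) (a : R) : mu.-integrable `[(- a)%R, a%R] (fun x => (x ^+ k * phi x)%:E).
  exact: integrable_truncated_moment.
have E (n : nat) : (\int[mu]_(x in `[(- n.+1%:R)%R, n.+1%:R%R]) ((x + 1) ^+ 2 * phi x)%:E =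
    truncated_moment s 2 n.+1%:R + truncated_moment s 0 n.+1%:R)%E.
  rewrite -[X in (X + _)%E]adde0 -(@truncated_moment1 _ s s0 n.+1%:R)//.
  rewrite -[X in (_ + X + _)%E]adde0 -(@truncated_moment1 _ s s0 n.+1%:R)//.
  rewrite /truncated_moment -integralD//=.
  rewrite -integralD//=; last exact: integrableD.
  rewrite -integralD//=; last by apply: integrableD => //; exact: integrableD.
  by apply: eq_integral => x _; rewrite -!EFinD; congr EFin; ring.
have : (\int[P]_w ((xi w + 1) ^+ 2)%:E =
  \int[P]_w (xi w ^+ 2)%:E + \int[P]_w (xi w ^+ 0)%:E)%E.
  apply: (cvg_unique _ h) => //.
  rewrite (_ : (fun n => _) = (fun n : nat => truncated_moment s 2 n.+1%:R + truncated_moment s 0 n.+1%:R)%E).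
    by apply: cvgeD => //; rewrite gaussian_variance.
  by apply/funext => n; exact: E.
have i1 : P.-integrable setT (fun w => (xi w)%:E) := gaussian_integrable 1.
have i2 := gaussian_integrable 2.
have i0 := gaussian_integrable 0.
have -> : (\int[P]_w ((xi w + 1) ^+ 2)%:E = \int[P]_w (xi w ^+ 2)%:E +
    (\int[P]_w (xi w)%:E + \int[P]_w (xi w)%:E) + \int[P]_w (xi w ^+ 0)%:E)%E.
  rewrite -integralD// -integralD//; last exact: integrableD.
  rewrite -integralD//; last by apply: integrableD => //; exact: integrableD.
  by apply: eq_integral => w _; rewrite -!EFinD; congr EFin; ring.
rewrite gaussian_variance.
move: (integrable_fin_num measurableT i1) (integrable_fin_num measurableT i0).
case: (\int[P]_w (xi w)%:E)%E => // r _; case: (\int[P]_w (xi w ^+ 0)%:E)%E => // q _.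
by rewrite -!EFinD => -[] ?; congr EFin; lra.
Qed.
End gaussian_random_variable.

(** * Independence of the past *)

Section product_expectation.
Context d (Omega : measurableType d) (R : realType) (P : probability Omega R).
Variables U V : {RV P >-> R}.
Hypothesis UV : forall A C : set R, measurable A -> measurable C ->
  P (U @^-1` A `&` V @^-1` C) = (P (U @^-1` A) * P (V @^-1` C))%E.
Hypothesis iU : P.-integrable setT (EFin \o U).
Hypothesis iV : P.-integrable setT (EFin \o V).

Let mUV : measurable_fun setT (fun w => (U w, V w)).
Proof. exact: measurable_fun_pair. Qed.

Let joint : {RV P >-> (R * R)%type} :=
  HB.pack (fun w => (U w, V w)) (isMeasurableFun.Build _ _ _ _ _ mUV).

Let jointE (X : set (R * R)) : measurable X ->
  (distribution P U \x distribution P V)%E X = distribution P joint X.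
Proof.
by move=> mX; apply: product_measure_unique => // A C mA mC; exact: UV.
Qed.

Let mprod : measurable_fun setT (fun x : R * R => (x.1 * x.2)%:E).
Proof. by apply/measurable_EFinP; exact: measurable_funM. Qed.

Let int_joint (f : R * R -> \bar R) : measurable_fun setT f -> (forall x, 0 <= f x)%E ->
  (\int[distribution P U \x distribution P V]_x f x = \int[P]_w f (U w, V w))%E.
Proof.
move=> mf f0; rewrite -(@ge0_integral_distribution _ _ _ _ _ P joint)//.
by apply: eq_measure_integral => X mX _; exact: jointE.
Qed.

Lemma integrable_indep_mul : P.-integrable setT (fun w => (U w * V w)%:E).
Proof.
apply/integrableP; split.
  by apply/measurable_EFinP; exact: measurable_funM.
have mabs : measurable_fun setT (fun x : R * R => `|(x.1 * x.2)%:E|)%E.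
  exact: measurableT_comp.
rewrite -(int_joint mabs)// fubini_tonelli1//=.
rewrite /fubini_F/=.
have mabs1 (D : set R) : measurable_fun D (fun x : R => (`|x|)%:E).
  by apply/measurable_EFinP; exact: measurable_funTS.
under eq_integral => x _.
  under eq_integral do rewrite normrM EFinM.
  rewrite ge0_integralZl//; over.
rewrite /= ge0_integralZr//; last exact: integral_ge0.
have idist (X : {RV P >-> R}) :
    (\int[distribution P X]_x (`|x|)%:E = \int[P]_w (`|X w|)%:E)%E.
  by rewrite (@ge0_integral_distribution _ _ _ _ _ P X (fun x : R => (`|x|)%:E)).
rewrite !idist.
by apply: lte_mul_pinfty; rewrite ?integral_ge0 ?ge0_fin_numE ?integral_ge0//;
  case/integrableP: iU => _ //; case/integrableP: iV.
Qed.

Let iprod : (distribution P U \x distribution P V)%E.-integrable setT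
  (fun x : R * R => (x.1 * x.2)%:E).
Proof.
apply/integrableP; split => //.
have mabs : measurable_fun setT (fun x : R * R => `|(x.1 * x.2)%:E|)%E.
  exact: measurableT_comp.
by rewrite int_joint//; case/integrableP: integrable_indep_mul.
Qed.

Lemma integral_indep_mul :
  (\int[P]_w (U w * V w)%:E = \int[P]_w (U w)%:E * \int[P]_w (V w)%:E)%E.
Proof.
have := @integral_distribution _ _ _ _ _ P joint _ mprod integrable_indep_mul.
rewrite /comp/= => <-.
rewrite -(eq_measure_integral (distribution P joint) (fun X mX _ => jointE mX)).
rewrite -integral12_prod_meas1//= /fubini_F/=.
have idE (X : {RV P >-> R}) : P.-integrable setT (EFin \o X) ->
    (distribution P X).-integrable setT (fun x : R => x%:E).
  move=> iX; apply: integrable_pushforward => //; exact/measurable_EFinP.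
have ide (X : {RV P >-> R}) : P.-integrable setT (EFin \o X) ->
    (\int[distribution P X]_x x%:E = \int[P]_w (X w)%:E)%E.
  by move=> iX; rewrite integral_distribution.
under eq_integral => x _.
  under eq_integral do rewrite EFinM.
  rewrite integralZl//; last exact: idE.
  rewrite ide//; over.
rewrite /= -(fineK (integrable_fin_num measurableT iV)) integralZr//; last exact: idE.
by rewrite ide.
Qed.

End product_expectation.

Section past.
Context d (Omega : measurableType d) (R : realType) (P : probability Omega R).
Variable g : nat -> {RV P >-> R}.

(** The cylinder events of the first [i] noises: a pi-system containing the whole space, as the
    uniqueness theorem for finite measures in [past_indep] demands. The sets [A j] with [j >= i] do
    not enter the intersection. *)
Definition past (i : nat) : set (set Omega) :=
  [set \bigcap_(j in `I_i) (g j @^-1` A j)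
     | A in [set A : nat -> set R | forall j, measurable (A j)]].

Definition adapted (i : nat) (U : Omega -> R) :=
  measurable_fun setT (U : g_sigma_algebraType (past i) -> R).

Lemma past_measurable i : past i `<=` measurable.
Proof.
move=> _ [A mA <-]; apply: bigcap_measurableType => j _.
by rewrite -[X in measurable X]setTI; exact: measurable_funP.
Qed.

Lemma sigma_past_measurable i : <<s past i>> `<=` measurable.
Proof. exact: smallest_sub (@sigma_algebra_measurable _ _) (@past_measurable i). Qed.

Lemma adapted_measurable i U : adapted i U -> measurable_fun setT U.
Proof.
by move=> aU _ A mA; apply: (@sigma_past_measurable i); exact: aU.
Qed.

Lemma past_setT i : past i setT.
Proof.
exists (fun=> setT) => //; apply/seteqP; split => // w _ j _ //.
Qed.

Lemma past_setI i : setI_closed (past i).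
Proof.
move=> _ _ [A mA <-] [A' mA' <-]; exists (fun j => A j `&` A' j).
  by move=> j; exact: measurableI.
by rewrite -bigcapI; apply: eq_bigcapr => j _; rewrite preimage_setI.
Qed.

Lemma past_le i : past i `<=` past i.+1.
Proof.
move=> _ [A mA <-]; exists (fun j => if (j < i)%N then A j else setT).
  by move=> j /=; case: ifP.
apply/seteqP; split => w H j /= ji.
  by have := H j (ltnW ji); rewrite ji.
by case: ifPn => // /H.
Qed.

Lemma adapted_noise i : adapted i.+1 (g i).
Proof.
move=> _ A mA; apply: sub_sigma_algebra; rewrite setTI.
exists (fun j => if j == i then A else setT).
  by move=> j /=; case: ifP.
apply/seteqP; split => w /=; first by move=> /(_ i (ltnSn i)); rewrite eqxx.
by move=> gA j _; case: eqP => // ->.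
Qed.

Hypothesis g_indep : forall k, mutually_independent P (fun j : 'I_k => g j : Omega -> R).

(** As functions of [E], both sides are finite measures that agree on the pi-system of cylinders,
    hence on the generated sigma-algebra. *)
Lemma past_indep i E (C : set R) : <<s past i>> E -> measurable C ->
  P (E `&` g i @^-1` C) = (P E * P (g i @^-1` C))%E.
Proof.
move=> sE mC.
have mgC : measurable (g i @^-1` C).
  by rewrite -[X in measurable X]setTI; exact: measurable_funP.
have Pfin : P (g i @^-1` C) \is a fin_num by exact: fin_num_measure.
have c0 : 0 <= fine (P (g i @^-1` C)) by rewrite fine_ge0.
have := @g_sigma_algebra_measure_unique _ R _ (past i) (@past_measurable i)
  (fun _ => setT) (fun _ => past_setT i) _ (mrestr P mgC)
  (mscale (NngNum c0) P) (@past_setI i).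
move=> H; transitivity (mscale (NngNum c0) P E); last first.
  by rewrite /mscale/= fineK// muleC.
apply: H => //.
- by apply/seteqP; split => // w _; exists 0%N.
- move=> _ [A mA <-].
  (* The event on the noise [i] is appended as the last of [i.+1] coordinates, so that the two
     product rules, for [i] and for [i.+1] factors, can be compared. *)
  have mAC (k : 'I_i.+1) : measurable (if (k < i)%N then A k else C) by case: ifP.
  have := g_indep mAC; rewrite big_ord_recr/= ltnn => H1.
  have H0 := @g_indep i (fun j => A j) (fun j => mA j).
  rewrite /mrestr /mscale/= fineK// muleC.
  transitivity (P (\bigcap_(k : 'I_i.+1) (g k @^-1` (if (k < i)%N then A k else C)))).
    congr (P _); apply/seteqP; split => w /=.
      move=> [HA HC] k _ /=; case: ifPn => [ki|]; first exact: HA.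
      by rewrite -leqNgt => ik; have -> : (k : nat) = i by apply/eqP; rewrite eqn_leq ik -ltnS ltn_ord.
    move=> H; split; last by have /= := H ord_max I; rewrite ltnn.
    move=> k /= ki; have := H (Ordinal (ltn_trans ki (ltnSn i))) I.
    by rewrite /= ki.
  rewrite H1; congr (_ * _)%E.
  transitivity (P (\bigcap_(k : 'I_i) (g k @^-1` A k))).
    by rewrite H0; apply: eq_bigr => k _; rewrite ltn_ord.
  congr (P _); apply/seteqP; split => w H k.
    by move=> /= ki; exact: (H (Ordinal ki) I).
  by move=> _; apply: H => /=.
- move=> _; change (P (setT `&` g i @^-1` C) < +oo)%E.
  by rewrite setTI ltey_eq Pfin.
Qed.

Lemma adapted_indep i (U : {RV P >-> R}) (f : R -> R) (fg : {RV P >-> R}) :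
  adapted i U -> measurable_fun setT f -> (forall w, fg w = f (g i w)) ->
  forall A C : set R, measurable A -> measurable C ->
  P (U @^-1` A `&` fg @^-1` C) = (P (U @^-1` A) * P (fg @^-1` C))%E.
Proof.
move=> aU mf fgE A C mA mC.
have -> : fg @^-1` C = g i @^-1` (f @^-1` C).
  by apply/seteqP; split => w /=; rewrite fgE.
rewrite past_indep//; last by rewrite -[X in measurable X]setTI; exact: mf.
by have := aU measurableT A mA; rewrite setTI.
Qed.
End past.

(** * The Euler chain and one-step expansions *)

Section chain.
Context {R : realType} (kappa : R).

Local Notation state := (R * R * R * R)%type.

(* A state is (t, b, s, a) with b the driving noise; st_u is sigma (X - Y), st_x
   is sigma X, hence sigma Y = - 1 - 2 s. *)
Definition st_t (z : state) : R := z.1.1.1.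
Definition st_b (z : state) : R := z.1.1.2.
Definition st_s (z : state) : R := z.1.2.
Definition st_a (z : state) : R := z.2.
Definition st_u (z : state) : R :=
  2 + Num.sqrt kappa * st_b z - (4 - kappa) * st_s z.
Definition st_x (z : state) : R := st_u z - 1 - 2 * st_s z.
Definition st_c (z : state) : R := st_u z / 2 - 1 - 2 * st_s z.

(* The time step is del ^+ 2 and the noise g is normalised to variance 1. *)
Definition step (del g : R) (z : state) : state :=
  (st_t z + del ^+ 2, st_b z + del * g, st_s z + del ^+ 2 / st_u z,
   st_a z + 2 * st_x z * del ^+ 2).

Definition next (eps del g : R) (z : state) : state :=
  if st_u z <= eps then z else step del g z.

(** [u ^+ 2], [b ^+ 2] and [K] scale like time and [a ^+ 2] like its cube, whence the exponent 3 in
    [lyapunov]. As [s] is affine in [u] and [b], and [t] stays below [K], the whole state is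
    controlled. *)
Definition weight (K : R) (z : state) : R := K + st_u z ^+ 2 + st_b z ^+ 2.
Definition lyapunov (K : R) (z : state) : R := weight K z ^+ 3 + st_a z ^+ 2.

Lemma step_u (del g : R) (z : state) : st_u (step del g z) =
  st_u z + (Num.sqrt kappa * (del * g) - (4 - kappa) * (del ^+ 2 / st_u z)).
Proof.
by rewrite /step; move: (_ / _) => v; rewrite /st_u /st_b /st_s/=; ring.
Qed.

Lemma measurable_st_t : measurable_fun setT st_t.
Proof. exact: measurableT_comp (measurableT_comp measurable_fst measurable_fst) measurable_fst. Qed.
Lemma measurable_st_b : measurable_fun setT st_b.
Proof. exact: measurableT_comp (measurableT_comp measurable_snd measurable_fst) measurable_fst. Qed.
Lemma measurable_st_s : measurable_fun setT st_s.
Proof. exact: measurableT_comp measurable_snd measurable_fst. Qed.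
Lemma measurable_st_a : measurable_fun setT st_a.
Proof. exact: measurable_snd. Qed.

Lemma measurable_st_u : measurable_fun setT st_u.
Proof.
apply: measurable_funB; first apply: measurable_funD => //.
  by apply: measurable_funM => //; exact: measurable_st_b.
by apply: measurable_funM => //; exact: measurable_st_s.
Qed.

Lemma measurable_st_x : measurable_fun setT st_x.
Proof.
apply: measurable_funB; first apply: measurable_funB => //; first exact: measurable_st_u.
by apply: measurable_funM => //; exact: measurable_st_s.
Qed.

Lemma measurable_inv_u : measurable_fun setT (fun z => (st_u z)^-1).
Proof.
(* The inverse is rewritten through [powR] applied to the nonnegative [u ^+ 2], which is measurable;
   both sides are 0 at [u = 0]. *)
have -> : (fun z => (st_u z)^-1) = (fun z => st_u z * (st_u z ^+ 2) `^ (-1)).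
  apply/funext => z; rewrite powR_inv1 ?sqr_ge0//.
  have [->|u0] := eqVneq (st_u z) 0; first by rewrite invr0 mul0r.
  by field.
apply: measurable_funM; first exact: measurable_st_u.
apply: (measurableT_comp (measurable_powR _)).
by apply: measurable_funX; exact: measurable_st_u.
Qed.

Section expansions.
Variables (eps K : R).
Hypotheses (eps0 : 0 < eps) (K1 : 1 <= K).

Definition valid (z : state) := [&& eps < st_u z, 0 <= st_t z & st_t z <= K].

Lemma weight_ge z : K <= weight K z.
Proof. by rewrite /weight -addrA lerDl addr_ge0// sqr_ge0. Qed.

Lemma lyapunov_ge1 z : 1 <= lyapunov K z.
Proof.
have w1 : 1 <= weight K z by rewrite (le_trans K1)// weight_ge.
by rewrite /lyapunov -[leLHS]addr0 lerD ?sqr_ge0// exprn_ege1.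
Qed.

(** Polynomial growth. The constants may depend on [eps] and [K] but not on [del]; the base is at
    least 1, so that exponents can be added for sums as well as for products. *)
Definition bounded (F : state -> R -> R -> R) := exists C : R, exists k : nat,
  0 <= C /\ forall (z : state) (g del : R), valid z -> 0 < del <= 1 ->
    `|F z g del| <= C * (lyapunov K z * (1 + `|g|)) ^+ k.

Lemma base_ge1 (z : state) (g : R) : 1 <= lyapunov K z * (1 + `|g|).
Proof. by apply: mulr_ege1; [exact: lyapunov_ge1|rewrite lerDl]. Qed.

Lemma bounded_cst (c : R) : bounded (fun _ _ _ => c).
Proof.
exists `|c|, 0%N; split => // z g del _ _.
by rewrite expr0 mulr1.
Qed.

Lemma bounded_add F H : bounded F -> bounded H ->
  bounded (fun z g del => F z g del + H z g del).
Proof.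
move=> [C [k [C0 HF]]] [C' [k' [C'0 HH]]].
exists (C + C'), (k + k')%N; split; first exact: addr_ge0.
move=> z g del vz d01; rewrite (le_trans (ler_normD _ _))// mulrDl lerD//.
  rewrite (le_trans (HF _ _ _ vz d01))// ler_wpM2l// ler_weXn2l ?leq_addr//.
  exact: base_ge1.
rewrite (le_trans (HH _ _ _ vz d01))// ler_wpM2l// ler_weXn2l ?leq_addl//.
exact: base_ge1.
Qed.

Lemma bounded_mul F H : bounded F -> bounded H ->
  bounded (fun z g del => F z g del * H z g del).
Proof.
move=> [C [k [C0 HF]]] [C' [k' [C'0 HH]]].
exists (C * C'), (k + k')%N; split; first exact: mulr_ge0.
move=> z g del vz d01; rewrite normrM exprD mulrACA ler_pM//.
  exact: HF.
exact: HH.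
Qed.

Lemma bounded_le F H : bounded H ->
  (forall (z : state) (g del : R), valid z -> 0 < del <= 1 -> `|F z g del| <= `|H z g del|) ->
  bounded F.
Proof.
move=> [C [k [C0 HH]]] FH; exists C, k; split => // z g del vz d01.
exact: le_trans (FH _ _ _ vz d01) (HH _ _ _ vz d01).
Qed.

Lemma bounded_opp F : bounded F -> bounded (fun z g del => - F z g del).
Proof. by move=> bF; apply: bounded_le bF _ => z g del _ _; rewrite normrN. Qed.

Lemma bounded_noise : bounded (fun _ g _ => g).
Proof.
exists 1, 1%N; split => // z g del _ _; rewrite mul1r expr1.
have := lyapunov_ge1 z; have := normr_ge0 g; nra.
Qed.

Lemma bounded_del : bounded (fun _ _ del => del).
Proof.
apply: (bounded_le (bounded_cst 1)) => z g del _ /andP[d0 d1].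
by rewrite normr1 gtr0_norm.
Qed.

Lemma bounded_exp F n : bounded F -> bounded (fun z g del => F z g del ^+ n).
Proof.
move=> bF; elim: n => [|n IH]; first exact: bounded_cst.
apply: (bounded_le (bounded_mul bF IH)) => z g del _ _.
by rewrite exprS.
Qed.

Definition tame (f : state -> R) :=
  measurable_fun setT f /\ bounded (fun z _ _ => f z).

Lemma tame_cst c : tame (fun=> c).
Proof. by split => //; exact: bounded_cst. Qed.
Lemma tame_add f h : tame f -> tame h -> tame (fun z => f z + h z).
Proof.
by move=> [mf bf] [mh bh]; split; [exact: measurable_funD|exact: bounded_add].
Qed.
Lemma tame_mul f h : tame f -> tame h -> tame (fun z => f z * h z).
Proof.
by move=> [mf bf] [mh bh]; split; [exact: measurable_funM|exact: bounded_mul].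
Qed.
Lemma tame_opp f : tame f -> tame (fun z => - f z).
Proof.
move=> [mf bf]; split; last exact: bounded_opp.
by apply: measurableT_comp => //.
Qed.

Lemma weight_le_lyapunov z : weight K z <= lyapunov K z.
Proof.
have w1 : 1 <= weight K z by rewrite (le_trans K1)// weight_ge.
have := sqr_ge0 (st_a z); rewrite /lyapunov; nra.
Qed.

Lemma bounded_sqr F (C : R) :
  (forall (z : state) (g del : R), valid z -> 0 < del <= 1 -> F z g del ^+ 2 <= C * lyapunov K z) ->
  bounded F.
Proof.
move=> H; exists (1 + `|C|), 1%N; split; first by rewrite addr_ge0.
move=> z g del vz d01; have := H z g del vz d01.
have := lyapunov_ge1 z; have := normr_ge0 g; rewrite expr1.
rewrite -(real_normK (num_real (F z g del))).
move: (normr_ge0 (F z g del)) (ler_norm C) (normr_ge0 C).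
move: `|F z g del| `|C| `|g| (lyapunov K z) => f c h L f0 cC c0 h0 L1 fL.
have fle : f <= (1 + c) * L.
  have : f ^+ 2 <= ((1 + c) * L) ^+ 2.
    rewrite (le_trans fL)// exprMn.
    apply: (@le_trans _ _ (c * L)); first by rewrite ler_wpM2r// (le_trans _ L1).
    have A : c <= (1 + c) ^+ 2 by nra.
    have B : L <= L ^+ 2 by nra.
    by rewrite ler_pM// (le_trans _ L1).
  by rewrite ler_sqr// nnegrE// mulr_ge0// ?addr_ge0// (le_trans _ L1).
rewrite (le_trans fle)// ler_wpM2l ?addr_ge0//; nra.
Qed.

Lemma bounded_st_u : bounded (fun z _ _ => st_u z).
Proof.
apply: (@bounded_sqr _ 1) => z g del vz d01; rewrite mul1r.
apply: le_trans (weight_le_lyapunov z).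
by rewrite /weight addrAC lerDr addr_ge0 ?sqr_ge0// (le_trans ler01).
Qed.

Lemma bounded_st_b : bounded (fun z _ _ => st_b z).
Proof.
apply: (@bounded_sqr _ 1) => z g del vz d01; rewrite mul1r.
apply: le_trans (weight_le_lyapunov z).
by rewrite /weight lerDr addr_ge0 ?sqr_ge0// (le_trans ler01).
Qed.

Lemma bounded_st_a : bounded (fun z _ _ => st_a z).
Proof.
apply: (@bounded_sqr _ 1) => z g del vz d01; rewrite mul1r /lyapunov lerDr exprn_ge0//.
by rewrite (le_trans _ (weight_ge z))// (le_trans _ K1).
Qed.

Lemma bounded_st_t : bounded (fun z _ _ => st_t z).
Proof.
apply: (bounded_le (bounded_cst K)) => z g del /and3P[_ t0 tK] _.
by rewrite !ger0_norm// (le_trans t0).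
Qed.

Lemma bounded_inv_u : bounded (fun z _ _ => (st_u z)^-1).
Proof.
apply: (bounded_le (bounded_cst eps^-1)) => z g del /and3P[ue _ _] _.
have u0 : 0 < st_u z by exact: lt_trans ue.
by rewrite !gtr0_norm ?invr_gt0// lef_pV2// ltW.
Qed.

Hypothesis k4 : kappa < 4.

Lemma bounded_st_s : bounded (fun z _ _ => st_s z).
Proof.
have -> : (fun z _ _ => st_s z) = (fun (z : state) (_ _ : R) =>
   (2 + Num.sqrt kappa * st_b z + - st_u z) * (4 - kappa)^-1).
  apply/funext => z; apply/funext => _; apply/funext => _.
  by rewrite /st_u; field; rewrite gt_eqF// subr_gt0.
apply: bounded_mul; last exact: bounded_cst.
apply: bounded_add; last by apply: bounded_opp; exact: bounded_st_u.
apply: bounded_add; first exact: bounded_cst.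
by apply: bounded_mul; [exact: bounded_cst|exact: bounded_st_b].
Qed.

Lemma tame_t : tame st_t. Proof. by split; [exact: measurable_st_t|exact: bounded_st_t]. Qed.
Lemma tame_s : tame st_s. Proof. by split; [exact: measurable_st_s|exact: bounded_st_s]. Qed.
Lemma tame_a : tame st_a. Proof. by split; [exact: measurable_st_a|exact: bounded_st_a]. Qed.
Lemma tame_u : tame st_u. Proof. by split; [exact: measurable_st_u|exact: bounded_st_u]. Qed.
Lemma tame_inv_u : tame (fun z => (st_u z)^-1).
Proof. by split; [exact: measurable_inv_u|exact: bounded_inv_u]. Qed.

Lemma tame_x : tame st_x.
Proof.
apply: tame_add; first by apply: tame_add; [exact: tame_u|exact: tame_cst].
by apply: tame_opp; apply: tame_mul; [exact: tame_cst|exact: tame_s].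
Qed.

(* f1 is the coefficient of the martingale part and G is the generator applied
   to f; the f3 term has mean 0 because the noise has variance 1. *)
Definition ito_expansion (f f1 G f3 : state -> R) (r : state -> R -> R -> R) z g del :=
  f z + del * (g * f1 z) + del ^+ 2 * (G z + (g ^+ 2 - 1) * f3 z) + del ^+ 3 * r z g del.

(** An exact one-step expansion with a controlled remainder of order [del ^+ 3], in place of Ito's
    formula. The class is closed under sums and products, hence contains all polynomials in the
    coordinates. *)
Definition ito (f f1 G : state -> R) :=
  [/\ tame f, tame f1, tame G & exists2 f3, tame f3 & exists2 r, bounded r &
    forall (z : state) (g del : R), valid z -> 0 < del <= 1 ->
      f (step del g z) = ito_expansion f f1 G f3 r z g del].

(** The square root has no exact finite expansion but lies below a cubic polynomial, and an upper
    estimate is all that a supermartingale needs. *)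
Definition ito_le (f f1 G : state -> R) :=
  [/\ tame f, tame f1, tame G & exists2 f3, tame f3 & exists2 r, bounded r &
    forall (z : state) (g del : R), valid z -> 0 < del <= 1 ->
      f (step del g z) <= ito_expansion f f1 G f3 r z g del].

Lemma ito_itole f f1 G : ito f f1 G -> ito_le f f1 G.
Proof.
move=> [tf t1 tG [f3 t3 [r br E]]]; split => //; exists f3 => //; exists r => //.
by move=> z g del vz d01; rewrite E.
Qed.

Lemma ito_cst c : ito (fun=> c) (fun=> 0) (fun=> 0).
Proof.
split; try exact: tame_cst; exists (fun=> 0); first exact: tame_cst.
exists (fun _ _ _ => 0); first exact: bounded_cst.
by move=> z g del _ _; rewrite /ito_expansion; ring.
Qed.

Lemma ito_add f f1 G h h1 H : ito f f1 G -> ito h h1 H ->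
  ito (fun z => f z + h z) (fun z => f1 z + h1 z) (fun z => G z + H z).
Proof.
move=> [tf t1 tG [f3 t3 [r br E]]] [th t1' tH [h3 t3' [r' br' E']]].
split; try exact: tame_add.
exists (fun z => f3 z + h3 z); first exact: tame_add.
exists (fun z g del => r z g del + r' z g del); first exact: bounded_add.
by move=> z g del vz d01; rewrite E// E'// /ito_expansion; ring.
Qed.

Definition mul_remainder (f f1 G f3 : state -> R) r (h h1 H h3 : state -> R) r'
    (z : state) (g del : R) : R :=
  f z * r' z g del + h z * r z g del
  + (g * f1 z) * (H z + (g ^+ 2 - 1) * h3 z) + (g * h1 z) * (G z + (g ^+ 2 - 1) * f3 z)
  + del * ((g * f1 z) * r' z g del + (g * h1 z) * r z g del
           + (G z + (g ^+ 2 - 1) * f3 z) * (H z + (g ^+ 2 - 1) * h3 z))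
  + del ^+ 2 * ((G z + (g ^+ 2 - 1) * f3 z) * r' z g del
                + (H z + (g ^+ 2 - 1) * h3 z) * r z g del)
  + del ^+ 3 * (r z g del * r' z g del).

Lemma bounded_mul_remainder f f1 G f3 r h h1 H h3 r' :
  tame f -> tame f1 -> tame G -> tame f3 -> bounded r ->
  tame h -> tame h1 -> tame H -> tame h3 -> bounded r' ->
  bounded (mul_remainder f f1 G f3 r h h1 H h3 r').
Proof.
move=> [_ bf] [_ bf1] [_ bG] [_ bf3] br [_ bh] [_ bh1] [_ bH] [_ bh3] br'.
have bg := bounded_noise.
have bd := bounded_del.
have bgg : bounded (fun _ g _ => g ^+ 2 - 1).
  by apply: bounded_add (bounded_cst _); exact: bounded_exp.
have b1 : bounded (fun z g _ => g * f1 z) by exact: bounded_mul.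
have b1' : bounded (fun z g _ => g * h1 z) by exact: bounded_mul.
have b2 : bounded (fun z g _ => G z + (g ^+ 2 - 1) * f3 z).
  by apply: bounded_add => //; exact: bounded_mul.
have b2' : bounded (fun z g _ => H z + (g ^+ 2 - 1) * h3 z).
  by apply: bounded_add => //; exact: bounded_mul.
rewrite /mul_remainder.
apply: bounded_add; last first.
  by apply: bounded_mul; [exact: bounded_exp|exact: bounded_mul].
apply: bounded_add; last first.
  apply: bounded_mul; first exact: bounded_exp.
  by apply: bounded_add; exact: bounded_mul.
apply: bounded_add; last first.
  apply: bounded_mul => //; apply: bounded_add; last exact: bounded_mul.
  by apply: bounded_add; exact: bounded_mul.
apply: bounded_add; last exact: bounded_mul.
apply: bounded_add; last exact: bounded_mul.
by apply: bounded_add; exact: bounded_mul.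
Qed.

(** The product of the two noise terms contains [g ^+ 2 = 1 + (g ^+ 2 - 1)]: the 1 is the Ito
    correction [f1 * h1] of the generator, and the centred part joins the [f3] terms. *)
Lemma mul_ito_expansion f f1 G f3 r h h1 H h3 r' z g del :
  ito_expansion f f1 G f3 r z g del * ito_expansion h h1 H h3 r' z g del =
  ito_expansion (fun z => f z * h z) (fun z => f z * h1 z + h z * f1 z)
    (fun z => f z * H z + h z * G z + f1 z * h1 z)
    (fun z => f z * h3 z + h z * f3 z + f1 z * h1 z)
    (mul_remainder f f1 G f3 r h h1 H h3 r') z g del.
Proof. by rewrite /ito_expansion /mul_remainder; ring. Qed.

Lemma ito_mul f f1 G h h1 H : ito f f1 G -> ito h h1 H ->
  ito (fun z => f z * h z) (fun z => f z * h1 z + h z * f1 z)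
    (fun z => f z * H z + h z * G z + f1 z * h1 z).
Proof.
move=> [tf t1 tG [f3 t3 [r br E]]] [th t1' tH [h3 t3' [r' br' E']]].
split.
- exact: tame_mul.
- by apply: tame_add; exact: tame_mul.
- by apply: tame_add; [apply: tame_add|]; exact: tame_mul.
- exists (fun z => f z * h3 z + h z * f3 z + f1 z * h1 z).
    by apply: tame_add; [apply: tame_add|]; exact: tame_mul.
  exists (mul_remainder f f1 G f3 r h h1 H h3 r').
    exact: bounded_mul_remainder.
  by move=> z g del vz d01; rewrite E// E'// mul_ito_expansion.
Qed.

Lemma ito_le_mul f f1 G h h1 H : ito f f1 G ->
  (forall (z : state) (g del : R), valid z -> 0 < del <= 1 -> 0 <= f (step del g z)) ->
  ito_le h h1 H ->
  ito_le (fun z => f z * h z) (fun z => f z * h1 z + h z * f1 z)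
    (fun z => f z * H z + h z * G z + f1 z * h1 z).
Proof.
move=> [tf t1 tG [f3 t3 [r br E]]] f0 [th t1' tH [h3 t3' [r' br' E']]].
split.
- exact: tame_mul.
- by apply: tame_add; exact: tame_mul.
- by apply: tame_add; [apply: tame_add|]; exact: tame_mul.
- exists (fun z => f z * h3 z + h z * f3 z + f1 z * h1 z).
    by apply: tame_add; [apply: tame_add|]; exact: tame_mul.
  exists (mul_remainder f f1 G f3 r h h1 H h3 r').
    exact: bounded_mul_remainder.
  move=> z g del vz d01; rewrite -mul_ito_expansion -E//.
  by apply: ler_wpM2l; [exact: f0|exact: E'].
Qed.

Lemma ito_t : ito st_t (fun=> 0) (fun=> 1).
Proof.
split; try exact: tame_cst; first exact: tame_t.
exists (fun=> 0); first exact: tame_cst.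
exists (fun _ _ _ => 0); first exact: bounded_cst.
by move=> z g del _ _; rewrite /ito_expansion {1}/st_t/=; ring.
Qed.

Lemma ito_s : ito st_s (fun=> 0) (fun z => (st_u z)^-1).
Proof.
split; [exact: tame_s|exact: tame_cst|exact: tame_inv_u|].
exists (fun=> 0); first exact: tame_cst.
exists (fun _ _ _ => 0); first exact: bounded_cst.
by move=> z g del _ _; rewrite /ito_expansion {1}/st_s/=; ring.
Qed.

Lemma ito_a : ito st_a (fun=> 0) (fun z => 2 * st_x z).
Proof.
split; [exact: tame_a|exact: tame_cst| |].
  by apply: tame_mul; [exact: tame_cst|exact: tame_x].
exists (fun=> 0); first exact: tame_cst.
exists (fun _ _ _ => 0); first exact: bounded_cst.
by move=> z g del _ _; rewrite /ito_expansion {1}/st_a/=; ring.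
Qed.

End expansions.
End chain.

(** * Lyapunov functions *)

Section lyapunov_functions.
Context {R : realType} (kappa : R).
Hypotheses (k0 : 0 < kappa) (k4 : kappa < 4).
Local Notation state := (R * R * R * R)%type.
Local Notation step := (step kappa).
Local Notation st_u := (st_u kappa).
Local Notation st_x := (st_x kappa).

(* Unlike the expansions above, these estimates are uniform in eps. K is the time
   horizon, so that the normalised increment del / sqrt K is summed at most
   K / del ^+ 2 times. *)
Definition lyap_remainder (F F1 : R -> state -> R) (K : R) (z : state) (g del : R) :=
  F K (step del g z) - F K z - del / Num.sqrt K * (g * F1 K z).

(** The hypothesis of a discrete Gronwall argument: apart from a term linear in the noise, of mean
    0, a step changes [F] by at most [del ^+ 2 / K] times [F], up to moments of the noise. The
    condition [del <= st_u z] takes the place of constants depending on [eps]: it bounds the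
    singular increment [del ^+ 2 / u] by [del]. *)
Definition lyap (F : R -> state -> R) :=
  [/\ forall K, measurable_fun setT (F K), forall K z, 1 <= K -> 0 <= F K z &
    exists2 F1 : R -> state -> R, (forall K, measurable_fun setT (F1 K)) &
    exists C : R, exists k : nat, [/\ 0 <= C,
      forall K z, 1 <= K -> `|F1 K z| <= C * F K z &
      forall (K : R) (z : state) (g del : R), 1 <= K -> 0 < del <= 1 -> del <= st_u z ->
        `|lyap_remainder F F1 K z g del| <= del ^+ 2 / K * (C * (1 + `|g|) ^+ k * F K z)]].

Lemma sqrt_ratio (K del : R) : 1 <= K -> 0 < del <= 1 ->
  [/\ 0 < del / Num.sqrt K, del / Num.sqrt K <= 1 & (del / Num.sqrt K) ^+ 2 = del ^+ 2 / K].
Proof.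
move=> K1 /andP[d0 d1]; have K0 : 0 < K by rewrite (lt_le_trans _ K1).
have s1 : 1 <= Num.sqrt K by rewrite -sqrtr1 ler_sqrt// ltW.
have s0 : 0 < Num.sqrt K by rewrite sqrtr_gt0.
split; first exact: divr_gt0.
  by rewrite ler_pdivrMr// mul1r (le_trans d1).
by rewrite expr_div_n sqr_sqrtr// ltW.
Qed.

Lemma lyap_cst (c : R) : 0 <= c -> lyap (fun _ _ => c).
Proof.
move=> c0; split => //; exists (fun _ _ => 0) => //; exists 0, 0%N; split => //.
  by move=> K z _; rewrite normr0 mul0r.
move=> K z g del K1 d01 _.
by rewrite /lyap_remainder !mulr0 subrr subr0 normr0 !mul0r mulr0.
Qed.

Lemma lyap_mul F H : lyap F -> lyap H -> lyap (fun K z => F K z * H K z).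
Proof.
move=> [mF F0 [F1 mF1 [C [k [C0 bF1 bF]]]]] [mH H0 [H1 mH1 [C' [k' [C'0 bH1 bH]]]]].
split; first by move=> K; exact: measurable_funM.
  by move=> K z K1; rewrite mulr_ge0 ?F0 ?H0.
exists (fun K z => F K z * H1 K z + H K z * F1 K z).
  by move=> K; apply: measurable_funD; exact: measurable_funM.
exists (C + C' + 4 * (C * C')), (k.+1 + k'.+1)%N; split.
- by rewrite !addr_ge0// !mulr_ge0.
- move=> K z K1; rewrite (le_trans (ler_normD _ _))// !normrM.
  rewrite (ger0_norm (F0 K z K1)) (ger0_norm (H0 K z K1)).
  move: (F0 K z K1) (H0 K z K1) (bF1 K z K1) (bH1 K z K1).
  move: (F K z) (H K z) => f h f0 h0 A B.
  have {}A := ler_wpM2l h0 A; have {}B := ler_wpM2l f0 B.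
  have CC : 0 <= C * C' * (f * h) by rewrite !mulr_ge0.
  by rewrite (le_trans (lerD B A))//; nra.
move=> K z g del K1 d01 du.
have [r0 r1 rE] := sqrt_ratio K1 d01.
move: (bF K z g del K1 d01 du) (bH K z g del K1 d01 du).
rewrite /lyap_remainder -rE; move: r0 r1; move: (del / Num.sqrt K) => r r0 r1.
move: (F0 K z K1) (H0 K z K1) (bF1 K z K1) (bH1 K z K1).
move: (F K z) (H K z) (F1 K z) (H1 K z) (F K (step del g z)) (H K (step del g z)).
move=> f h f1 h1 f' h' f0 h0 A B.
set P := 1 + `|g|; have P1 : 1 <= P by rewrite lerDl.
have P0 : 0 <= P by rewrite (le_trans ler01).
have gP : `|g| <= P by rewrite lerDr.
move rfE : (f' - f - _) => rf; move rhE : (h' - h - _) => rh Af Bh.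
have f'E : f' = f + r * (g * f1) + rf by rewrite -rfE; ring.
have h'E : h' = h + r * (g * h1) + rh by rewrite -rhE; ring.
(* Each of the six terms carries at least [r ^+ 2]; surplus factors [r <= 1] are dropped in the
   estimates. *)
have -> : f' * h' - f * h - r * (g * (f * h1 + h * f1)) =
    f * rh + h * rf + r ^+ 2 * ((g * f1) * (g * h1))
    + r * ((g * f1) * rh) + r * ((g * h1) * rf) + rf * rh.
  by rewrite f'E h'E; ring.
set N := C * P ^+ k.+1; set N' := C' * P ^+ k'.+1.
have N0 : 0 <= N by rewrite mulr_ge0// exprn_ge0.
have N'0 : 0 <= N' by rewrite mulr_ge0// exprn_ge0.
have r2 : 0 <= r ^+ 2 by exact: sqr_ge0.
have rf_le : `|rf| <= r ^+ 2 * (N * f).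
  rewrite (le_trans Af)// ler_wpM2l// ler_wpM2r// ler_wpM2l// ler_weXn2l//.
have rh_le : `|rh| <= r ^+ 2 * (N' * h).
  rewrite (le_trans Bh)// ler_wpM2l// ler_wpM2r// ler_wpM2l// ler_weXn2l//.
have gf_le : `|g * f1| <= N * f.
  rewrite normrM (le_trans (ler_pM _ _ gP A))//.
  rewrite mulrCA mulrA ler_wpM2r// ler_wpM2l// exprS ler_peMr// exprn_ege1//.
have gh_le : `|g * h1| <= N' * h.
  rewrite normrM (le_trans (ler_pM _ _ gP B))//.
  rewrite mulrCA mulrA ler_wpM2r// ler_wpM2l// exprS ler_peMr// exprn_ege1//.
have T1 : `|f * rh| <= r ^+ 2 * (N' * (f * h)).
  rewrite normrM (ger0_norm f0) (le_trans (ler_wpM2l f0 rh_le))//.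
  by rewrite le_eqVlt; apply/orP; left; apply/eqP; ring.
have T2 : `|h * rf| <= r ^+ 2 * (N * (f * h)).
  rewrite normrM (ger0_norm h0) (le_trans (ler_wpM2l h0 rf_le))//.
  by rewrite le_eqVlt; apply/orP; left; apply/eqP; ring.
have T3 : `|r ^+ 2 * ((g * f1) * (g * h1))| <= r ^+ 2 * (N * N' * (f * h)).
  rewrite normrM (ger0_norm r2) ler_wpM2l// normrM.
  rewrite (le_trans (ler_pM _ _ gf_le gh_le))//.
  by rewrite le_eqVlt; apply/orP; left; apply/eqP; ring.
have NN : 0 <= N * N' * (f * h) by apply: mulr_ge0; exact: mulr_ge0.
have T4 : `|r * ((g * f1) * rh)| <= r ^+ 2 * (N * N' * (f * h)).
  rewrite normrM (ger0_norm (ltW r0)) normrM.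
  apply: (@le_trans _ _ (1 * (N * f * (r ^+ 2 * (N' * h))))).
    by apply: ler_pM; [exact: ltW|exact: mulr_ge0|exact: r1|exact: ler_pM].
  by rewrite le_eqVlt; apply/orP; left; apply/eqP; ring.
have T5 : `|r * ((g * h1) * rf)| <= r ^+ 2 * (N * N' * (f * h)).
  rewrite normrM (ger0_norm (ltW r0)) normrM.
  apply: (@le_trans _ _ (1 * (N' * h * (r ^+ 2 * (N * f))))).
    by apply: ler_pM; [exact: ltW|exact: mulr_ge0|exact: r1|exact: ler_pM].
  by rewrite le_eqVlt; apply/orP; left; apply/eqP; ring.
have T6 : `|rf * rh| <= r ^+ 2 * (N * N' * (f * h)).
  rewrite normrM (le_trans (ler_pM _ _ rf_le rh_le))//.
  have r21 : r ^+ 2 <= 1 by rewrite expr_le1// ltW.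
  have -> : r ^+ 2 * (N * f) * (r ^+ 2 * (N' * h)) = r ^+ 2 * (r ^+ 2 * (N * N' * (f * h))) by ring.
  by rewrite ler_piMl// mulr_ge0.
apply: (@le_trans _ _ (r ^+ 2 * ((N + N' + 4 * (N * N')) * (f * h)))).
  have -> : r ^+ 2 * ((N + N' + 4 * (N * N')) * (f * h)) =
   r ^+ 2 * (N' * (f * h)) + r ^+ 2 * (N * (f * h)) + r ^+ 2 * (N * N' * (f * h))
    + r ^+ 2 * (N * N' * (f * h)) + r ^+ 2 * (N * N' * (f * h)) + r ^+ 2 * (N * N' * (f * h)).
    by ring.
  by do 5! (rewrite (le_trans (ler_normD _ _))// lerD//).
apply: ler_wpM2l => //; apply: ler_wpM2r; first exact: mulr_ge0.
have Q1 : 1 <= P ^+ k.+1 by exact: exprn_ege1.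
have Q1' : 1 <= P ^+ k'.+1 by exact: exprn_ege1.
rewrite /N /N' exprD !mulrDl !lerD//.
- by rewrite ler_wpM2l// ler_peMr// (le_trans ler01).
- by rewrite ler_wpM2l// ler_peMl// (le_trans ler01).
all: by rewrite le_eqVlt; apply/orP; left; apply/eqP; ring.
Qed.

Lemma lyap_exp F n : lyap F -> lyap (fun K z => F K z ^+ n).
Proof.
move=> lF; elim: n => [|n IH]; first exact: lyap_cst.
have -> : (fun K z => F K z ^+ n.+1) = (fun K z => F K z * F K z ^+ n).
  by apply/funext => K; apply/funext => z; rewrite exprS.
exact: lyap_mul.
Qed.

Let sk0 : 0 <= Num.sqrt kappa. Proof. exact: sqrtr_ge0. Qed.
Let sk2 : Num.sqrt kappa <= 2.
Proof.
have <- : Num.sqrt (2 ^+ 2) = 2 :> R by rewrite sqrtr_sqr ger0_norm.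
by rewrite ler_sqrt ?sqr_ge0// expr2; move: k4; lra.
Qed.

(** In the increment of [u ^+ 2] the singular drift is multiplied by [2 * u] and becomes the
    constant [- 2 * (4 - kappa) * del ^+ 2]. The linear term is absorbed by the inequality between
    means, applied to [Num.sqrt K] and [|u|] or [|b|]. *)
Lemma lyap_weight : lyap (weight kappa).
Proof.
have mw K : measurable_fun setT (weight kappa K).
  apply: measurable_funD; first apply: measurable_funD => //.
    by apply: measurable_funX; exact: measurable_st_u.
  by apply: measurable_funX; exact: measurable_st_b.
split => //.
  by move=> K z K1; apply: le_trans (weight_ge _ _ _); rewrite (le_trans ler01).
exists (fun K z => Num.sqrt K * (2 * Num.sqrt kappa * st_u z + 2 * st_b z)).
  move=> K; apply: measurable_funM => //; apply: measurable_funD.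
    by apply: measurable_funM => //; exact: measurable_st_u.
  by apply: measurable_funM => //; exact: measurable_st_b.
(* The remainder costs 16 for the square of the increment of [u], 1 for that of [b] and at most 8
   for the drift, and the linear coefficient costs 3; 30 leaves a margin. *)
exists 30, 2%N; split => //.
- move=> K z K1; have K0 : 0 <= K by rewrite (le_trans ler01).
  rewrite normrM (ger0_norm (sqrtr_ge0 K)).
  have := sqr_sqrtr K0; move: (sqrtr_ge0 K); rewrite /weight.
  move: (Num.sqrt K) => q q0 qE.
  have : `|2 * Num.sqrt kappa * st_u z + 2 * st_b z| <= 4 * `|st_u z| + 2 * `|st_b z|.
    rewrite (le_trans (ler_normD _ _))// !normrM (ger0_norm sk0) ger0_norm//.
    rewrite lerD2r ler_wpM2r//.
    by apply: (@le_trans _ _ (2 * 2)); [rewrite ler_wpM2l|rewrite -natrM].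
  rewrite -(real_normK (num_real (st_u z))) -(real_normK (num_real (st_b z))).
  move: (`|_ + _|) (`|st_u z|) (`|st_b z|) (normr_ge0 (st_u z)) (normr_ge0 (st_b z)) => l u b u0 b0 lub.
  rewrite (le_trans (ler_wpM2l q0 lub))// -qE.
  have := sqr_ge0 (q - u); have := sqr_ge0 (q - b); nra.
move=> K z g del K1 d01 du.
have [r0 r1 rE] := sqrt_ratio K1 d01.
have K0 : 0 < K by rewrite (lt_le_trans _ K1).
have q0 : Num.sqrt K != 0 by rewrite gt_eqF// sqrtr_gt0.
case/andP: (d01) => d0 d1.
have u0 : 0 < st_u z by rewrite (lt_le_trans d0).
rewrite /lyap_remainder {1}/weight step_u.
set h := Num.sqrt kappa * (del * g) - (4 - kappa) * (del ^+ 2 / st_u z).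
have -> : st_b (step del g z) = st_b z + del * g by [].
have -> : K + (st_u z + h) ^+ 2 + (st_b z + del * g) ^+ 2 - weight kappa K z -
   del / Num.sqrt K * (g * (Num.sqrt K * (2 * Num.sqrt kappa * st_u z + 2 * st_b z)))
  = h ^+ 2 + del ^+ 2 * g ^+ 2 - 2 * (4 - kappa) * del ^+ 2.
  rewrite /weight /h; field; rewrite q0 gt_eqF//.
have dv0 : 0 <= del / st_u z by rewrite divr_ge0// ltW.
have dv : del / st_u z <= 1 by rewrite ler_pdivrMr// mul1r.
have hE : h = del * (Num.sqrt kappa * g - (4 - kappa) * (del / st_u z)).
  by rewrite /h; ring.
have hle : `|Num.sqrt kappa * g - (4 - kappa) * (del / st_u z)| <= 4 * (1 + `|g|).
  rewrite (le_trans (ler_normB _ _))// !normrM (ger0_norm sk0).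
  have k40 : 0 <= 4 - kappa by rewrite subr_ge0 ltW.
  rewrite (ger0_norm k40) -normrM (ger0_norm dv0).
  have A : Num.sqrt kappa * `|g| <= 2 * `|g| by rewrite ler_wpM2r.
  have B : (4 - kappa) * (del / st_u z) <= 4 * 1.
    by apply: ler_pM => //; rewrite gerBl ltW.
  have := normr_ge0 g; lra.
have : `|h ^+ 2 + del ^+ 2 * g ^+ 2 - 2 * (4 - kappa) * del ^+ 2| <= del ^+ 2 * (30 * (1 + `|g|) ^+ 2).
  rewrite hE exprMn -(real_normK (num_real (_ * g - _))) -(real_normK (num_real g)).
  move: hle (normr_ge0 g) (normr_ge0 (Num.sqrt kappa * g - (4 - kappa) * (del / st_u z))).
  move: (`|_ - _|) (`|g|) => y x yx x0 y0.
  have y2 : y ^+ 2 <= 16 * (1 + x) ^+ 2 by nra.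
  have d2 : 0 <= del ^+ 2 by exact: sqr_ge0.
  have -> : del ^+ 2 * y ^+ 2 + del ^+ 2 * x ^+ 2 - 2 * (4 - kappa) * del ^+ 2 =
    del ^+ 2 * (y ^+ 2 + x ^+ 2 - 2 * (4 - kappa)) by ring.
  have Q1 : 1 <= (1 + x) ^+ 2 by rewrite exprn_ege1// lerDl.
  have Qx : x ^+ 2 <= (1 + x) ^+ 2 by rewrite ler_sqr ?nnegrE ?lerDr// addr_ge0.
  have y20 : 0 <= y ^+ 2 by exact: sqr_ge0.
  have x20 : 0 <= x ^+ 2 by exact: sqr_ge0.
  move: k0 k4 => k0' k4'.
  by rewrite normrM (ger0_norm d2) ler_wpM2l// ler_norml; apply/andP; split; lra.
move=> /le_trans; apply; rewrite -mulrA ler_wpM2l ?sqr_ge0//.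
have p0 : 0 <= (1 + `|g|) ^+ 2 by exact: sqr_ge0.
rewrite [leRHS](_ : _ = 30 * (1 + `|g|) ^+ 2 * (weight kappa K z / K)); last by ring.
by rewrite ler_peMr ?mulr_ge0// ler_pdivlMr// mul1r weight_ge.
Qed.

(** Once [s] is eliminated, [x] is affine in [u] and [b], and the square of a sum of three terms is
    at most 3 times the sum of the squares. *)
Lemma st_x_le : exists2 C : R, 0 <= C & forall K (z : state), 1 <= K ->
  st_x z ^+ 2 <= C * weight kappa K z.
Proof.
pose a := (4 - kappa)^-1.
have a0 : 0 < a by rewrite invr_gt0 subr_gt0.
(* [M] dominates the coefficients [1 + 2 * a], [1 + 4 * a] and [2 * a * Num.sqrt kappa <= 4 * a]. *)
pose M := 2 + 6 * a.
have M0 : 0 <= M by rewrite /M; nra.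
exists (3 * M ^+ 2) => [|K z K1]; first by rewrite mulr_ge0// sqr_ge0.
have xE : st_x z = (1 + 2 * a) * st_u z - (1 + 4 * a) - 2 * a * Num.sqrt kappa * st_b z.
  have -> : st_x z = st_u z - 1 - 2 * ((2 + Num.sqrt kappa * st_b z - st_u z) * a).
    by rewrite /(st_x) /(st_u) /a; field; rewrite gt_eqF// subr_gt0.
  by ring.
have xle : `|st_x z| <= M * (`|st_u z| + 1 + `|st_b z|).
  have -> : M * (`|st_u z| + 1 + `|st_b z|) = M * `|st_u z| + M + M * `|st_b z| by ring.
  rewrite xE (le_trans (ler_normB _ _))// lerD//.
    rewrite (le_trans (ler_normB _ _))// lerD//.
      rewrite normrM ler_wpM2r// ger0_norm /M; nra.
    rewrite ger0_norm /M; nra.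
  rewrite normrM ler_wpM2r// ger0_norm /M; last by rewrite !mulr_ge0// ltW.
  have : 2 * a * Num.sqrt kappa <= 2 * a * 2 by rewrite ler_wpM2l// mulr_ge0// ltW.
  by move=> /le_trans; apply; lra.
rewrite /weight -(real_normK (num_real (st_x z))) -(real_normK (num_real (st_u z))) -(real_normK (num_real (st_b z))).
move: xle (normr_ge0 (st_x z)).
move: (`|st_x z|) (`|st_u z|) (`|st_b z|) => x u b xle x0.
have : x ^+ 2 <= (M * (u + 1 + b)) ^+ 2.
  by rewrite ler_sqr// nnegrE (le_trans _ xle).
move=> /le_trans; apply; rewrite exprMn.
  rewrite [leRHS](_ : _ = M ^+ 2 * (3 * (K + u ^+ 2 + b ^+ 2))); last by ring.
rewrite ler_wpM2l ?sqr_ge0//.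
have := sqr_ge0 (u - b); have := sqr_ge0 (u - 1); have := sqr_ge0 (b - 1); nra.
Qed.

(** The increment of [a] contains no noise, so the martingale part is that of [weight ^+ 3]. With
    [del ^+ 2 = r ^+ 2 * K], the change of [a ^+ 2] is controlled by [a ^+ 2] and [(K * x) ^+ 2],
    and the latter by [weight ^+ 3], because both [K] and [x ^+ 2] are of the order of the weight at
    most. *)
Lemma lyap_lyapunov : lyap (lyapunov kappa).
Proof.
have [mW W0 [W1 mW1 [C [k [C0 bW1 bW]]]]] := lyap_exp 3 lyap_weight.
have [D D0 xD] := st_x_le.
split.
- move=> K; apply: measurable_funD; first exact: mW.
  by apply: measurable_funX; exact: measurable_st_a.
- by move=> K z K1; rewrite addr_ge0 ?sqr_ge0//; exact: W0.
exists W1 => //; exists (C + (2 + 6 * D)), k; split.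
- by rewrite !addr_ge0// mulr_ge0.
- move=> K z K1; rewrite (le_trans (bW1 K z K1))// mulrDl /lyapunov.
  have := W0 K z K1; have := sqr_ge0 (st_a z); move: (_ ^+ 3) (_ ^+ 2) => w a a0 w0.
  have : 0 <= C * a by rewrite mulr_ge0.
  have : 0 <= (2 + 6 * D) * (w + a) by rewrite mulr_ge0 ?addr_ge0// mulr_ge0.
  nra.
move=> K z g del K1 d01 du.
have [r0 r1 rE] := sqrt_ratio K1 d01.
have K0 : 0 < K by rewrite (lt_le_trans _ K1).
case/andP: (d01) => d0 d1.
have -> : lyap_remainder (lyapunov kappa) W1 K z g del =
   lyap_remainder (fun K z => weight kappa K z ^+ 3) W1 K z g del +
   (4 * st_a z * (st_x z * del ^+ 2) + 4 * (st_x z * del ^+ 2) ^+ 2).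
  by rewrite /lyap_remainder /lyapunov {2}/st_a/=; ring.
rewrite (le_trans (ler_normD _ _))//.
have -> : del ^+ 2 / K * ((C + (2 + 6 * D)) * (1 + `|g|) ^+ k * lyapunov kappa K z) =
  del ^+ 2 / K * (C * (1 + `|g|) ^+ k * lyapunov kappa K z) +
  del ^+ 2 / K * ((2 + 6 * D) * (1 + `|g|) ^+ k * lyapunov kappa K z) by ring.
apply: lerD.
  rewrite (le_trans (bW K z g del K1 d01 du))//.
  rewrite ler_wpM2l ?divr_ge0 ?sqr_ge0 ?(ltW K0)//.
  by rewrite ler_wpM2l ?mulr_ge0 ?exprn_ge0 ?addr_ge0// /lyapunov lerDl sqr_ge0.
have dE : del ^+ 2 = (del / Num.sqrt K) ^+ 2 * K by rewrite rE mulfVK// gt_eqF.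
rewrite -rE; rewrite dE; move: (del / Num.sqrt K) r0 r1 => r r0 r1.
have P1 : 1 <= (1 + `|g|) ^+ k by rewrite exprn_ege1// lerDl.
apply: (@le_trans _ _ (r ^+ 2 * ((2 + 6 * D) * lyapunov kappa K z))); last first.
  rewrite ler_wpM2l ?sqr_ge0// ler_wpM2r//.
    by rewrite (le_trans ler01)// lyapunov_ge1.
  by rewrite ler_peMr// addr_ge0// mulr_ge0.
have w0 := weight_ge kappa K z.
have xK : K ^+ 2 * st_x z ^+ 2 <= D * weight kappa K z ^+ 3.
  have E : K ^+ 2 <= weight kappa K z ^+ 2 by rewrite ler_sqr ?nnegrE// ?ltW// (lt_le_trans K0).
  rewrite (le_trans (ler_pM _ _ E (xD K z K1)))// ?sqr_ge0//.
  by rewrite le_eqVlt; apply/orP; left; apply/eqP; ring.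
have -> : 4 * st_a z * (st_x z * (r ^+ 2 * K)) + 4 * (st_x z * (r ^+ 2 * K)) ^+ 2 =
  r ^+ 2 * (4 * (st_a z * (K * st_x z)) + 4 * r ^+ 2 * (K ^+ 2 * st_x z ^+ 2)) by ring.
rewrite normrM ger0_norm ?sqr_ge0// ler_wpM2l ?sqr_ge0//.
rewrite (le_trans (ler_normD _ _))//.
have T1 : `|4 * (st_a z * (K * st_x z))| <= 2 * (st_a z ^+ 2 + K ^+ 2 * st_x z ^+ 2).
  rewrite -exprMn; move: (st_a z) (K * st_x z) => p q.
  rewrite ler_norml; have := sqr_ge0 (p - q); have := sqr_ge0 (p + q); nra.
have r21 : r ^+ 2 <= 1 by rewrite expr_le1// ltW.
have T2 : `|4 * r ^+ 2 * (K ^+ 2 * st_x z ^+ 2)| <= 4 * (K ^+ 2 * st_x z ^+ 2).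
  rewrite ger0_norm; last by rewrite -exprMn mulr_ge0 ?sqr_ge0// mulr_ge0// sqr_ge0.
  rewrite [leLHS](_ : _ = r ^+ 2 * (4 * (K ^+ 2 * st_x z ^+ 2))); last by ring.
  by rewrite ler_piMl// mulr_ge0// -exprMn sqr_ge0.
rewrite (le_trans (lerD T1 T2))// /lyapunov.
have a2 := sqr_ge0 (st_a z).
have w3 : 0 <= weight kappa K z ^+ 3 by rewrite exprn_ge0// (le_trans (ltW K0)).
move: xK (sqr_ge0 (K * st_x z)); rewrite exprMn; move: (_ * _ ^+ 2) (st_a z ^+ 2) a2 (weight kappa K z ^+ 3) w3 => q a a0 w w3 qw q0.
have : 0 <= D * a by rewrite mulr_ge0.
nra.
Qed.

End lyapunov_functions.

(** * Expectations along the chain *)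

Section expectation_calculus.
Context d (Omega : measurableType d) (R : realType) (P : probability Omega R).

Definition integ (f : Omega -> R) := P.-integrable setT (EFin \o f).

Lemma integ_measurable f : integ f -> measurable_fun setT f.
Proof. by move=> /measurable_int/measurable_EFinP. Qed.

Lemma integ_cst (c : R) : integ (fun=> c).
Proof. by apply: finite_measure_integrable_cst. Qed.

Lemma integ_le (f h : Omega -> R) : measurable_fun setT f -> integ h ->
  (forall w, `|f w| <= `|h w|) -> integ f.
Proof.
move=> mf ih fh; apply: le_integrable ih => //; first exact/measurable_EFinP.
by move=> w _; rewrite /= lee_fin.
Qed.

Lemma integD (f h : Omega -> R) : integ f -> integ h -> integ (fun w => f w + h w).
Proof. by move=> jf jh; have H := integrableD measurableT jf jh; exact: H. Qed.

Lemma integB (f h : Omega -> R) : integ f -> integ h -> integ (fun w => f w - h w).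
Proof. by move=> jf jh; have H := integrableB measurableT jf jh; exact: H. Qed.

Lemma integZ (c : R) (f : Omega -> R) : integ f -> integ (fun w => c * f w).
Proof. by move=> jf; have H := integrableZl measurableT c jf; exact: H. Qed.

Lemma expect_cst (c : R) : \int[P]_w c = c.
Proof.
rewrite Rintegral_cst//; have -> : fine (P setT) = 1 by rewrite probability_setT.
by rewrite mulr1.
Qed.

Lemma ge0_integ_lty (f : Omega -> R) (c : R) : measurable_fun setT f -> (forall w, 0 <= f w) ->
  (\int[P]_w (f w)%:E <= c%:E)%E -> integ f.
Proof.
move=> mf f0 fc; apply/integrableP; split; first exact/measurable_EFinP.
by under eq_integral do rewrite /= ger0_norm//; rewrite (le_lt_trans fc)// ltry.
Qed.

Lemma integral_expect f : integ f -> (\int[P]_w (f w)%:E = (\int[P]_w f w)%:E)%E.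
Proof. by move=> jf; rewrite /Rintegral fineK//; exact: integrable_fin_num. Qed.

End expectation_calculus.

Section noise_expectation.
Context d (Omega : measurableType d) (R : realType) (P : probability Omega R).
Variables (g : nat -> {RV P >-> R}) (M : nat -> R).
Hypothesis g_indep : forall k, mutually_independent P (fun j : 'I_k => g j : Omega -> R).
Hypothesis g_moment : forall i k, (\int[P]_w ((1 + `|g i w|) ^+ k)%:E <= (M k)%:E)%E.
Hypothesis g_mean : forall i, (\int[P]_w (g i w)%:E = 0)%E.
Hypothesis g_variance : forall i, (\int[P]_w (g i w ^+ 2)%:E = 1)%E.
Local Notation integ := (integ P).

Lemma expect_adapted_mul i (U : Omega -> R) (f : R -> R) :
  adapted g i U -> integ U -> measurable_fun setT f -> integ (fun w => f (g i w)) ->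
  integ (fun w => U w * f (g i w)) /\
  \int[P]_w (U w * f (g i w)) = \int[P]_w U w * \int[P]_w f (g i w).
Proof.
move=> aU jU mf jf.
have mU := adapted_measurable aU.
have mfg : measurable_fun setT (fun w => f (g i w)) by exact: measurableT_comp.
pose U' : {RV P >-> R} := HB.pack U (isMeasurableFun.Build _ _ _ _ _ mU).
pose V' : {RV P >-> R} := HB.pack (fun w => f (g i w)) (isMeasurableFun.Build _ _ _ _ _ mfg).
have H := @adapted_indep _ _ _ P g g_indep i U' f V' aU mf (fun=> erefl).
have jUf := @integrable_indep_mul _ _ _ P U' V' H jU jf.
split; first exact: jUf.
rewrite /Rintegral; have := @integral_indep_mul _ _ _ P U' V' H jU jf.
by rewrite /= => ->; rewrite fineM//; exact: integrable_fin_num.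
Qed.

Lemma M_ge0 k : 0 <= M k.
Proof.
by rewrite -lee_fin (le_trans _ (g_moment 0 k))// integral_ge0// => w _; rewrite lee_fin exprn_ge0// addr_ge0.
Qed.

Lemma integ_moment i k : integ (fun w => (1 + `|g i w|) ^+ k).
Proof.
apply: (ge0_integ_lty _ _ (g_moment i k)) => [|w]; last by rewrite exprn_ge0// addr_ge0.
by apply: measurable_funX; apply: measurable_funD => //; exact: measurableT_comp.
Qed.

Lemma expect_moment_le i k : \int[P]_w ((1 + `|g i w|) ^+ k) <= M k.
Proof. by rewrite -lee_fin -integral_expect//; exact: integ_moment. Qed.

Lemma integ_noise i : integ (g i).
Proof.
apply: (integ_le _ (integ_moment i 1)) => // w.
by rewrite expr1 [leRHS]ger0_norm ?addr_ge0// lerDr.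
Qed.

Lemma integ_noise2 i : integ (fun w => g i w ^+ 2).
Proof.
apply: (integ_le _ (integ_moment i 2)) => [|w]; first exact: measurable_funX.
rewrite ger0_norm ?sqr_ge0// [leRHS]ger0_norm ?sqr_ge0//.
by rewrite -(real_normK (num_real (g i w))) ler_sqr ?nnegrE ?lerDr ?addr_ge0.
Qed.

Lemma expect_noise i : \int[P]_w g i w = 0.
Proof. by rewrite /Rintegral g_mean. Qed.

Lemma expect_noise2 i : \int[P]_w (g i w ^+ 2 - 1) = 0.
Proof.
rewrite RintegralB//; [|exact: integ_noise2|exact: integ_cst].
by rewrite expect_cst /Rintegral g_variance/= subrr.
Qed.

Lemma integ_noise2B i : integ (fun w => g i w ^+ 2 - 1).
Proof. by apply: integB; [exact: integ_noise2|exact: integ_cst]. Qed.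

Lemma expect_adapted_noise i U : adapted g i U -> integ U ->
  integ (fun w => U w * g i w) /\ \int[P]_w (U w * g i w) = 0.
Proof.
move=> aU jU; have [] := @expect_adapted_mul i U (fun x => x) aU jU _ (integ_noise i) => //.
by move=> ? ->; rewrite expect_noise mulr0.
Qed.

Lemma expect_adapted_noise2 i U : adapted g i U -> integ U ->
  integ (fun w => U w * (g i w ^+ 2 - 1)) /\ \int[P]_w (U w * (g i w ^+ 2 - 1)) = 0.
Proof.
move=> aU jU; have [] := @expect_adapted_mul i U (fun x => x ^+ 2 - 1) aU jU _ (integ_noise2B i).
  by apply: measurable_funB => //; exact: measurable_funX.
by move=> ? ->; rewrite expect_noise2 mulr0.
Qed.

Lemma expect_adapted_moment i U k : adapted g i U -> integ U -> (forall w, 0 <= U w) ->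
  integ (fun w => U w * (1 + `|g i w|) ^+ k) /\
  \int[P]_w (U w * (1 + `|g i w|) ^+ k) <= M k * \int[P]_w U w.
Proof.
move=> aU jU U0; have [] := @expect_adapted_mul i U (fun x => (1 + `|x|) ^+ k) aU jU _ (integ_moment i k).
  by apply: measurable_funX; apply: measurable_funD.
move=> ? ->; split => //; rewrite mulrC ler_wpM2r ?Rintegral_ge0//.
exact: expect_moment_le.
Qed.

Variable kappa : R.
Hypotheses (k0 : 0 < kappa) (k4 : kappa < 4).
Local Notation state := (R * R * R * R)%type.

Fixpoint proc (eps del : R) (z0 : state) (i : nat) (w : Omega) : state :=
  if i is j.+1 then next kappa eps del (g j w) (proc eps del z0 j w) else z0.

Section fixed_mesh.
Variables (eps del : R) (z0 : state).
Hypotheses (eps0 : 0 < eps) (d01 : 0 < del <= 1) (deps : del <= eps).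
Local Notation Z := (proc eps del z0).
Local Notation st_u := (st_u kappa).

Let running i w := eps < st_u (Z i w).

Lemma procS i w : Z i.+1 w =
  if running i w then step kappa del (g i w) (Z i w) else Z i w.
Proof. by rewrite /= /next /running ltNge; case: ifP. Qed.

Lemma proc_adapted i :
  measurable_fun setT (Z i : g_sigma_algebraType (past g i) -> state).
Proof.
elim: i => [|i IH]; first exact: measurable_cst.
have IH' : measurable_fun setT (Z i : g_sigma_algebraType (past g i.+1) -> state).
  move=> mT A mA; have h : <<s past g i>> (setT `&` Z i @^-1` A) := IH measurableT A mA.
  by apply: sub_sigma_algebra2 h; exact: past_le.
have mg : measurable_fun setT (g i : g_sigma_algebraType (past g i.+1) -> R).
  exact: adapted_noise.
have mc (f : state -> R) : measurable_fun setT f ->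
    measurable_fun setT (fun w : g_sigma_algebraType (past g i.+1) => f (Z i w)).
  by move=> mf; exact: measurableT_comp.
have mt := mc _ (@measurable_st_t R).
have mb := mc _ (@measurable_st_b R).
have ms := mc _ (@measurable_st_s R).
have ma := mc _ (@measurable_st_a R).
have mu := mc _ (measurable_st_u kappa).
have mx := mc _ (measurable_st_x kappa).
have mi := mc _ (measurable_inv_u kappa).
rewrite [Z i.+1](_ : _ = fun w => if running i w then step kappa del (g i w) (Z i w) else Z i w); last first.
  by apply/funext => w; exact: procS.
apply: measurable_fun_ifT => //; first by apply: measurable_fun_ltr.
rewrite /step; apply: measurable_fun_pair; first apply: measurable_fun_pair;
  first apply: measurable_fun_pair.
- by apply: measurable_funD.
- by apply: measurable_funD => //; apply: measurable_funM.
- by apply: measurable_funD => //; apply: measurable_funM.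
- by apply: measurable_funD => //; apply: measurable_funM => //; apply: measurable_funM.
Qed.

Lemma adapted_proc i (f : state -> R) : measurable_fun setT f -> adapted g i (fun w => f (Z i w)).
Proof. by move=> mf; apply: (measurableT_comp mf); exact: proc_adapted. Qed.

Lemma measurable_proc i (f : state -> R) : measurable_fun setT f -> measurable_fun setT (fun w => f (Z i w)).
Proof. move=> mf; exact (adapted_measurable (adapted_proc mf)). Qed.

Let ind i w : R := (running i w)%:R.

Lemma adapted_running i (f : state -> R) : measurable_fun setT f ->
  adapted g i (fun w => ind i w * f (Z i w)).
Proof.
move=> mf; pose h z : R := (if eps < st_u z then 1 else 0) * f z.
have mh : measurable_fun setT h.
  apply: measurable_funM => //; apply: measurable_fun_ifT => //.
  by apply: measurable_fun_ltr => //; exact: measurable_st_u.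
have -> : (fun w => ind i w * f (Z i w)) = (fun w => h (Z i w)).
  by apply/funext => w; rewrite /ind /h /running; case: ifP.
exact: adapted_proc.
Qed.

Lemma integ_running i (f : state -> R) : measurable_fun setT f -> integ (fun w => f (Z i w)) ->
  integ (fun w => ind i w * f (Z i w)).
Proof.
move=> mf jf; apply: (integ_le _ jf) => [|w].
  exact (adapted_measurable (adapted_running mf)).
by rewrite /ind; case: (running i w); rewrite ?mul1r// mul0r normr0.
Qed.

Lemma proc_time i : st_t z0 = 0 -> forall w,
  0 <= st_t (Z i w) <= i%:R * del ^+ 2.
Proof.
move=> t0 w; elim: i => [|i /andP[IH1 IH2]]; first by rewrite t0 mul0r lexx.
have d2 : 0 <= del ^+ 2 by exact: sqr_ge0.
rewrite procS; case: ifP => _.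
  by rewrite {1 2}/st_t/= addr_ge0//= -natr1 mulrDl mul1r lerD2r.
by rewrite IH1 (le_trans IH2)// ler_wpM2r// ler_nat.
Qed.

End fixed_mesh.

End noise_expectation.

(** * Estimates uniform over a family of noise sequences *)

Section noise_family.
Context d (Omega : measurableType d) (R : realType) (P : probability Omega R).
Variables (g : nat -> nat -> {RV P >-> R}) (M : nat -> R).
Hypothesis g_indep : forall nu k, mutually_independent P (fun j : 'I_k => g nu j : Omega -> R).
Hypothesis g_moment : forall nu i k, (\int[P]_w ((1 + `|g nu i w|) ^+ k)%:E <= (M k)%:E)%E.
Hypothesis g_mean : forall nu i, (\int[P]_w (g nu i w)%:E = 0)%E.
Hypothesis g_variance : forall nu i, (\int[P]_w (g nu i w ^+ 2)%:E = 1)%E.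
Variable kappa : R.
Hypotheses (k0 : 0 < kappa) (k4 : kappa < 4).
Local Notation state := (R * R * R * R)%type.
Local Notation integ := (integ P).

Let family_noise nu i U : adapted (g nu) i U -> integ U ->
  integ (fun w => U w * g nu i w) /\ \int[P]_w (U w * g nu i w) = 0.
Proof. exact: (expect_adapted_noise (g_indep nu) (g_moment nu) (g_mean nu)). Qed.

Let family_noise2 nu i U : adapted (g nu) i U -> integ U ->
  integ (fun w => U w * (g nu i w ^+ 2 - 1)) /\ \int[P]_w (U w * (g nu i w ^+ 2 - 1)) = 0.
Proof. exact: (expect_adapted_noise2 (g_indep nu) (g_moment nu) (g_variance nu)). Qed.

Let family_moment nu i U k : adapted (g nu) i U -> integ U -> (forall w, 0 <= U w) ->
  integ (fun w => U w * (1 + `|g nu i w|) ^+ k) /\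
  \int[P]_w (U w * (1 + `|g nu i w|) ^+ k) <= M k * \int[P]_w U w.
Proof. exact: (expect_adapted_moment (g_indep nu) (g_moment nu)). Qed.

(** Discrete Gronwall: each step multiplies the expectation by at most [1 + C * M k * del ^+ 2 / K],
    and at most [K / del ^+ 2] steps are made, so the product is at most [expR (C * M k)]. The
    constant is thus independent of [K], [eps], [del] and the noise sequence. *)
Lemma expect_lyap F : lyap kappa F -> exists2 C : R, 0 <= C &
  forall (K eps del : R) (z0 : state) (nu i : nat), 1 <= K -> 0 < eps -> 0 < del <= 1 ->
    del <= eps -> i%:R * del ^+ 2 <= K ->
    integ (fun w => F K (proc (g nu) kappa eps del z0 i w)) /\
    \int[P]_w F K (proc (g nu) kappa eps del z0 i w) <= C * F K z0.
Proof.
move=> [mF F0 [F1 mF1 [C [k [C0 bF1 bF]]]]].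
exists (expR (C * M k)) => [|K eps del z0 nu i K1 eps0 d01 deps]; first exact: expR_ge0.
have K0 : 0 < K by rewrite (lt_le_trans _ K1).
have [r0 r1 rE] := sqrt_ratio K1 d01.
set Z := proc (g nu) kappa eps del z0; set q := del ^+ 2 / K.
have q0 : 0 <= q by rewrite divr_ge0 ?sqr_ge0// ltW.
have CM0 : 0 <= C * M k by rewrite mulr_ge0// (M_ge0 (g_moment 0)).
suff H j : integ (fun w => F K (Z j w)) /\
    \int[P]_w F K (Z j w) <= (1 + C * M k * q) ^+ j * F K z0.
  move=> iK; have [jF HF] := H i; split => //.
  rewrite (le_trans HF)// ler_wpM2r ?F0//.
  have A : (1 + C * M k * q) ^+ i <= expR (C * M k * q) ^+ i.
    by rewrite lerXn2r ?nnegrE ?expR_ge0 ?expR_ge1Dx// addr_ge0// mulr_ge0.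
  rewrite (le_trans A)// -expRM_natl ler_expR.
  rewrite [leLHS](_ : _ = C * M k * (i%:R * del ^+ 2 / K)); last by rewrite /q; ring.
  by rewrite ler_piMr// ler_pdivrMr// mul1r.
elim: j => [|j [jF HF]].
  by split; [exact: (integ_cst P (F K z0))|rewrite /Z/= expect_cst expr0 mul1r].
have mZ := @measurable_proc _ _ _ P (g nu) kappa eps del z0.
pose U (w : Omega) : R := (eps < st_u kappa (Z j w))%R%:R * F1 K (Z j w).
have aU : adapted (g nu) j U by exact: (@adapted_running _ _ _ P (g nu) kappa eps del z0 j _ (mF1 K)).
have jF1 : integ (fun w => F1 K (Z j w)).
  apply: (integ_le _ (integZ C jF)) => [|w]; first exact: mZ.
  by rewrite [leRHS]ger0_norm ?bF1// mulr_ge0// F0.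
have jU : integ U by exact: (@integ_running _ _ _ P (g nu) kappa eps del z0 j _ (mF1 K) jF1).
have [jUg EUg] := family_noise aU jU.
have aF : adapted (g nu) j (fun w => F K (Z j w)) by exact: adapted_proc.
have [jFm EFm] := family_moment k aF jF (fun w => F0 K (Z j w) K1).
pose W w := F K (Z j w) + del / Num.sqrt K * (U w * g nu j w)
  + q * C * (F K (Z j w) * (1 + `|g nu j w|) ^+ k).
have jFU : integ (fun w => F K (Z j w) + del / Num.sqrt K * (U w * g nu j w)).
  by apply: integD => //; exact: integZ.
have jW : integ W by apply: integD => //; exact: integZ.
have FW w : F K (Z j.+1 w) <= W w.
  rewrite /Z procS -/Z /W /U; case: ifP => run; last first.
    rewrite !mul0r mulr0 addr0 lerDl; apply: mulr_ge0; first exact: mulr_ge0.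
    by apply: mulr_ge0; [exact: F0|rewrite exprn_ge0// addr_ge0].
  have := bF K (Z j w) (g nu j w) del K1 d01 (le_trans deps (ltW run)).
  rewrite /lyap_remainder mul1r ler_norml => /andP[_].
  rewrite -/q !lerBlDr [F1 _ _ * _]mulrC.
  move=> /le_trans; apply; rewrite le_eqVlt; apply/orP; left; apply/eqP; ring.
have jFS : integ (fun w => F K (Z j.+1 w)).
  apply: (integ_le _ jW) => [|w]; first exact: mZ.
  by rewrite ger0_norm ?F0// (le_trans (FW w))// ler_norm.
split => //.
apply: (@le_trans _ _ (\int[P]_w W w)); first by apply: le_Rintegral => // w _; exact: FW.
rewrite /W RintegralD//; last exact: integZ.
rewrite RintegralD//; last exact: integZ.
rewrite !RintegralZl// EUg mulr0 addr0.
apply: (@le_trans _ _ ((1 + C * M k * q) * \int[P]_w F K (Z j w))).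
  rewrite mulrDl mul1r lerD2l.
  rewrite [leRHS](_ : _ = q * C * (M k * \int[P]_w F K (Z j w))); last by ring.
  by rewrite ler_wpM2l// mulr_ge0.
by rewrite exprS -[leRHS]mulrA ler_wpM2l// addr_ge0// mulr_ge0.
Qed.

Section ito_formula.
Variables (eps K : R) (z0 : state).
Hypotheses (eps0 : 0 < eps) (K1 : 1 <= K) (t0 : st_t z0 = 0).

Lemma expect_lyapunov_noise k : exists2 C : R, 0 <= C & forall (del : R) (nu i : nat),
  0 < del <= 1 -> del <= eps -> i%:R * del ^+ 2 <= K ->
  [/\ integ (fun w => lyapunov kappa K (proc (g nu) kappa eps del z0 i w) ^+ k),
      integ (fun w => (lyapunov kappa K (proc (g nu) kappa eps del z0 i w) * (1 + `|g nu i w|)) ^+ k) &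
      \int[P]_w ((lyapunov kappa K (proc (g nu) kappa eps del z0 i w) * (1 + `|g nu i w|)) ^+ k) <= C].
Proof.
have lL := lyap_exp k (lyap_lyapunov k0 k4).
have [C C0 HC] := expect_lyap lL.
exists (M k * (C * lyapunov kappa K z0 ^+ k)).
  by rewrite mulr_ge0 ?(M_ge0 (g_moment 0))// mulr_ge0// exprn_ge0// (le_trans ler01)// lyapunov_ge1.
move=> del nu i d01 deps iK; have [jL EL] := HC K eps del z0 nu i K1 eps0 d01 deps iK.
have [mL L0 _] := lL.
have aL : adapted (g nu) i (fun w => lyapunov kappa K (proc (g nu) kappa eps del z0 i w) ^+ k).
  exact: (@adapted_proc _ _ _ P (g nu) kappa eps del z0 i (fun z => lyapunov kappa K z ^+ k) (mL K)).
have [j2 E2] := family_moment k aL jL (fun w => L0 K _ K1).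
have E : (fun w => (lyapunov kappa K (proc (g nu) kappa eps del z0 i w) * (1 + `|g nu i w|)) ^+ k) =
  (fun w => lyapunov kappa K (proc (g nu) kappa eps del z0 i w) ^+ k * (1 + `|g nu i w|) ^+ k).
  by apply/funext => w; rewrite exprMn.
by rewrite E; split => //; rewrite (le_trans E2)// ler_wpM2l// (M_ge0 (g_moment 0)).
Qed.

Lemma proc_valid del nu i w : i%:R * del ^+ 2 <= K ->
  eps < st_u kappa (proc (g nu) kappa eps del z0 i w) -> valid kappa eps K (proc (g nu) kappa eps del z0 i w).
Proof.
move=> iK run; have /andP[A B] := @proc_time _ _ _ P (g nu) kappa eps del z0 i t0 w.
by rewrite /valid run A (le_trans B).
Qed.

Lemma proc_integrable (f : state -> R) : measurable_fun setT f ->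
  bounded kappa eps K (fun z g del => f (step kappa del g z)) ->
  forall (del : R) (nu i : nat), 0 < del <= 1 -> del <= eps -> i%:R * del ^+ 2 <= K ->
  integ (fun w => f (proc (g nu) kappa eps del z0 i w)).
Proof.
move=> mf [C [k [C0 bf]]] del nu i d01 deps iK.
have [D D0 HD] := expect_lyapunov_noise k.
elim: i iK => [|i IH] iK; first exact: (integ_cst P (f z0)).
have iK' : i%:R * del ^+ 2 <= K.
  by rewrite (le_trans _ iK)// ler_wpM2r ?sqr_ge0// ler_nat.
have [_ jL _] := HD del nu i d01 deps iK'.
have jf := IH iK'.
have jn : integ (fun w => `|f (proc (g nu) kappa eps del z0 i w)|).
  apply: (integ_le _ jf) => [|w]; last by rewrite normr_id.
  by apply: measurableT_comp => //; exact: integ_measurable jf.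
apply: (integ_le _ (integD jn (integZ C jL))) => [|w].
  exact: (@measurable_proc _ _ _ P (g nu) kappa eps del z0 i.+1 f mf).
have T0 : 0 <= C * (lyapunov kappa K (proc (g nu) kappa eps del z0 i w) * (1 + `|g nu i w|)) ^+ k.
  by rewrite mulr_ge0// exprn_ge0// (le_trans ler01)// base_ge1.
rewrite [leRHS]ger0_norm ?addr_ge0// procS; case: ifP => run; last by rewrite lerDl.
by rewrite (le_trans (bf _ _ _ (proc_valid iK' run) d01))// lerDr.
Qed.

(** In expectation the noise term and the [f3] term vanish by independence, the generator has the
    right sign, and only the remainders accumulate. For [i] of order [K / del ^+ 2] the total error
    is of order [del]. *)
Lemma ito_le_expect (f f1 G : state -> R) : ito_le kappa eps K f f1 G ->
  bounded kappa eps K (fun z g del => f (step kappa del g z)) ->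
  (forall z, valid kappa eps K z -> G z <= 0) ->
  exists2 C : R, 0 <= C & forall (del : R) (nu i : nat), 0 < del <= 1 -> del <= eps ->
    i%:R * del ^+ 2 <= K ->
    \int[P]_w f (proc (g nu) kappa eps del z0 i w) <= f z0 + C * (i%:R * del ^+ 3).
Proof.
move=> [[mf bf] [mf1 bf1] [mG bG] [f3 [mf3 bf3] [r [C [k [C0 br]]] E]]] bstep G0.
have [D D0 HD] := expect_lyapunov_noise k.
exists (C * D) => [|del nu i d01 deps]; first exact: mulr_ge0.
have jf := proc_integrable mf bstep.
have d3 : 0 <= del ^+ 3 by case/andP: d01 => d0 _; rewrite exprn_ge0// ltW.
elim: i => [|i IH] iK; first by rewrite /= expect_cst mul0r mulr0 addr0.
have iK' : i%:R * del ^+ 2 <= K.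
  by rewrite (le_trans _ iK)// ler_wpM2r ?sqr_ge0// ler_nat.
have {}IH := IH iK'; have [_ jL EL] := HD del nu i d01 deps iK'.
set Z := proc (g nu) kappa eps del z0 in jL EL IH *.
pose cut (h : state -> R) (w : Omega) : R := (eps < st_u kappa (Z i w))%R%:R * h (Z i w).
have acut h : measurable_fun setT h -> adapted (g nu) i (cut h).
  by move=> mh; exact: (@adapted_running _ _ _ P (g nu) kappa eps del z0 i h mh).
have jcut h : measurable_fun setT h -> bounded kappa eps K (fun z _ _ => h z) -> integ (cut h).
  move=> mh [C' [k' [C'0 bh]]].
  have [D' D'0 HD'] := expect_lyapunov_noise k'.
  have [jL' _ _] := HD' del nu i d01 deps iK'.
  apply: (integ_le _ (integZ C' jL')) => [|w].
    exact: adapted_measurable (acut h mh).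
  rewrite /cut; case: (boolP (eps < _)) => run; last by rewrite mul0r normr0.
  (* For a function of the state alone the growth bound is read at noise 0 and step 1. *)
  rewrite mul1r; have := bh _ 0 1 (proc_valid iK' run).
  rewrite ltr01 lexx normr0 addr0 mulr1 => /(_ isT) /le_trans; apply.
  exact: ler_norm.
have [j1 E1] := family_noise (acut _ mf1) (jcut _ mf1 bf1).
have [j3 E3] := family_noise2 (acut _ mf3) (jcut _ mf3 bf3).
have jG := jcut _ mG bG.
pose W w := f (Z i w) + del * (cut f1 w * g nu i w) + del ^+ 2 * cut G w
  + del ^+ 2 * (cut f3 w * (g nu i w ^+ 2 - 1))
  + del ^+ 3 * C * (lyapunov kappa K (Z i w) * (1 + `|g nu i w|)) ^+ k.
have jfi := jf del nu i d01 deps iK'.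
have J1 := integD jfi (integZ del j1).
have J2 := integD J1 (integZ (del ^+ 2) jG).
have J3 := integD J2 (integZ (del ^+ 2) j3).
have J4 := integD J3 (integZ (del ^+ 3 * C) jL).
have fW w : f (Z i.+1 w) <= W w.
  have L0 : 0 <= (lyapunov kappa K (Z i w) * (1 + `|g nu i w|)) ^+ k.
    by rewrite exprn_ge0// (le_trans ler01)// base_ge1.
  rewrite /Z procS -/Z /W /cut; case: ifP => run; last first.
    rewrite !mul0r !mulr0 !addr0 lerDl.
    by apply: mulr_ge0 => //; exact: mulr_ge0.
  rewrite !mul1r (le_trans (E _ (g nu i w) del (proc_valid iK' run) d01))//.
  have := br _ (g nu i w) del (proc_valid iK' run) d01; rewrite -/Z => brw.
  have : del ^+ 3 * r (Z i w) (g nu i w) del <=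
      del ^+ 3 * (C * (lyapunov kappa K (Z i w) * (1 + `|g nu i w|)) ^+ k).
    by rewrite ler_wpM2l// (le_trans (ler_norm _)).
  rewrite /ito_expansion mulrA -(lerD2l (f (Z i w) + del * (g nu i w * f1 (Z i w)) +
     del ^+ 2 * (G (Z i w) + (g nu i w ^+ 2 - 1) * f3 (Z i w)))) => /le_trans; apply.
  rewrite le_eqVlt; apply/orP; left; apply/eqP; ring.
apply: (@le_trans _ _ (\int[P]_w W w)).
  have jfS := jf del nu i.+1 d01 deps iK.
  by apply: le_Rintegral => // w _; exact: fW.
rewrite /W RintegralD//; last exact: integZ.
rewrite RintegralD//; last exact: integZ.
rewrite RintegralD//; last exact: integZ.
rewrite RintegralD//; last exact: integZ.
rewrite !RintegralZl// E1 E3 !mulr0 !addr0.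
have cG : \int[P]_w cut G w <= 0.
  rewrite -(expect_cst P 0); apply: le_Rintegral => //; first exact: integ_cst.
  move=> w _; rewrite /cut; case: (boolP (eps < _)) => run; last by rewrite mul0r.
  by rewrite mul1r; apply: G0; exact: proc_valid iK' run.
have G2 : del ^+ 2 * \int[P]_w cut G w <= 0 by rewrite mulr_ge0_le0// sqr_ge0.
apply: (@le_trans _ _ (\int[P]_w f (Z i w) + del ^+ 3 * C * D)).
  rewrite lerD//; first by rewrite gerDl.
  by rewrite ler_wpM2l// mulr_ge0.
rewrite (le_trans (lerD IH (lexx _)))// -natr1.
rewrite le_eqVlt; apply/orP; left; apply/eqP; ring.
Qed.

Lemma bounded_ito_le_step f f1 G : (forall z, 0 <= f z) -> ito_le kappa eps K f f1 G ->
  bounded kappa eps K (fun z g del => f (step kappa del g z)).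
Proof.
move=> f0 [[_ bf] [_ bf1] [_ bG] [f3 [_ bf3] [r br E]]].
have bg : bounded kappa eps K (fun _ g _ => g) by exact: bounded_noise.
have bd : bounded kappa eps K (fun _ _ del => del) by exact: bounded_del.
have : bounded kappa eps K (fun z g del => ito_expansion f f1 G f3 r z g del).
  rewrite /ito_expansion; apply: bounded_add => //; last first.
    by apply: bounded_mul => //; exact: bounded_exp.
  apply: bounded_add => //; last first.
    apply: bounded_mul => //; first exact: bounded_exp.
    apply: bounded_add => //; apply: bounded_mul => //.
    by apply: bounded_add => //; [exact: bounded_exp|exact: bounded_cst].
  apply: bounded_add => //; apply: bounded_mul => //.
  exact: bounded_mul.
move=> /bounded_le; apply => z h del vz d01.
by rewrite ger0_norm// (le_trans (E z h del vz d01))// ler_norm.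
Qed.

Lemma bounded_ito_step f f1 G : ito kappa eps K f f1 G ->
  bounded kappa eps K (fun z g del => f (step kappa del g z)).
Proof.
move=> [[_ bf] [_ bf1] [_ bG] [f3 [_ bf3] [r br E]]].
have bg : bounded kappa eps K (fun _ g _ => g) by exact: bounded_noise.
have bd : bounded kappa eps K (fun _ _ del => del) by exact: bounded_del.
have : bounded kappa eps K (fun z g del => ito_expansion f f1 G f3 r z g del).
  rewrite /ito_expansion; apply: bounded_add => //; last first.
    by apply: bounded_mul => //; exact: bounded_exp.
  apply: bounded_add => //; last first.
    apply: bounded_mul => //; first exact: bounded_exp.
    apply: bounded_add => //; apply: bounded_mul => //.
    by apply: bounded_add => //; [exact: bounded_exp|exact: bounded_cst].
  apply: bounded_add => //; apply: bounded_mul => //.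
  exact: bounded_mul.
move=> /bounded_le; apply => z h del vz d01.
by rewrite E.
Qed.

Lemma ito_expect (f f1 G : state -> R) : ito kappa eps K f f1 G ->
  (forall z, valid kappa eps K z -> G z = 0) ->
  exists2 C : R, 0 <= C & forall (del : R) (nu i : nat), 0 < del <= 1 -> del <= eps ->
    i%:R * del ^+ 2 <= K ->
    integ (fun w => f (proc (g nu) kappa eps del z0 i w)) /\
    `|\int[P]_w f (proc (g nu) kappa eps del z0 i w) - f z0| <= C * (i%:R * del ^+ 3).
Proof.
move=> If G0; have bs := bounded_ito_step If.
have [[mf _] _ _ _] := If.
(* [- f] is treated as a product with the constant -1, so that the one-sided estimate yields both
   inequalities. *)
have Ic : ito kappa eps K (fun=> -1) (fun=> 0) (fun=> 0) by exact: ito_cst.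
have If' := ito_mul K1 Ic If.
have bs' := bounded_ito_step If'.
have G0' z : valid kappa eps K z -> -1 * G z + f z * 0 + 0 * f1 z <= 0.
  by move=> vz; rewrite (G0 _ vz) !mulr0 mul0r !addr0.
have [C C0 H] := ito_le_expect (ito_itole If) bs (fun z vz => eq_ind_r (fun x => x <= 0) (lexx 0) (G0 z vz)).
have [C' C'0 H'] := ito_le_expect (ito_itole If') bs' G0'.
exists (C + C') => [|del nu i d01 deps iK]; first exact: addr_ge0.
have jf := proc_integrable mf bs nu d01 deps iK.
split => //.
have := H del nu i d01 deps iK; have := H' del nu i d01 deps iK.
rewrite RintegralZl// => A B.
have d3 : 0 <= i%:R * del ^+ 3 by case/andP: d01 => d0 _; rewrite mulr_ge0// exprn_ge0// ltW.
have := mulr_ge0 C0 d3; have := mulr_ge0 C'0 d3.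
move: (\int[P]_w _) A B => e A B c c'.
by rewrite ler_norml mulrDl; apply/andP; split; lra.
Qed.

End ito_formula.
End noise_family.

(** * The supermartingale controlling the tail of tau *)

Ltac solve_bounded := repeat first [ eassumption | apply: bounded_cst | apply: bounded_noise
  | apply: bounded_del | apply: bounded_opp | apply: bounded_exp | apply: bounded_mul
  | apply: bounded_add ]; try assumption.

Lemma tame_exp {R : realType} (kappa eps K : R) (f : R * R * R * R -> R) n :
  tame kappa eps K f -> tame kappa eps K (fun z => f z ^+ n).
Proof. by move=> [mf bf]; split; [exact: measurable_funX|exact: bounded_exp]. Qed.

Ltac solve_tame := repeat first [ eassumption | apply: tame_cst | apply: tame_opp
  | apply: tame_exp | apply: tame_mul | apply: tame_add ]; try assumption.

Section power_functions.
Context {R : realType} (kappa eps K : R).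
Hypotheses (k0 : 0 < kappa) (k4 : kappa < 4) (eps0 : 0 < eps) (K1 : 1 <= K).
Local Notation state := (R * R * R * R)%type.
Local Notation tame := (tame kappa eps K).
Local Notation bounded := (bounded kappa eps K).
Local Notation valid := (valid kappa eps K).
Local Notation ito := (ito kappa eps K).
Local Notation ito_le := (ito_le kappa eps K).
Local Notation st_u := (st_u kappa).

Lemma ito_le_ext f f1 G f' f1' G' : ito_le f f1 G -> f =1 f' ->
  (forall z, valid z -> f1 z = f1' z) -> (forall z, valid z -> G z = G' z) ->
  tame f1' -> tame G' -> ito_le f' f1' G'.
Proof.
move=> [tf t1 tG [f3 t3 [r br E]]] /funext <- ff GG t1' tG'; split => //.
exists f3 => //; exists r => // z g del vz d01.
by rewrite (le_trans (E z g del vz d01))// /ito_expansion ff// GG.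
Qed.

Lemma ito_ext_valid f f1 G f' f1' G' : ito f f1 G -> f =1 f' ->
  (forall z, valid z -> f1 z = f1' z) -> (forall z, valid z -> G z = G' z) ->
  tame f1' -> tame G' -> ito f' f1' G'.
Proof.
move=> [tf t1 tG [f3 t3 [r br E]]] /funext <- ff GG t1' tG'; split => //.
exists f3 => //; exists r => // z g del vz d01.
by rewrite E// /ito_expansion ff// GG.
Qed.

Lemma ito_u : ito st_u (fun=> Num.sqrt kappa) (fun z => - (4 - kappa) / st_u z).
Proof.
have tu : tame st_u by exact: tame_u.
have tv : tame (fun z => (st_u z)^-1) by exact: tame_inv_u.
split => //; first exact: tame_cst.
  by apply: tame_mul => //; exact: tame_cst.
exists (fun=> 0); first exact: tame_cst.
exists (fun _ _ _ => 0); first exact: bounded_cst.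
by move=> z g del _ _; rewrite /ito_expansion step_u; ring.
Qed.

Lemma measurable_sqrt (f : state -> R) : measurable_fun setT f -> (forall z, 0 <= f z) ->
  measurable_fun setT (fun z => Num.sqrt (f z)).
Proof.
move=> mf f0; have -> : (fun z => Num.sqrt (f z)) = (fun z => f z `^ 2^-1).
  by apply/funext => z; rewrite powR12_sqrt.
exact: (measurableT_comp (measurable_powR _)).
Qed.

Lemma measurable_invf (f : state -> R) : measurable_fun setT f ->
  measurable_fun setT (fun z => (f z)^-1).
Proof.
move=> mf; have -> : (fun z => (f z)^-1) = (fun z => f z * (f z ^+ 2) `^ (-1)).
  apply/funext => z; rewrite powR_inv1 ?sqr_ge0//.
  have [->|u0] := eqVneq (f z) 0; first by rewrite invr0 mul0r.
  by field.
apply: measurable_funM => //.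
apply: (measurableT_comp (measurable_powR _)).
exact: measurable_funX.
Qed.

Lemma tame_inv f c : 0 < c -> tame f -> (forall z, valid z -> c <= f z) ->
  tame (fun z => (f z)^-1).
Proof.
move=> c0 [mf bf] cf; split; first exact: measurable_invf.
apply: (bounded_le (bounded_cst kappa eps K c^-1)) => z g del vz _.
have f0 : 0 < f z by rewrite (lt_le_trans c0)// cf.
by rewrite !ger0_norm ?invr_ge0 ?(ltW f0) ?(ltW c0)// lef_pV2// cf.
Qed.

Lemma tame_sqrt f : tame f -> (forall z, 0 <= f z) -> tame (fun z => Num.sqrt (f z)).
Proof.
move=> [mf bf] f0; split; first exact: measurable_sqrt.
have : bounded (fun z _ _ => 1 + f z) by solve_bounded.
move=> /bounded_le; apply => z g del vz _.
rewrite !ger0_norm ?sqrtr_ge0 ?addr_ge0//.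
have := sqr_sqrtr (f0 z); have := sqrtr_ge0 (f z).
by move: (Num.sqrt _) => s s0 <-; rewrite expr2; nra.
Qed.

(** The right-hand side is the Taylor polynomial of degree 3 at 0; the next coefficient,
    [- 5 / 128], is negative. The inequality is verified by squaring, which leaves a nonnegative
    excess with factor [y ^+ 4], and by the nonnegativity of the cubic for [y >= -1]. *)
Lemma sqrt_taylor (y : R) : -1 <= y ->
  Num.sqrt (1 + y) <= 1 + y / 2 - y ^+ 2 / 8 + y ^+ 3 / 16.
Proof.
move=> y1; set S := _ + y ^+ 3 / 16.
have SS : 1 + y <= S ^+ 2.
  have -> : S ^+ 2 = 1 + y + y ^+ 4 * (20 - y * 4 + y ^+ 2) / 256.
    by rewrite /S; field.
  rewrite lerDl divr_ge0// mulr_ge0//; first by rewrite (exprM y 2 2) sqr_ge0.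
  by have := sqr_ge0 (y - 2); nra.
have S0 : 0 <= S.
  have -> : S = ((y + 1) * (y - 2) ^+ 2 + (y + 2) * (y + 6)) / 16 by rewrite /S; field.
  have y10 : 0 <= y + 1 by rewrite -lerBlDr sub0r.
  by rewrite divr_ge0// addr_ge0// mulr_ge0 ?sqr_ge0//; lra.
by rewrite -(ger0_norm S0) -sqrtr_sqr; exact: ler_wsqrtr.
Qed.

(** The new value of [f] is at most [f * (1 + Y)] with [Y] of order [del]; its square root is
    bounded by the cubic of [sqrt_taylor]. The lower bound [c] keeps the inverse of [Num.sqrt f]
    tame on valid states. *)
Lemma ito_le_sqrt f f1 G c : 0 < c -> (forall z, valid z -> c <= f z) ->
  (forall z, 0 <= f z) -> ito_le f f1 G ->
  ito_le (fun z => Num.sqrt (f z)) (fun z => f1 z * (Num.sqrt (f z))^-1 / 2)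
    (fun z => G z * (Num.sqrt (f z))^-1 / 2 - f1 z ^+ 2 * (Num.sqrt (f z))^-1 ^+ 3 / 8).
Proof.
move=> c0 cf f0 [tf t1 tG [f3 t3 [r br E]]].
have th := tame_sqrt tf f0.
have tv : tame (fun z => (Num.sqrt (f z))^-1).
  apply: (tame_inv (_ : 0 < Num.sqrt c)) => //; first by rewrite sqrtr_gt0.
  by move=> z vz; rewrite ler_sqrt// cf.
have tc (a : R) : tame (fun=> a) by exact: tame_cst.
have t13 : tame (fun z => f1 z ^+ 2 * (Num.sqrt (f z))^-1 ^+ 3 / 8).
  by solve_tame.
split => //.
- by solve_tame.
- by solve_tame.
exists (fun z => f3 z * (Num.sqrt (f z))^-1 / 2 - f1 z ^+ 2 * (Num.sqrt (f z))^-1 ^+ 3 / 8).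
  by solve_tame.
move: th tv tf t1 tG t3 => [_ bh] [_ bv] [_ bf] [_ b1] [_ bG] [_ b3].
pose v z := (Num.sqrt (f z))^-1.
pose Y1 z (g : R) (_ : R) := g * f1 z * v z ^+ 2.
pose Y2 z (g : R) (_ : R) := (G z + (g ^+ 2 - 1) * f3 z) * v z ^+ 2.
pose Y3 z g del := r z g del * v z ^+ 2.
pose T' z g del := Y2 z g del + del * Y3 z g del.
have bY1 : bounded Y1 by rewrite /Y1 /v; solve_bounded.
have bY2 : bounded Y2 by rewrite /Y2 /v; solve_bounded.
have bY3 : bounded Y3 by rewrite /Y3 /v; solve_bounded.
have bT' : bounded T' by rewrite /T'; solve_bounded.
(* Here [Y = del * Y1 + del ^+ 2 * T'] and [T' = Y2 + del * Y3]: these are the terms of order at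
   least 3 in the cubic polynomial of [Y], divided by [del ^+ 3]. *)
exists (fun z g del => Num.sqrt (f z) * (Y3 z g del / 2
  + - ((2 * Y1 z g del * T' z g del + del * T' z g del ^+ 2) / 8)
  + (Y1 z g del + del * T' z g del) ^+ 3 / 16)); first by solve_bounded.
move=> z g del vz d01; have fz0 : 0 < f z by rewrite (lt_le_trans c0)// cf.
have h0 : 0 < Num.sqrt (f z) by rewrite sqrtr_gt0.
pose Y := del * (Y1 z g del + del * T' z g del).
have hE : f z = Num.sqrt (f z) ^+ 2 by rewrite sqr_sqrtr// ltW.
have UE : ito_expansion f f1 G f3 r z g del = f z * (1 + Y).
  rewrite /ito_expansion /Y /T' /Y1 /Y2 /Y3 /v; move: hE h0; move: (Num.sqrt _) => h -> h0.
  by field; rewrite gt_eqF.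
(* The expansion dominates a value of the nonnegative function [f]. *)
have Y0 : 0 <= 1 + Y.
  rewrite -(pmulr_rge0 _ fz0) -UE; apply: le_trans (E z g del vz d01); exact: f0.
have Y1' : -1 <= Y by rewrite -subr_ge0 opprK addrC.
apply: (@le_trans _ _ (Num.sqrt (f z) * (1 + Y / 2 - Y ^+ 2 / 8 + Y ^+ 3 / 16))).
  apply: (@le_trans _ _ (Num.sqrt (f z * (1 + Y)))).
    by apply: ler_wsqrtr; rewrite -UE; exact: E.
  rewrite sqrtrM; last exact: ltW.
  by rewrite ler_wpM2l ?(ltW h0)// sqrt_taylor.
rewrite le_eqVlt; apply/orP; left; apply/eqP.
rewrite /ito_expansion /Y /T' /Y1 /Y2 /Y3 /v; move: h0; move: (Num.sqrt _) => h h0.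
by field; rewrite gt_eqF.
Qed.

Section power.
Variables (X1 X2 : state -> R).
Hypotheses (tX1 : tame X1) (tX2 : tame X2).

(** [F] stands for the [q]-th power of a function whose relative noise coefficient and relative
    drift are [X1] and [X2]. With these two fixed, exponents add under products and are halved by
    square roots. *)
Definition power_ito (q : R) (F : state -> R) :=
  ito F (fun z => q * F z * X1 z) (fun z => q * F z * X2 z + q * (q - 1) / 2 * F z * X1 z ^+ 2).
Definition power_ito_le (q : R) (F : state -> R) :=
  ito_le F (fun z => q * F z * X1 z) (fun z => q * F z * X2 z + q * (q - 1) / 2 * F z * X1 z ^+ 2).

Let tame_grad q F : tame F -> tame (fun z => q * F z * X1 z).
Proof. by move=> tF; apply: tame_mul => //; apply: tame_mul => //; exact: tame_cst. Qed.

Let tame_gen q F : tame F -> tame (fun z => q * F z * X2 z + q * (q - 1) / 2 * F z * X1 z ^+ 2).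
Proof.
by move=> tF; solve_tame.
Qed.

Lemma power_ito_mul q q' F F' : power_ito q F -> power_ito q' F' ->
  power_ito (q + q') (fun z => F z * F' z).
Proof.
move=> pF pF'; have tF : tame F by case: pF. have tF' : tame F' by case: pF'.
have tFF := tame_mul tF tF'.
apply: (ito_ext_valid (ito_mul K1 pF pF')) => //; try (by [exact: tame_grad|exact: tame_gen]).
  by move=> z _; ring.
by move=> z _; field.
Qed.

Lemma power_ito_le_mul q q' F F' : (forall z g del, valid z -> 0 < del <= 1 -> 0 <= F (step kappa del g z)) ->
  power_ito q F -> power_ito_le q' F' ->
  power_ito_le (q + q') (fun z => F z * F' z).
Proof.
move=> F0 pF pF'; have tF : tame F by case: pF. have tF' : tame F' by case: pF'.
have tFF := tame_mul tF tF'.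
apply: (ito_le_ext (ito_le_mul K1 pF F0 pF')) => //; try (by [exact: tame_grad|exact: tame_gen]).
  by move=> z _; ring.
by move=> z _; field.
Qed.

Lemma power_ito_exp F (p : nat) : power_ito 1 F -> power_ito p%:R (fun z => F z ^+ p).
Proof.
move=> pF; elim: p => [|p IH].
  have tc (a : R) : tame (fun=> a) by exact: tame_cst.
  apply: (ito_ext_valid (ito_cst kappa eps K 1)) => //.
  - by move=> z _; rewrite !mul0r.
  - by move=> z _; rewrite !mul0r addr0.
  - by apply: tame_grad; exact: tame_cst.
  - by apply: tame_gen; exact: tame_cst.
have -> : (fun z => F z ^+ p.+1) = (fun z => F z * F z ^+ p).
  by apply/funext => z; rewrite exprS.
by rewrite -natr1 addrC; exact: power_ito_mul.
Qed.

Lemma power_ito_le_sqrt q F c : 0 < c -> (forall z, valid z -> c <= F z) ->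
  (forall z, 0 <= F z) -> power_ito_le q F -> power_ito_le (q / 2) (fun z => Num.sqrt (F z)).
Proof.
move=> c0 cF F0 pF; have tF : tame F by case: pF.
have tS := tame_sqrt tF F0.
apply: (ito_le_ext (ito_le_sqrt c0 cF F0 pF)) => //; try (by [exact: tame_grad|exact: tame_gen]).
- move=> z vz; have Fz0 : 0 < F z by rewrite (lt_le_trans c0)// cF.
  have h0 : 0 < Num.sqrt (F z) by rewrite sqrtr_gt0.
  have hE : F z = Num.sqrt (F z) ^+ 2 by rewrite sqr_sqrtr// ltW.
  move: hE h0; move: (Num.sqrt _) => h -> h0.
  by field; rewrite gt_eqF.
- move=> z vz; have Fz0 : 0 < F z by rewrite (lt_le_trans c0)// cF.
  have h0 : 0 < Num.sqrt (F z) by rewrite sqrtr_gt0.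
  have hE : F z = Num.sqrt (F z) ^+ 2 by rewrite sqr_sqrtr// ltW.
  move: hE h0; move: (Num.sqrt _) => h -> h0.
  by field; rewrite gt_eqF.
Qed.

Lemma power_ito_le_iter F c (j : nat) : 0 < c -> (forall z, valid z -> c <= F z) ->
  (forall z, 0 <= F z) -> power_ito_le 1 F ->
  power_ito_le (2 ^- j) (fun z => iter j Num.sqrt (F z)).
Proof.
move=> c0 cF F0 pF.
have S0 i z : 0 <= iter i Num.sqrt (F z) by case: i => [|i]; [exact: F0|exact: sqrtr_ge0].
have cS i z : valid z -> iter i Num.sqrt c <= iter i Num.sqrt (F z).
  by move=> vz; elim: i => [|i IH]; [exact: cF|exact: ler_wsqrtr].
have c0' i : 0 < iter i Num.sqrt c by elim: i => // i IH; rewrite sqrtr_gt0.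
elim: j => [|j IH]; first by rewrite expr0 invr1.
have := power_ito_le_sqrt (c0' j) (cS j) (S0 j) IH.
by rewrite exprSr invfM.
Qed.

End power.

Section supermartingale.
Variables (p j : nat).
Let q : R := p%:R + 2 ^- j.
Hypotheses (p0 : (0 < p)%N) (kq : 0 < 8 - (2 * q + 1) * kappa).
Let bb : R := (8 - (2 * q + 1) * kappa)^-1.

Let q1 : 1 <= q.
Proof. by rewrite /q -[leLHS]addr0 lerD// ?invr_ge0 ?exprn_ge0// ler1n. Qed.
Let bb0 : 0 < bb. Proof. by rewrite invr_gt0. Qed.

(* The iterated square root realises the exponent q = p + 2 ^- j without real
   powers; bb makes the generator of the q-th power nonpositive. *)
Definition parabolic (z : state) : R := Num.max 0 (st_t z) + bb * st_u z ^+ 2.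
Definition tail_function (z : state) : R :=
  parabolic z ^+ p * iter j Num.sqrt (parabolic z).

Lemma parabolic_ge0 z : 0 <= parabolic z.
Proof. by rewrite /parabolic addr_ge0 ?le_max ?lexx// mulr_ge0 ?sqr_ge0// ltW. Qed.

Let X1 z : R := 2 * bb * st_u z * Num.sqrt kappa * (parabolic z)^-1.
Let X2 z : R := (1 - bb * (8 - 3 * kappa)) * (parabolic z)^-1.

Let tmax : tame (fun z => Num.max 0 (st_t z)).
Proof.
split; first by apply: measurable_maxr => //; exact: measurable_st_t.
apply: (bounded_le (bounded_st_t kappa eps K)) => z g del /and3P[_ t0 _] _.
by rewrite (max_idPr t0).
Qed.

Let ito_parabolic : ito parabolic (fun z => 2 * bb * st_u z * Num.sqrt kappa)
  (fun=> 1 - bb * (8 - 3 * kappa)).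
Proof.
have tu : tame st_u by exact: tame_u.
have I1 := ito_mul K1 ito_u ito_u.
have I2 := ito_mul K1 (ito_cst kappa eps K bb) I1.
have I3 := ito_add K1 (ito_t kappa eps K) I2.
have [] := I3 => t3 t31 t3G [f3 tf3 [r br E]].
split; [ |by solve_tame|exact: tame_cst|].
  by apply: tame_add => //; solve_tame.
exists f3 => //; exists r => // z g del vz d01.
have /and3P[ue t0 tK] := vz.
have u0 : st_u z != 0 by rewrite gt_eqF// (lt_trans eps0).
have := E z g del vz d01; rewrite /ito_expansion /parabolic.
have -> : Num.max 0 (st_t z) = st_t z by exact/max_idPr.
have -> : Num.max 0 (st_t (step kappa del g z)) = st_t (step kappa del g z).
  by apply/max_idPr; rewrite {1}/st_t/= addr_ge0// sqr_ge0.
rewrite expr2 => ->.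
have sk : Num.sqrt kappa * Num.sqrt kappa = kappa by rewrite -expr2 sqr_sqrtr// ltW.
have -> : 1 + (bb * (st_u z * (- (4 - kappa) / st_u z) + st_u z * (- (4 - kappa) / st_u z) +
     Num.sqrt kappa * Num.sqrt kappa) + st_u z * st_u z * 0 + 0 * (st_u z * Num.sqrt kappa + st_u z * Num.sqrt kappa)) = 1 - bb * (8 - 3 * kappa).
  by rewrite sk; field.
ring.
Qed.

Let parabolic_ge z : valid z -> bb * eps ^+ 2 <= parabolic z.
Proof.
move=> /and3P[ue t0 _]; rewrite /parabolic (max_idPr t0) -[leLHS]add0r lerD//.
by rewrite ler_wpM2l ?(ltW bb0)// ler_sqr ?nnegrE ?(ltW eps0)// ltW// (lt_trans eps0).
Qed.

Let c0 : 0 < bb * eps ^+ 2. Proof. by rewrite mulr_gt0// exprn_gt0. Qed.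

(** Up to a nonnegative factor the generator is [(1 - bb * (8 - 3 * kappa)) * parabolic + 2 * (q -
    1) * bb ^+ 2 * kappa * u ^+ 2]. The relation [bb * (8 - (2 * q + 1) * kappa) = 1] cancels the
    terms in [u ^+ 2] exactly, and the remaining coefficient of [t] is nonpositive because
    [q >= 1]. *)
Lemma ito_le_tail : exists f1, exists2 G, ito_le tail_function f1 G &
  forall z, valid z -> G z <= 0.
Proof.
have tu : tame st_u by exact: tame_u.
have tp : tame parabolic by case: ito_parabolic.
have ti : tame (fun z => (parabolic z)^-1) by exact: (tame_inv c0 tp parabolic_ge).
have tX1 : tame X1 by rewrite /X1; solve_tame.
have tX2 : tame X2 by rewrite /X2; solve_tame.
have P1 : power_ito X1 X2 1 parabolic.
  apply: (ito_ext_valid ito_parabolic) => //.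
  - move=> z vz; have pz : parabolic z != 0 by rewrite gt_eqF// (lt_le_trans c0)// parabolic_ge.
    by rewrite /X1; field.
  - move=> z vz; have pz : parabolic z != 0 by rewrite gt_eqF// (lt_le_trans c0)// parabolic_ge.
    by rewrite /X2; field.
  - by solve_tame.
  - by solve_tame.
have P2 := power_ito_exp tX1 tX2 p P1.
have P3 := power_ito_le_iter tX1 tX2 j c0 parabolic_ge parabolic_ge0 (ito_itole P1).
have P4 := power_ito_le_mul tX1 tX2 (fun z g del _ _ => exprn_ge0 p (parabolic_ge0 (step kappa del g z))) P2 P3.
exists (fun z => q * tail_function z * X1 z).
exists (fun z => q * tail_function z * X2 z + q * (q - 1) / 2 * tail_function z * X1 z ^+ 2).
  exact: P4.
move=> z vz; have pz : 0 < parabolic z by rewrite (lt_le_trans c0)// parabolic_ge.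
have V0 : 0 <= tail_function z.
  rewrite mulr_ge0 ?exprn_ge0 ?parabolic_ge0//.
  by case: (j) => [|i]; [exact: parabolic_ge0|exact: sqrtr_ge0].
have -> : q * tail_function z * X2 z + q * (q - 1) / 2 * tail_function z * X1 z ^+ 2 =
   q * tail_function z / parabolic z ^+ 2 * ((1 - bb * (8 - 3 * kappa)) * parabolic z +
     2 * (q - 1) * bb ^+ 2 * kappa * st_u z ^+ 2).
  rewrite /X1 /X2 exprMn (exprMn _ (2 * bb * st_u z)) sqr_sqrtr; last exact: ltW.
  by field; rewrite gt_eqF.
apply: mulr_ge0_le0.
  by rewrite divr_ge0 ?exprn_ge0 ?parabolic_ge0// mulr_ge0// (le_trans ler01).
have /and3P[ue t0 _] := vz.
have E : bb * (8 - (2 * q + 1) * kappa) = 1 by rewrite /bb mulVf// gt_eqF.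
have neg : 1 - bb * (8 - 3 * kappa) <= 0.
  have -> : 1 - bb * (8 - 3 * kappa) = bb * (8 - (2 * q + 1) * kappa - (8 - 3 * kappa)) by rewrite [RHS]mulrBr E.
  have : (8 - (2 * q + 1) * kappa - (8 - 3 * kappa)) <= 0.
    by move: q1 k0; nra.
  by move=> h; rewrite mulr_ge0_le0// ltW.
rewrite /parabolic (max_idPr t0) mulrDr.
have T : (1 - bb * (8 - 3 * kappa)) * st_t z <= 0 by rewrite mulr_le0_ge0.
have U : (1 - bb * (8 - 3 * kappa)) * (bb * st_u z ^+ 2) + 2 * (q - 1) * bb ^+ 2 * kappa * st_u z ^+ 2 = 0.
  have -> : (1 - bb * (8 - 3 * kappa)) * (bb * st_u z ^+ 2) + 2 * (q - 1) * bb ^+ 2 * kappa * st_u z ^+ 2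
    = bb * st_u z ^+ 2 * (1 - bb * (8 - (2 * q + 1) * kappa)) by ring.
  by rewrite E subrr mulr0.
by rewrite -addrA U addr0.
Qed.

End supermartingale.
End power_functions.

(** * The martingale polynomial *)

Section hermite.
Variable A : comNzRingType.

(* Heat polynomials: d/dv herm = 1/2 d^2/da^2 herm, and herm a v n is the n-th
   moment of the normal law with mean a and variance v. *)
Fixpoint herm (a v : A) (n : nat) {struct n} : A :=
  if n is k.+1 then
    if k is l.+1 then a * herm a v k + k%:R * v * herm a v l else a
  else 1.

(** [dherm] and [ddherm] are the first and second derivatives in [a], in closed form since the heat
    polynomials are an Appell sequence. The numerical factors vanish wherever the truncated
    predecessors would matter. *)
Definition dherm (a v : A) (n : nat) : A := n%:R * herm a v n.-1.
Definition ddherm (a v : A) (n : nat) : A := (n * n.-1)%:R * herm a v n.-2.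

Lemma hermSS a v n : herm a v n.+2 = a * herm a v n.+1 + n.+1%:R * v * herm a v n.
Proof. by []. Qed.

Lemma hermS a v n : a * herm a v n + n%:R * v * herm a v n.-1 = herm a v n.+1.
Proof. by case: n => [|n] //=; rewrite mulr1 !mul0r addr0. Qed.

Lemma herm_ind2 (Q : nat -> Prop) : Q 0%N -> Q 1%N ->
  (forall n, Q n -> Q n.+1 -> Q n.+2) -> forall n, Q n.
Proof.
move=> Q0 Q1 QS n; suff [] : Q n /\ Q n.+1 by [].
by elim: n => [|n [IH1 IH2]]; split => //; exact: QS.
Qed.

Lemma dhermSS a v n : dherm a v n.+2 =
  a * dherm a v n.+1 + herm a v n.+1 + n.+1%:R * v * dherm a v n.
Proof.
rewrite /dherm/= -!/(herm _ _ _).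
have -> : a * (n.+1%:R * herm a v n) + herm a v n.+1 + n.+1%:R * v * (n%:R * herm a v n.-1)
  = n.+1%:R * (a * herm a v n + n%:R * v * herm a v n.-1) + herm a v n.+1 by ring.
by rewrite hermS -[in LHS]natr1 mulrDl mul1r.
Qed.

Lemma ddhermSS a v n : ddherm a v n.+2 =
  a * ddherm a v n.+1 + 2 * dherm a v n.+1 + n.+1%:R * v * ddherm a v n.
Proof.
case: n => [|n]; first by rewrite /ddherm /dherm /=; ring.
have dd k : ddherm a v k.+2 = (k.+2 * k.+1)%:R * herm a v k by [].
have d1 k : dherm a v k.+1 = k.+1%:R * herm a v k by [].
have -> : ddherm a v n.+1 = (n.+1 * n)%:R * herm a v n.-1 by [].
rewrite !dd d1 -(hermS a v n) !natrM -[n.+3%:R]natr1 -[n.+2%:R]natr1; ring.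
Qed.

Lemma herm_v0 a n : herm a 0 n = a ^+ n.
Proof.
elim/herm_ind2: n => [||n _ IH]; rewrite ?expr0 ?expr1//.
by rewrite hermSS IH mulr0 mul0r addr0 [RHS]exprS.
Qed.

Lemma herm_a0 v l : herm 0 v l.*2 = (\prod_(i < l) i.*2.+1)%N%:R * v ^+ l.
Proof.
elim: l => [|l IH]; first by rewrite big_ord0 mul1r.
by rewrite doubleS hermSS IH mul0r add0r big_ord_recr/= natrM exprS; ring.
Qed.

Lemma prod_odd_fact l : ((\prod_(i < l) i.*2.+1) * (2 ^ l * l`!) = (l.*2)`!)%N.
Proof.
elim: l => [|l IH]; first by rewrite big_ord0.
by rewrite big_ord_recr doubleS !factS -IH expnS -muln2/=; ring.
Qed.

End hermite.

Lemma rmorph_herm (A B : comNzRingType) (f : {rmorphism A -> B}) a v n :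
  f (herm a v n) = herm (f a) (f v) n.
Proof.
elim/herm_ind2: n => [||n IH1 IH2]; rewrite ?rmorph1//.
by rewrite !hermSS rmorphD !rmorphM rmorph_nat IH1 IH2.
Qed.

(** A factor [a] uses one unit of [n] and has degree at most 1; a factor [v] uses two units and has
    degree at most 3. The degree is therefore at most [3 * n / 2]. *)
Lemma size_herm (R : idomainType) (a v : {poly R}) n : (size a <= 2)%N -> (size v <= 4)%N ->
  (size (herm a v n) <= ((3 * n)./2).+1)%N.
Proof.
move=> sa sv; elim/herm_ind2: n => [||n IH1 IH2]; rewrite ?size_poly1//.
rewrite hermSS (leq_trans (size_polyD _ _))// geq_max; apply/andP; split.
  rewrite (leq_trans (size_polyMleq _ _))//.
  move: (size a) (size (herm a v n.+1)) sa IH2 => i j; lia.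
rewrite -mulrA mulr_natl -scaler_nat (leq_trans (size_scale_leq _ _))//.
rewrite (leq_trans (size_polyMleq _ _))//.
move: (size v) (size (herm a v n)) sv IH1 => i j; lia.
Qed.

(** The chain rule, in which the heat equation turns the derivative in [v] into half of the second
    derivative in [a]; the factor 2 in the hypothesis absorbs that half. *)
Lemma deriv_herm (R : comNzRingType) (a v w : {poly R}) n : v^`() = 2 * w ->
  (herm a v n)^`() = dherm a v n * a^`() + ddherm a v n * w.
Proof.
move=> vw; elim/herm_ind2: n => [||n IH1 IH2].
- by rewrite /dherm /ddherm /= derivC; ring.
- by rewrite /dherm /ddherm /=; ring.
rewrite hermSS derivD !derivM -polyC_natr derivC IH1 IH2 dhermSS ddhermSS vw.
have -> : dherm a v n.+1 = n.+1%:R * herm a v n by [].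
by rewrite polyC_natr; ring.
Qed.

Section martingale_polynomial.
Context {R : realType} (kappa : R).
Hypotheses (k0 : 0 < kappa) (k4 : kappa < 4).
Local Notation state := (R * R * R * R)%type.
Local Notation st_u := (st_u kappa).
Local Notation st_x := (st_x kappa).
Local Notation st_c := (st_c kappa).

(* The indeterminate stands for the remaining lifetime, and tpow i is its i-th
   moment, so that phi averages the final value over the lifetime. *)
Definition tcoef (i : nat) : R := (\prod_(1 <= j < i.+1) (8 - (2 * j + 1)%:R * kappa))^-1.

(** With remaining lifetime ['X] the collision occurs at time [t + 'X], and [a_1] is twice that
    time. The number [st_c] entering the mean [poly_a] is the midpoint of [sigma X] and
    [sigma Y]. *)
Definition poly_l (z : state) : {poly R} := (2 * st_t z)%:P + 2%:P * 'X.
Definition poly_a (z : state) : {poly R} := (st_a z)%:P + (2 * st_c z)%:P * 'X.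
Definition poly_v : {poly R} := (kappa / 3)%:P * 'X^3.
Definition poly_phi (n m : nat) (z : state) : {poly R} :=
  poly_l z ^+ n * herm (poly_a z) poly_v m.
Definition tpow (i : nat) (z : state) : R := tcoef i * st_u z ^+ (2 * i).
Definition phi (n m : nat) (z : state) : R :=
  \sum_(i < (n + (3 * m)./2).+1) (poly_phi n m z)`_i * tpow i z.

Lemma phi_collision n m z : st_u z = 0 -> phi n m z = (2 * st_t z) ^+ n * st_a z ^+ m.
Proof.
move=> u0; rewrite /phi big_ord_recl big1 => [|i _]; last first.
  by rewrite /tpow u0 expr0n /= !mulr0.
rewrite addr0 /tpow muln0 expr0 /tcoef big_geq// invr1 !mulr1.
rewrite -horner_coef0 /poly_phi hornerM horner_exp /poly_l.
rewrite -[(herm _ _ _).[_]]/(horner_eval 0 _) rmorph_herm /horner_eval.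
rewrite /= /horner_eval /poly_a /poly_v !hornerE.
by rewrite /= ?expr0n /= ?mulr0 ?mul0r ?addr0 herm_v0.
Qed.

(** At the starting point [t], [a] and the midpoint [c] vanish, so the polynomial is a single
    monomial of degree [p] and only the [p]-th lifetime moment for [u = 2] contributes. The
    factorials come from the odd double factorial in [herm_a0]. *)
Lemma phi_start n m (z : state) : ~~ odd m ->
  st_t z = 0 -> st_u z = 2 -> st_c z = 0 -> st_a z = 0 ->
  phi n m z = 2 ^+ (3 * n + 3 * m) * (kappa / 6) ^+ (m %/ 2)
     * (m`!%:R / ((m %/ 2)`!)%:R)
   / \prod_(1 <= j < (n + (3 * m) %/ 2).+1) (8 - (2 * j + 1)%:R * kappa).
Proof.
move=> om t0 u2 c0 a0.
have mE : m = ((m./2).*2)%N by rewrite even_halfK.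
move: (m./2) mE => l ->.
rewrite !divn2 doubleK -(prod_odd_fact l) !natrM natrX.
have hl : (3 * l.*2)./2 = (3 * l)%N by lia.
rewrite hl; set D := (\prod_(i < l) _)%N; set p := (n + 3 * l)%N.
have E : poly_phi n l.*2 z = (2 ^+ n * D%:R * (kappa / 3) ^+ l)%:P * 'X^p.
  rewrite /poly_phi /poly_l /poly_a /poly_v t0 c0 a0 !mulr0 polyC0 !add0r mul0r herm_a0.
  rewrite -/D; move: (kappa / 3) => c.
  rewrite [(2%:P * _) ^+ n]exprMn [(c%:P * _) ^+ l]exprMn /p exprD exprM.
  by rewrite !polyCM !rmorphXn /= !rmorph_nat; ring.
rewrite /phi hl -/p big_ord_recr big1 => [|i _]; last first.
  by rewrite E coefCM coefXn /= ltn_eqF ?mulr0 ?mul0r.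
rewrite /= add0r E coefCM coefXn eqxx mulr1 /tpow u2 /tcoef.
have f0 : (l`!)%:R != 0 :> R by rewrite pnatr_eq0 -lt0n fact_gt0.
move: (\prod_(1 <= j < p.+1) _)^-1 => Q.
have -> : (3 * n + 3 * l.*2 = n + 2 * n + l + l + 4 * l)%N by lia.
have -> : (2 * p = 2 * n + l + l + 4 * l)%N by rewrite /p; lia.
have -> : kappa / 3 = kappa / 6 * 2 by field.
by rewrite !exprD exprMn; field.
Qed.

Section generator.
Variables (eps K : R).
Hypotheses (eps0 : 0 < eps) (K1 : 1 <= K).
Local Notation tame := (tame kappa eps K).
Local Notation valid := (valid kappa eps K).
Local Notation ito := (ito kappa eps K).

Lemma ito_eq f f1 G f' f1' G' : ito f f1 G -> f =1 f' -> f1 =1 f1' -> G =1 G' ->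
  ito f' f1' G'.
Proof. by move=> I /funext <- /funext <- /funext <-. Qed.

Lemma ito_sum (I : Type) (r : seq I) (Q : pred I) (f f1 G : I -> state -> R) :
  (forall i, ito (f i) (f1 i) (G i)) ->
  ito (fun z => \sum_(i <- r | Q i) f i z) (fun z => \sum_(i <- r | Q i) f1 i z)
      (fun z => \sum_(i <- r | Q i) G i z).
Proof.
move=> If; elim: r => [|i r IH].
  by apply: (ito_eq (ito_cst kappa eps K 0)) => z; rewrite big_nil.
have I1 : ito (fun z => if Q i then f i z else 0) (fun z => if Q i then f1 i z else 0)
    (fun z => if Q i then G i z else 0).
  by case: (Q i) => //; exact: ito_cst.
by apply: (ito_eq (ito_add K1 I1 IH)) => z; rewrite big_cons; case: ifP => //; rewrite add0r.
Qed.

Definition itoP (F F1 G : state -> {poly R}) := forall i : nat,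
  ito (fun z => (F z)`_i) (fun z => (F1 z)`_i) (fun z => (G z)`_i).

Lemma itoP_ext F F1 G F' F1' G' : itoP F F1 G -> F =1 F' -> F1 =1 F1' -> G =1 G' ->
  itoP F' F1' G'.
Proof. by move=> I /funext <- /funext <- /funext <-. Qed.

Lemma itoP_poly (q : {poly R}) : itoP (fun=> q) (fun=> 0) (fun=> 0).
Proof. by move=> i; apply: (ito_eq (ito_cst kappa eps K q`_i)) => z; rewrite ?coef0. Qed.

Lemma itoP_cst f f1 G : ito f f1 G ->
  itoP (fun z => (f z)%:P) (fun z => (f1 z)%:P) (fun z => (G z)%:P).
Proof.
move=> If i; case: (eqVneq i 0%N) => [->|/negPf i0].
    by apply: (ito_eq If) => z; rewrite coefC.
by apply: (ito_eq (ito_cst kappa eps K 0)) => z; rewrite coefC i0.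
Qed.

Lemma itoP_add F F1 G H H1 L : itoP F F1 G -> itoP H H1 L ->
  itoP (fun z => F z + H z) (fun z => F1 z + H1 z) (fun z => G z + L z).
Proof.
by move=> IF IH i; apply: (ito_eq (ito_add K1 (IF i) (IH i))) => z; rewrite coefD.
Qed.

Lemma itoP_mul F F1 G H H1 L : itoP F F1 G -> itoP H H1 L ->
  itoP (fun z => F z * H z) (fun z => F z * H1 z + H z * F1 z)
       (fun z => F z * L z + H z * G z + F1 z * H1 z).
Proof.
move=> IF IH i.
have := @ito_sum _ (index_enum 'I_i.+1) xpredT _ _ _ (fun j => ito_mul K1 (IF (j : nat)) (IH (i - j)%N)).
move=> I; apply: (ito_eq I) => z.
- by rewrite coefM.
- by rewrite coefD [H z * _]mulrC !coefM -big_split/=; apply: eq_bigr => j _; rewrite [X in _ + X]mulrC.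
- rewrite !coefD [H z * _]mulrC !coefM -!big_split/=; apply: eq_bigr => j _.
  by rewrite [(H z)`_ _ * _]mulrC.
Qed.

Lemma itoP_exp_poly F q k : itoP F (fun=> 0) (fun=> q) ->
  itoP (fun z => F z ^+ k) (fun=> 0) (fun z => k%:R * q * F z ^+ k.-1).
Proof.
move=> IF; elim: k => [|k IH].
  by apply: (itoP_ext (itoP_poly 1)) => z; rewrite ?expr0// !mul0r.
apply: (itoP_ext (itoP_mul IF IH)) => z; rewrite ?exprS// ?mulr0 ?addr0//.
by case: k {IH} => [|k] /=; rewrite -?[k.+2%:R]natr1 ?exprS; ring.
Qed.

(** Ito's formula for [herm], by induction along its recursion: the correction is half the squared
    noise coefficient, the constant [w], times the second derivative in [a]. *)
Lemma itoP_herm F F1 G v w n : itoP F F1 G -> (forall z, F1 z ^+ 2 = 2 * w) ->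
  itoP (fun z => herm (F z) v n) (fun z => dherm (F z) v n * F1 z)
    (fun z => dherm (F z) v n * G z + ddherm (F z) v n * w).
Proof.
move=> IF Fw; elim/herm_ind2: n => [||n IH1 IH2].
- by apply: (itoP_ext (itoP_poly 1)) => z //; rewrite /dherm /ddherm !mul0r// addr0.
- by apply: (itoP_ext IF) => z //; rewrite /dherm /ddherm /= ?mulr1 ?mul1r// mul0r addr0.
have I1 := itoP_mul IF IH2.
have I2 := itoP_mul (itoP_poly (n.+1%:R * v)) IH1.
apply: (itoP_ext (itoP_add I1 I2)) => z; rewrite ?hermSS// ?dhermSS ?ddhermSS; first by ring.
have -> : herm (F z) v n.+1 * G z = dherm (F z) v n.+2 * G z - F z * dherm (F z) v n.+1 * G z - n.+1%:R * v * dherm (F z) v n * G z.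
  by rewrite dhermSS; ring.
rewrite dhermSS [in F1 z * (_ * F1 z)]mulrCA -expr2 Fw; ring.
Qed.

(** For [u ^+ (2 * i)] the drift contributes [- 2 * i * (4 - kappa)] and the second order term
    [i * (2 * i - 1) * kappa]; their sum is [- i * (8 - (2 * i + 1) * kappa)], the source of the
    denominators in the theorem. *)
Lemma ito_tpow i : ito (tpow i) (fun z => (2 * i)%:R * Num.sqrt kappa * tpow i z / st_u z)
  (fun z => - i%:R * (8 - (2 * i + 1)%:R * kappa) * tpow i z / st_u z ^+ 2).
Proof.
have tu : tame st_u by exact: tame_u.
have tv : tame (fun z => (st_u z)^-1) by exact: tame_inv_u.
have sk : Num.sqrt kappa ^+ 2 = kappa by rewrite sqr_sqrtr// ltW.
pose X1 z := Num.sqrt kappa * (st_u z)^-1.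
pose X2 z := - (4 - kappa) * ((st_u z)^-1 * (st_u z)^-1).
have tX1 : tame X1 by rewrite /X1; solve_tame.
have tX2 : tame X2 by rewrite /X2; solve_tame.
have u0 z : valid z -> st_u z != 0.
  by move=> /and3P[ue _ _]; rewrite gt_eqF// (lt_trans eps0).
have P1 : power_ito kappa eps K X1 X2 1 st_u.
  apply: (ito_ext_valid (ito_u kappa eps0 K1)) => //.
  - by move=> z /u0 uz; rewrite /X1; field.
  - by move=> z /u0 uz; rewrite /X1 /X2; field.
  - by solve_tame.
  - by solve_tame.
have P2 := power_ito_exp K1 tX1 tX2 (2 * i) P1.
have tt : tame (tpow i) by rewrite /tpow; solve_tame.
apply: (ito_ext_valid (ito_mul K1 (ito_cst kappa eps K (tcoef i)) P2)) => //.
- by move=> z /u0 uz; rewrite /X1 /tpow; field.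
- move=> z /u0 uz; rewrite mul0r /X1 /X2 /tpow exprMn sk (natrD _ _ 1) natrM.
  by field.
- by apply: tame_mul => //; solve_tame.
- have -> : (fun z => - i%:R * (8 - (2 * i + 1)%:R * kappa) * tpow i z / st_u z ^+ 2) =
     (fun z => - i%:R * (8 - (2 * i + 1)%:R * kappa) * tpow i z * (st_u z)^-1 ^+ 2).
    by apply/funext => z; rewrite exprVn.
  by solve_tame.
Qed.

Lemma itoP_poly_a : itoP poly_a (fun=> (Num.sqrt kappa)%:P * 'X)
  (fun z => (2 * st_x z)%:P + (- (8 - kappa) / st_u z)%:P * 'X).
Proof.
have Ic : ito (fun z => 2 * st_c z) (fun=> Num.sqrt kappa) (fun z => - (8 - kappa) / st_u z).
  have I1 := ito_mul K1 (ito_cst kappa eps K (-4)) (ito_s eps0 K1 k4).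
  have I2 := ito_add K1 (ito_u kappa eps0 K1) (ito_add K1 (ito_cst kappa eps K (-2)) I1).
  apply: (ito_eq I2) => z; rewrite ?mulr0 ?mul0r ?addr0//; last by ring.
  by rewrite /(st_c); field.
have I1 := itoP_mul (itoP_cst Ic) (itoP_poly 'X).
have I2 := itoP_cst (ito_a eps K1 k4).
have I3 := itoP_add I2 I1.
apply: (itoP_ext I3) => z //.
  by rewrite polyC0; ring.
ring.
Qed.

Lemma itoP_poly_l : itoP poly_l (fun=> 0) (fun=> 2%:P).
Proof.
have I1 := ito_mul K1 (ito_cst kappa eps K 2) (ito_t kappa eps K).
apply: (itoP_ext (itoP_add (itoP_cst I1) (itoP_poly (2%:P * 'X)))) => z //.
  by rewrite !mulr0 !addr0 polyC0.
by rewrite !mulr0 !addr0 mulr1.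
Qed.

Variables (n m : nat).
Let p := (n + (3 * m)./2)%N.
Hypotheses (om : ~~ odd m) (kp : 0 < 8 - (2 * p + 1)%:R * kappa).

(** The derivative of [poly_phi] with respect to [a]. *)
Let Q z := poly_l z ^+ n * dherm (poly_a z) poly_v m.

(** The drift of [2 * t] and the Ito correction of [herm] reproduce the derivative in the lifetime,
    because [poly_l] has derivative 2 and [poly_v] has derivative [2 * w]. What is left is the
    excess [u] of [2 * x] over [2 * c] and the drift of [c], both multiplied by [Q]. *)
Let itoP_phi : itoP (poly_phi n m) (fun z => (Num.sqrt kappa)%:P * (Q z * 'X))
  (fun z => (poly_phi n m z)^`() + ((st_u z)%:P * Q z + (- (8 - kappa) / st_u z)%:P * (Q z * 'X))).
Proof.
pose w : {poly R} := (kappa / 2)%:P * 'X^2.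
have w1 (z : state) : ((Num.sqrt kappa)%:P * 'X) ^+ 2 = 2 * w.
  rewrite exprMn -rmorphXn /= sqr_sqrtr ?ltW// /w mulrA; congr (_ * _).
  by rewrite -polyC_natr -polyCM; congr (_%:P); field.
have vw : poly_v^`() = 2 * w.
  rewrite /poly_v derivM derivC mul0r add0r derivXn /w; have xy : kappa / 3 * 3 = 2 * (kappa / 2) by field.
  move: (kappa / 3) (kappa / 2) xy => x y xy; rewrite -[_ *+ 3]mulr_natl [LHS]mulrA [RHS]mulrA; congr (_ * _).
  by rewrite -!polyC_natr -!polyCM; congr (_%:P).
have I1 := itoP_herm poly_v m itoP_poly_a w1.
have I2 := itoP_exp_poly n itoP_poly_l.
apply: (itoP_ext (itoP_mul I2 I1)) => z //.
  by rewrite /Q; ring.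
rewrite /poly_phi derivM (deriv_herm _ _ vw) /Q.
have -> : (poly_a z)^`() = (2 * st_c z)%:P.
  by rewrite /poly_a derivD !derivM !derivC derivX; ring.
have -> : (poly_l z ^+ n)^`() = n%:R * 2%:P * poly_l z ^+ n.-1.
  rewrite deriv_exp /poly_l derivD derivM !derivC derivX !mul0r !add0r mulr1 -mulr_natl; ring.
have -> : (2 * st_x z)%:P = (2 * st_c z)%:P + (st_u z)%:P.
  by rewrite -polyCD; congr (_%:P); rewrite /(st_x) /(st_c); field.
ring.
Qed.

Let den_neq0 i : (i <= p)%N -> 8 - (2 * i + 1)%:R * kappa != 0.
Proof.
move=> ip; rewrite gt_eqF// (lt_le_trans kp)// lerD2l lerN2 ler_wpM2r ?(ltW k0)//.
by rewrite ler_nat leq_add2r leq_mul2l ip.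
Qed.

Let tpowS z i : (i < p)%N -> (8 - (2 * i.+1 + 1)%:R * kappa) * tpow i.+1 z = st_u z ^+ 2 * tpow i z.
Proof.
move=> ip; rewrite /tpow /tcoef big_nat_recr//= invfM mulnS exprD.
move: (den_neq0 ip); rewrite mulnS; move: (8 - (2 + _ + 1)%:R * _) => D D0.
by move: (\prod_(_ <= _ < _) _)^-1 => w; field.
Qed.

Let size_affine (b c : R) : (size (b%:P + c%:P * 'X)%R <= 2)%N.
Proof.
by rewrite addrC size_MXaddC; case: ifP => // _; rewrite ltnS size_polyC_leq1.
Qed.

Let size_Q z : (size (Q z) <= p)%N.
Proof.
have sl : (size (poly_l z) <= 2)%N.
  exact: size_affine.
have sa : (size (poly_a z) <= 2)%N.
  exact: size_affine.
have sv : (size poly_v <= 4)%N.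
  by rewrite /poly_v mul_polyC (leq_trans (size_scale_leq _ _))// size_polyXn.
have sln : (size (poly_l z ^+ n) <= n.+1)%N.
  rewrite (leq_trans (size_poly_exp_leq _ _))// ltnS.
  by move: (size _) sl => i; nia.
rewrite /Q /dherm; case: m om @p => [|k] om' p'; first by rewrite mul0r mulr0 size_poly0.
rewrite mulrCA mulr_natl -scaler_nat (leq_trans (size_scale_leq _ _))//.
rewrite (leq_trans (size_polyMleq _ _))//; have /= := size_herm k sa sv.
rewrite /p'; move: (size _) (size _) sln => i j ni jk; lia.
Qed.

Let size_phi z : (size (poly_phi n m z) <= p.+1)%N.
Proof.
have sl : (size (poly_l z) <= 2)%N.
  exact: size_affine.
have sa : (size (poly_a z) <= 2)%N.
  exact: size_affine.
have sv : (size poly_v <= 4)%N.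
  by rewrite /poly_v mul_polyC (leq_trans (size_scale_leq _ _))// size_polyXn.
have sln : (size (poly_l z ^+ n) <= n.+1)%N.
  rewrite (leq_trans (size_poly_exp_leq _ _))// ltnS.
  by move: (size _) sl => i; nia.
rewrite /poly_phi (leq_trans (size_polyMleq _ _))//; have /= := size_herm m sa sv.
rewrite /p; move: (size _) (size _) sln => i j ni jk; lia.
Qed.

Lemma ito_phi : exists f1, exists2 G, ito (phi n m) f1 G & forall z, valid z -> G z = 0.
Proof.
have I := @ito_sum _ (index_enum 'I_p.+1) xpredT _ _ _
  (fun i => ito_mul K1 (itoP_phi (i : nat)) (ito_tpow (i : nat))).
eexists; eexists; first exact: I.
move=> z /and3P[ue _ _]; have u0 : st_u z != 0 by rewrite gt_eqF// (lt_trans eps0).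
have sk : Num.sqrt kappa ^+ 2 = kappa by rewrite sqr_sqrtr// ltW.
have Qp : (Q z)`_p = 0 by apply: nth_default; exact: size_Q.
have Pp : (poly_phi n m z)`_p.+1 = 0 by apply: nth_default; exact: size_phi.
pose Qm i := (Q z * 'X)`_i.
have Qm0 : Qm 0%N = 0 by rewrite /Qm coefMX.
have QmS i : Qm i.+1 = (Q z)`_i by rewrite /Qm coefMX.
(* The generator is a telescoping sum. The product of the noise coefficients of [poly_phi] and
   [tpow i] turns the factor [8 - kappa] of the drift of [c] into [8 - (2 * i + 1) * kappa], so that
   the terms with a negative power of [u] form [- S i]; the recursion [tpowS] identifies the others
   with [S i.+1]. Both ends vanish: [S 0] because of the factors [i] and [Qm 0], and [S p.+1] by
   definition, consistently with the degree bounds. *)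
pose S i := if (i <= p)%N then
  (8 - (2 * i + 1)%:R * kappa) * tpow i z * (i%:R * (poly_phi n m z)`_i / st_u z ^+ 2 + Qm i / st_u z) else 0.
transitivity (\sum_(0 <= i < p.+1) (S i.+1 - S i)); last first.
  by rewrite telescope_sumr// /S ltnn Qm0 !mul0r addr0 mulr0 subr0.
rewrite big_mkord; apply: eq_bigr => -[i /= ip] _.
have -> : S i.+1 = tpow i z * (i.+1%:R * (poly_phi n m z)`_i.+1 + st_u z * (Q z)`_i).
  rewrite /S; case: ltnP => ip'; first by rewrite tpowS// QmS; field.
  have -> : i = p by apply/eqP; rewrite eqn_leq ip' -ltnS ip.
  by rewrite Qp Pp !mulr0 addr0 mulr0.
rewrite /S -ltnS ip !coefD !coefCM coef_deriv -mulr_natl -/(Qm i) natrD natrM.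
move: (tpow i z) (Qm i) ((Q z)`_i) ((poly_phi n m z)`_i) ((poly_phi n m z)`_i.+1) => t x y v w.
rewrite [Num.sqrt kappa * x * _](_ : _ = Num.sqrt kappa ^+ 2 * (x * (2 * i%:R) * t / st_u z)); last by ring.
by rewrite sk; field.
Qed.

End generator.
End martingale_polynomial.

(** * Growth of the martingale polynomial by scaling *)

Section homogeneity.
Context {R : realType} (kappa : R).
Hypotheses (k0 : 0 < kappa) (k4 : kappa < 4).
Local Notation state := (R * R * R * R)%type.
Local Notation lyapunov := (lyapunov kappa).
Local Notation st_u := (st_u kappa).
Local Notation st_c := (st_c kappa).

(* Under the scaling K ~ u^2 ~ t, a ~ K^(3/2) the Lyapunov function has order
   K^3, hence the sixth powers. *)
Definition homog (i k : nat) (f : state -> R) := exists2 C : R, 0 <= C &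
  forall (K : R) (z : state), 1 <= K -> 0 <= st_t z <= K ->
    f z ^+ 6 * lyapunov K z ^+ i <= C * lyapunov K z ^+ k.

Lemma sixth_power_add (x y : R) : (x + y) ^+ 6 <= 32 * (x ^+ 6 + y ^+ 6).
Proof.
rewrite !(exprM _ 2 3).
have h : (x + y) ^+ 2 <= 2 * (x ^+ 2 + y ^+ 2) by have := sqr_ge0 (x - y); nra.
apply: (@le_trans _ _ ((2 * (x ^+ 2 + y ^+ 2)) ^+ 3)).
  by rewrite lerXn2r// nnegrE ?sqr_ge0// mulr_ge0// addr_ge0// sqr_ge0.
move: (sqr_ge0 x) (sqr_ge0 y); move: (x ^+ 2) (y ^+ 2) => a b a0 b0.
have : 0 <= (a + b) * (a - b) ^+ 2 by rewrite mulr_ge0 ?addr_ge0// sqr_ge0.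
have -> : (2 * (a + b)) ^+ 3 = 32 * (a ^+ 3 + b ^+ 3) - 24 * ((a + b) * (a - b) ^+ 2) by ring.
lra.
Qed.

Let lyap0 (K : R) (z : state) : 1 <= K -> 0 < lyapunov K z.
Proof. by move=> K1; rewrite (lt_le_trans ltr01)// lyapunov_ge1. Qed.

Lemma homog0 i k : homog i k (fun=> 0).
Proof. by exists 0 => // K z _ _; rewrite expr0n !mul0r. Qed.

Lemma homog_cst c : homog 0 0 (fun=> c).
Proof.
exists (c ^+ 6) => [|K z _ _]; first by rewrite (exprM _ 3 2) sqr_ge0.
by rewrite expr0 !mulr1.
Qed.

Lemma homog_shift i j k f : homog i k f -> homog (i + j) (k + j) f.
Proof.
move=> [C C0 H]; exists C => // K z K1 tK.
by rewrite !exprD !mulrA ler_wpM2r ?exprn_ge0 ?(ltW (lyap0 _ K1))// H.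
Qed.

Lemma homog_cancel i j k f : homog (i + j) (k + j) f -> homog i k f.
Proof.
move=> [C C0 H]; exists C => // K z K1 tK; have := H K z K1 tK.
by rewrite !exprD !mulrA ler_pM2r// exprn_gt0// lyap0.
Qed.

Lemma homog_add i k f h : homog i k f -> homog i k h -> homog i k (fun z => f z + h z).
Proof.
move=> [C C0 Hf] [D D0 Hh]; exists (32 * (C + D)) => [|K z K1 tK].
  by rewrite mulr_ge0// addr_ge0.
have := Hf K z K1 tK; have := Hh K z K1 tK.
have := sixth_power_add (f z) (h z).
have : 0 <= lyapunov K z ^+ i by rewrite exprn_ge0// ltW// lyap0.
move: (_ ^+ i) (_ ^+ k) ((_ + _) ^+ 6) => l l' s l0 A B E.
rewrite (le_trans (ler_wpM2r l0 A))// -!mulrA ler_wpM2l// !mulrDl lerD//.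
Qed.

Lemma homog_mul i k j l f h : homog i k f -> homog j l h ->
  homog (i + j) (k + l) (fun z => f z * h z).
Proof.
move=> [C C0 Hf] [D D0 Hh]; exists (C * D) => [|K z K1 tK]; first exact: mulr_ge0.
rewrite exprMn !exprD mulrACA [leRHS]mulrACA ler_pM//.
- by apply: mulr_ge0; [exact: exprn_even_ge0|rewrite exprn_ge0// ltW// lyap0].
- by apply: mulr_ge0; [exact: exprn_even_ge0|rewrite exprn_ge0// ltW// lyap0].
- exact: Hf.
- exact: Hh.
Qed.

Lemma homog_exp k f j : homog 0 k f -> homog 0 (k * j) (fun z => f z ^+ j).
Proof.
move=> hf; elim: j => [|j IH]; first by rewrite muln0; exact: homog_cst.
have -> : (fun z => f z ^+ j.+1) = (fun z => f z * f z ^+ j).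
  by apply/funext => z; rewrite exprS.
by rewrite mulnS; exact: (homog_mul hf IH).
Qed.

Lemma homog_sum (I : Type) (r : seq I) i k (f : I -> state -> R) :
  (forall j, homog i k (f j)) -> homog i k (fun z => \sum_(j <- r) f j z).
Proof.
move=> hf; elim: r => [|j r IH].
  by under eq_fun do rewrite big_nil; exact: homog0.
by under eq_fun do rewrite big_cons; exact: homog_add.
Qed.

Let weight_lyap (K : R) (z : state) : 1 <= K -> weight kappa K z ^+ 3 <= lyapunov K z.
Proof. by move=> K1; rewrite /(lyapunov) lerDl sqr_ge0. Qed.

Let weight0 (K : R) (z : state) : 1 <= K -> 0 <= weight kappa K z.
Proof. by move=> K1; apply: le_trans (weight_ge _ _ _); rewrite (le_trans ler01). Qed.

Lemma homog_sqr C f : (forall (K : R) (z : state), 1 <= K -> 0 <= st_t z <= K ->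
  f z ^+ 2 <= C * weight kappa K z) -> homog 0 1 f.
Proof.
move=> H; exists (`|C| ^+ 3) => [|K z K1 tK]; first by rewrite exprn_ge0.
rewrite expr0 mulr1 expr1 (exprM _ 2 3).
apply: (@le_trans _ _ ((`|C| * weight kappa K z) ^+ 3)).
  rewrite lerXn2r ?nnegrE ?sqr_ge0 ?mulr_ge0 ?weight0//.
  by rewrite (le_trans (H K z K1 tK))// ler_wpM2r ?weight0// ler_norm.
by rewrite exprMn ler_wpM2l ?exprn_ge0// weight_lyap.
Qed.

Lemma homog_u : homog 0 1 st_u.
Proof.
apply: (@homog_sqr 1) => K z K1 _.
by rewrite mul1r /weight addrAC lerDr addr_ge0 ?sqr_ge0// (le_trans ler01).
Qed.

Lemma homog_c : homog 0 1 st_c.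
Proof.
have [C C0 H] := st_x_le k4.
have -> : st_c = (fun z => st_x kappa z + - 2^-1 * st_u z).
  by apply/funext => z; rewrite /(st_c) /st_x; field.
apply: homog_add; last exact: (homog_mul (homog_cst (- 2^-1)) homog_u).
by apply: (@homog_sqr C) => K z K1 _; exact: H.
Qed.

Lemma homog_t : homog 0 2 st_t.
Proof.
exists 1 => // K z K1 /andP[t0 tK]; rewrite expr0 mulr1 mul1r.
have K0 : 0 <= K by rewrite (le_trans t0).
apply: (@le_trans _ _ (K ^+ 6)); first by rewrite lerXn2r.
rewrite (exprM _ 3 2) lerXn2r ?nnegrE ?exprn_ge0 ?(ltW (lyap0 _ K1))//.
apply: le_trans (weight_lyap z K1).
by rewrite lerXn2r ?nnegrE ?weight0// weight_ge.
Qed.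

Lemma homog_a : homog 0 3 st_a.
Proof.
exists 1 => // K z K1 _; rewrite expr0 mulr1 mul1r (exprM _ 2 3).
rewrite lerXn2r ?nnegrE ?sqr_ge0 ?(ltW (lyap0 _ K1))//.
by rewrite /(lyapunov) lerDr exprn_ge0// weight0.
Qed.

(** The indeterminate is a time, of order 2, so the coefficient of degree [i] has order
    [k - 2 * i]. *)
Definition homogP k (F : state -> {poly R}) := forall i, homog (2 * i) k (fun z => (F z)`_i).

Lemma homogP_mul k l F H : homogP k F -> homogP l H -> homogP (k + l) (fun z => F z * H z).
Proof.
move=> hF hH i; have -> : (fun z => (F z * H z)`_i) =
    (fun z => \sum_(j < i.+1) (F z)`_j * (H z)`_(i - j)).
  by apply/funext => z; rewrite coefM.
apply: homog_sum => j; have -> : (2 * i = 2 * j + 2 * (i - j))%N.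
  by rewrite -mulnDr subnKC// -ltnS.
exact: (homog_mul (hF j) (hH (i - j)%N)).
Qed.

Lemma homogP_add k F H : homogP k F -> homogP k H -> homogP k (fun z => F z + H z).
Proof.
by move=> hF hH i; under eq_fun do rewrite coefD; exact: homog_add.
Qed.

Lemma homogP_cst (c : R) : homogP 0 (fun=> c%:P).
Proof.
move=> [|i]; under eq_fun do rewrite coefC /=; [exact: homog_cst|exact: homog0].
Qed.

Lemma homogP_exp k F j : homogP k F -> homogP (k * j) (fun z => F z ^+ j).
Proof.
move=> hF; elim: j => [|j IH].
  by rewrite muln0; under eq_fun do rewrite expr0; exact: (homogP_cst 1).
by rewrite mulnS; under eq_fun do rewrite exprS; exact: homogP_mul.
Qed.

Lemma homogP_affine k f h : homog 0 k f -> homog 2 k h ->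
  homogP k (fun z => (f z)%:P + (h z)%:P * 'X).
Proof.
move=> hf hh [|[|i]].
- by under eq_fun do rewrite coefD coefC coefMX /= addr0.
- by under eq_fun do rewrite coefD coefC coefMX /= add0r coefC /=.
- by under eq_fun do rewrite coefD coefC coefMX /= add0r coefC /=; exact: homog0.
Qed.

Lemma homogP_herm F v n : homogP 3 F -> homogP 6 (fun=> v) -> homogP (3 * n) (fun z => herm (F z) v n).
Proof.
move=> hF hv; elim/herm_ind2: n => [||n IH1 IH2].
- exact: (homogP_cst 1).
- exact: hF.
under eq_fun do rewrite hermSS; apply: homogP_add.
  have -> : (3 * n.+2 = 3 + 3 * n.+1)%N by rewrite -mulnS.
  exact: (homogP_mul hF IH2).
have -> : (3 * n.+2 = 0 + 6 + 3 * n)%N by lia.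
apply: homogP_mul => //; apply: homogP_mul => //.
by rewrite -polyC_natr; exact: homogP_cst.
Qed.

(** The coefficient of degree [i] and the factor [tpow i] have the complementary orders
    [2 * p - 2 * i] and [2 * i], so every term has order [2 * p]. The resulting growth bound
    involves neither [eps] nor the mesh, and its constant does not depend on [K]. *)
Lemma homog_phi n m : ~~ odd m -> homog 0 (2 * (n + (3 * m)./2)) (phi kappa n m).
Proof.
move=> om; apply: homog_sum => i; apply: (@homog_cancel 0 (2 * i)).
rewrite [(0 + _)%N]addnC; apply: homog_mul; last first.
  rewrite /tpow; apply: (homog_mul (homog_cst _)).
  by have := homog_exp (2 * i) homog_u; rewrite mul1n.
have -> : (2 * (n + (3 * m)./2) = 2 * n + 3 * m)%N by lia.
apply: homogP_mul.
  apply: homogP_exp; apply: homogP_affine.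
    exact: (homog_mul (homog_cst 2) homog_t).
  exact: (homog_shift 2 (homog_cst 2)).
apply: homogP_herm.
  apply: homogP_affine; first exact: homog_a.
  exact: (homog_shift 2 (homog_mul (homog_cst 2) homog_c)).
move=> j; rewrite /poly_v; under eq_fun do rewrite coefCM coefXn.
case: eqVneq => [->|_] /=; last by rewrite mulr0; exact: homog0.
exact: (homog_shift 6 (homog_cst _)).
Qed.

End homogeneity.

(** * Continuity of the martingale polynomial *)

Section phi_continuity.
Context {R : realType} (kappa : R).
Local Notation state := (R * R * R * R)%type.

Let contM (f h : state -> R) : continuous f -> continuous h -> continuous (fun z => f z * h z).
Proof. by move=> cf ch z; apply: cvgM; [exact: cf|exact: ch]. Qed.
Let contD (f h : state -> R) : continuous f -> continuous h -> continuous (fun z => f z + h z).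
Proof. by move=> cf ch z; apply: cvgD; [exact: cf|exact: ch]. Qed.
Let contC (c : R) : continuous (fun _ : state => c).
Proof. by move=> z; exact: cvg_cst. Qed.
Let contX (f : state -> R) n : continuous f -> continuous (fun z => f z ^+ n).
Proof.
move=> cf; elim: n => [|n IH]; first exact: contC.
by under eq_fun do rewrite exprS; exact: contM.
Qed.
Let cont_sum (I : Type) (r : seq I) (f : I -> state -> R) :
  (forall j, continuous (f j)) -> continuous (fun z => \sum_(j <- r) f j z).
Proof.
move=> hf; elim: r => [|j r IH].
  by under eq_fun do rewrite big_nil; exact: contC.
by under eq_fun do rewrite big_cons; exact: contD.
Qed.

Lemma continuous_st_t : continuous (@st_t R).
Proof. by move=> z; exact: (cvg_comp _ _ (cvg_comp _ _ cvg_fst cvg_fst) cvg_fst). Qed.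
Lemma continuous_st_b : continuous (@st_b R).
Proof. by move=> z; exact: (cvg_comp _ _ (cvg_comp _ _ cvg_fst cvg_fst) cvg_snd). Qed.
Lemma continuous_st_s : continuous (@st_s R).
Proof. by move=> z; exact: (cvg_comp _ _ cvg_fst cvg_snd). Qed.
Lemma continuous_st_a : continuous (@st_a R).
Proof. by move=> z; exact: cvg_snd. Qed.

Lemma continuous_st_u : continuous (@st_u R kappa).
Proof.
rewrite /st_u; under eq_fun do rewrite -mulNr.
by apply: contD; [apply: contD|]; [exact: contC|apply: contM|apply: contM];
  [exact: contC|exact: continuous_st_b|exact: contC|exact: continuous_st_s].
Qed.

Lemma continuous_st_c : continuous (@st_c R kappa).
Proof.
rewrite /st_c; under eq_fun do rewrite -mulNr.
apply: contD; first apply: contD.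
- by apply: contM; [exact: continuous_st_u|exact: contC].
- exact: contC.
- by apply: contM; [exact: contC|exact: continuous_st_s].
Qed.

Definition continuousP (F : state -> {poly R}) := forall i, continuous (fun z => (F z)`_i).

Lemma continuousP_mul F H : continuousP F -> continuousP H -> continuousP (fun z => F z * H z).
Proof.
move=> hF hH i; under eq_fun do rewrite coefM.
by apply: cont_sum => j; exact: contM.
Qed.
Lemma continuousP_add F H : continuousP F -> continuousP H -> continuousP (fun z => F z + H z).
Proof. by move=> hF hH i; under eq_fun do rewrite coefD; exact: contD. Qed.
Lemma continuousP_cst q : continuousP (fun=> q).
Proof. by move=> i; exact: contC. Qed.
Lemma continuousP_polyC (f : state -> R) : continuous f -> continuousP (fun z => (f z)%:P).
Proof.
by move=> cf [|i]; under eq_fun do rewrite coefC /=; [exact: cf|exact: contC].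
Qed.

Lemma continuousP_herm F v n : continuousP F -> continuousP (fun z => herm (F z) v n).
Proof.
move=> hF; elim/herm_ind2: n => [||n IH1 IH2]; [exact: continuousP_cst|exact: hF|].
under eq_fun do rewrite hermSS; apply: continuousP_add; apply: continuousP_mul => //.
Qed.

Lemma continuous_phi n m : continuous (phi kappa n m).
Proof.
apply: cont_sum => i; apply: contM.
  apply: continuousP_mul; last first.
    apply: continuousP_herm; apply: continuousP_add.
      exact/continuousP_polyC/continuous_st_a.
    apply: continuousP_mul; last exact: continuousP_cst.
    by apply: continuousP_polyC; apply: contM; [exact: contC|exact: continuous_st_c].
  elim: (n) => [|k IH]; first exact: continuousP_cst.
  under eq_fun do rewrite exprS; apply: continuousP_mul => //.
  apply: continuousP_add; last exact: continuousP_cst.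
  by apply: continuousP_polyC; apply: contM; [exact: contC|exact: continuous_st_t].
by apply: contM; [exact: contC|apply: contX; exact: continuous_st_u].
Qed.

End phi_continuity.

(** * Passage to the limit at a fixed horizon *)

Section liminf.
Context {R : realType}.
Implicit Types (u : (\bar R)^nat).

Lemma limn_einfE u : limn_einf u = ereal_sup (range (einfs u)).
Proof. by rewrite limn_einf_lim; apply/cvg_lim => //; exact: cvg_einfs_sup. Qed.

Lemma lt_limn_einf u (x : \bar R) : (x < limn_einf u)%E ->
  exists n0, forall N, (n0 <= N)%N -> (x < u N)%E.
Proof.
rewrite limn_einfE => /ereal_sup_gt[_ [n _ <-] xn]; exists n => N nN.
by apply: (lt_le_trans xn); apply: ereal_inf_lbound; exists N.
Qed.

Lemma limn_einf_ge u (x : \bar R) n0 : (forall N, (n0 <= N)%N -> (x <= u N)%E) ->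
  (x <= limn_einf u)%E.
Proof.
move=> H; rewrite limn_einfE; apply: ereal_sup_ge; exists (einfs u n0); first by exists n0.
by apply: le_ereal_inf_tmp => _ [N /= nN <-]; exact: H.
Qed.

Lemma limn_einf_le u (x : \bar R) n0 : (forall N, (n0 <= N)%N -> (u N <= x)%E) ->
  (limn_einf u <= x)%E.
Proof.
move=> H; rewrite limn_einfE; apply: ge_ereal_sup => _ [n _ <-].
apply: ereal_inf_le; exists (u (maxn n n0)); last by rewrite H// leq_maxr.
by exists (maxn n n0) => //=; rewrite leq_maxl.
Qed.

Lemma measurable_limn_einf d (T : measurableType d) (f : nat -> T -> \bar R) :
  (forall n, measurable_fun setT (f n)) ->
  measurable_fun setT (fun x => limn_einf (f ^~ x)).
Proof.
move=> mf; rewrite /limn_einf; apply: measurableT_comp => //.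
apply: measurable_fun_limn_esup => n; exact: measurableT_comp.
Qed.

End liminf.

(** * Expectations under an almost sure double limit *)

Section double_limit.
Context d (Omega : measurableType d) (R : realType) (P : probability Omega R).
Variables (F : nat -> nat -> Omega -> R) (Z : Omega -> R).
Hypothesis mF : forall k N, measurable_fun setT (F k N).
Hypothesis FZ : {ae P, forall w, forall e : R, 0 < e -> exists k0, forall k, (k0 <= k)%N ->
  exists n0, forall N, (n0 <= N)%N -> `|F k N w - Z w| <= e}.

(* The innermost limit is del -> 0, the outer one is eps -> 0. Taking inferior
   limits makes the limit measurable without measurability of the SLE path. *)
Definition double_liminf (w : Omega) : R :=
  fine (limn_einf (fun k => limn_einf (fun N => (F k N w)%:E))).

Lemma measurable_double_liminf : measurable_fun setT double_liminf.
Proof.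
apply: measurableT_comp; first exact: (fine_measurable measurableT).
apply: (measurable_limn_einf (f := fun k w => limn_einf (fun N => (F k N w)%:E))) => k.
by apply: (measurable_limn_einf (f := fun N w => (F k N w)%:E)) => N; exact/measurable_EFinP.
Qed.

Lemma double_liminfE : {ae P, forall w, double_liminf w = Z w}.
Proof.
apply: filterS FZ => w H; rewrite /double_liminf.
suff -> : limn_einf (fun k => limn_einf (fun N => (F k N w)%:E)) = (Z w)%:E by [].
apply/eqP; rewrite eq_le; apply/andP; split; apply/lee_addgt0Pr => e e0.
  have [k0 Hk] := H _ e0; apply: (@limn_einf_le _ _ _ k0) => k kk.
  have [n0 Hn] := Hk _ kk; apply: (@limn_einf_le _ _ _ n0) => N nN.
  rewrite -EFinD lee_fin -lerBlDl (le_trans (ler_norm _))//; exact: Hn.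
have [k0 Hk] := H _ e0; rewrite -leeBlDr//; apply: (@limn_einf_ge _ _ _ k0) => k kk.
have [n0 Hn] := Hk _ kk; apply: (@limn_einf_ge _ _ _ n0) => N nN.
rewrite -EFinB lee_fin lerBlDr -lerBlDl (le_trans (ler_norm _))// distrC; exact: Hn.
Qed.

(** Closeness holds eventually in [N] for each large [k], so there is no single sequence for
    dominated convergence. Fatou's lemma is applied twice, in [N] and then in [k], to the
    nonnegative [2 * M - |psi F - psi G|], whose double inferior limit is almost surely [2 * M]. *)
Lemma double_limit_expectation (psi : R -> R) (M : R) : continuous psi ->
  (forall x, `|psi x| <= M) -> forall e : R, 0 < e -> exists k0, forall k, (k0 <= k)%N ->
  exists n0, forall N, (n0 <= N)%N ->
    `|\int[P]_w psi (F k N w) - \int[P]_w psi (double_liminf w)| <= e.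
Proof.
move=> cpsi bpsi e e0; set G := double_liminf.
have M0 : 0 <= M by exact: le_trans (bpsi 0).
have mpsi : measurable_fun setT psi by exact: continuous_measurable_fun.
have mpF k N : measurable_fun setT (fun w => psi (F k N w)) by exact: measurableT_comp.
have mpG : measurable_fun setT (fun w => psi (G w)).
  by apply: measurableT_comp => //; exact: measurable_double_liminf.
pose D k N w := 2 * M - `|psi (F k N w) - psi (G w)|.
have D0 k N w : 0 <= D k N w.
  by rewrite subr_ge0 (le_trans (ler_normB _ _))// mulr_natl mulr2n lerD.
have mD k N : measurable_fun setT (fun w => (D k N w)%:E).
  apply/measurable_EFinP; apply: measurable_funB => //.
  by apply: measurableT_comp => //; exact: measurable_funB.
pose L k w := limn_einf (fun N => (D k N w)%:E).
have mL k : measurable_fun setT (L k) by exact: measurable_limn_einf.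
have L0 k w : (0 <= L k w)%E by apply: (@limn_einf_ge _ _ _ 0%N) => N _; rewrite lee_fin.
have LL : (\int[P]_w limn_einf (L ^~ w) = (2 * M)%:E)%E.
  transitivity (\int[P]_w (2 * M)%:E)%E; last first.
    by rewrite integral_expect ?expect_cst//; exact: integ_cst.
  apply: ae_eq_integral => //; first exact: measurable_limn_einf.
  apply: filterS2 double_liminfE FZ => w GZ H _.
  apply/eqP; rewrite eq_le; apply/andP; split.
    apply: (@limn_einf_le _ _ _ 0%N) => k _; apply: (@limn_einf_le _ _ _ 0%N) => N _.
    by rewrite lee_fin gerBl.
  apply/lee_addgt0Pr => h h0; rewrite -leeBlDr//.
  have := cpsi (Z w) => /cvgrPdist_le /(_ _ h0) /nbhs_ballP[r /= r0 Hr].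
  have r20 : 0 < r / 2 by rewrite divr_gt0.
  have [k0 Hk] := H _ r20; apply: (@limn_einf_ge _ _ _ k0) => k kk.
  have [n0 Hn] := Hk _ kk; apply: (@limn_einf_ge _ _ _ n0) => N nN.
  rewrite -EFinB lee_fin lerB// /G GZ distrC; apply: Hr.
  rewrite /ball/= distrC (le_lt_trans (Hn _ nN))// ltr_pdivrMr// ltr_pMr// ltr1n//.
have F1 := @fatou _ _ R P setT measurableT L mL (fun k w _ => L0 k w).
rewrite LL in F1.
have e20 : 0 < e / 2 by rewrite divr_gt0.
have [k0 Hk] : exists k0, forall k, (k0 <= k)%N -> ((2 * M - e / 2)%:E < \int[P]_w L k w)%E.
  by apply: lt_limn_einf; apply: lt_le_trans F1; rewrite lte_fin gtrBl.
exists k0 => k kk; have {}Hk := Hk k kk.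
have F2 := @fatou _ _ R P setT measurableT (fun N w => (D k N w)%:E) (mD k) (fun N w _ => D0 k N w).
have [n0 Hn] := lt_limn_einf (lt_le_trans Hk F2).
exists n0 => N nN; have := Hn N nN.
have jpF : integ P (fun w => psi (F k N w)).
  apply: (integ_le _ (integ_cst P M)) => // w.
  by rewrite (le_trans (bpsi _))// ler_norm.
have jpG : integ P (fun w => psi (G w)).
  apply: (integ_le _ (integ_cst P M)) => // w.
  by rewrite (le_trans (bpsi _))// ler_norm.
have jd : integ P (fun w => `|psi (F k N w) - psi (G w)|).
  apply: (integ_le _ (integB jpF jpG)) => [|w]; last by rewrite normr_id.
  by apply: measurableT_comp => //; exact: measurable_funB.
have jD : integ P (D k N) by apply: integB => //; exact: integ_cst.
rewrite integral_expect// lte_fin /D RintegralB//; last exact: integ_cst.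
rewrite expect_cst ltrD2l ltrN2 => lt; rewrite -RintegralB//.
apply: (le_trans (le_normr_Rintegral measurableT (integB jpF jpG))).
by rewrite (le_trans (ltW lt))// ler_pdivrMr// ler_peMr ?(ltW e0)// ler1n.
Qed.

(** Truncation at level [M] reduces to the bounded continuous case, and Fatou's lemma removes the
    truncation. *)
Lemma ge0_le_double_limit (h : R -> R) (C : R) : continuous h -> (forall x, 0 <= h x) ->
  (forall k (e : R), 0 < e -> exists n0, forall N, (n0 <= N)%N ->
     integ P (fun w => h (F k N w)) /\ \int[P]_w h (F k N w) <= C + e) ->
  (\int[P]_w (h (double_liminf w))%:E <= C%:E)%E.
Proof.
move=> ch h0 H; set G := double_liminf.
have mh : measurable_fun setT h by exact: continuous_measurable_fun.
have mhG : measurable_fun setT (fun w => h (G w)).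
  by apply: measurableT_comp => //; exact: measurable_double_liminf.
pose psi (M : nat) x := Num.min (M%:R : R) (h x).
have psi0 M x : 0 <= psi M x by rewrite /psi le_min ler0n h0.
have psiM M x : `|psi M x| <= M%:R by rewrite ger0_norm// /psi ge_min lexx.
have cpsi M : continuous (psi M).
  by move=> x; apply: (@continuous_min _ _ (fun=> M%:R) h); [exact: cvg_cst|exact: ch].
have mpsi M : measurable_fun setT (psi M) by exact: continuous_measurable_fun.
have EM M : (\int[P]_w (psi M (G w))%:E <= C%:E)%E.
  have jG : integ P (fun w => psi M (G w)).
    apply: (integ_le _ (integ_cst P M%:R)) => [|w]; last by rewrite (le_trans (psiM _ _))// ler_norm.
    by apply: measurableT_comp => //; exact: measurable_double_liminf.
  rewrite integral_expect// lee_fin; apply/ler_addgt0Pr => e e0.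
  have e20 : 0 < e / 2 by rewrite divr_gt0.
  have [k0 /(_ k0 (leqnn _))[n0 Hn]] := double_limit_expectation (cpsi M) (psiM M) e20.
  have [n1 Hn1] := H k0 _ e20.
  have := Hn _ (leq_maxl n0 n1); have [jF EF] := Hn1 _ (leq_maxr n0 n1).
  set N := maxn n0 n1.
  have : \int[P]_w psi M (F k0 N w) <= \int[P]_w h (F k0 N w).
    apply: le_Rintegral => //; last by move=> w _; rewrite /psi ge_min lexx orbT.
    apply: (integ_le _ jF) => [|w]; first exact: measurableT_comp.
    by rewrite !ger0_norm// /psi ge_min lexx orbT.
  by rewrite -/G => A /ler_normlP[B _]; lra.
apply: (@le_trans _ _ (\int[P]_w limn_einf (fun M => (psi M (G w))%:E))%E).
  apply: ge0_le_integral => //.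
  - by move=> w _; rewrite lee_fin.
  - exact/measurable_EFinP.
  - apply: (measurable_limn_einf (f := fun M w => (psi M (G w))%:E)) => M.
    by apply/measurable_EFinP; apply: measurableT_comp => //; exact: measurable_double_liminf.
  - move=> w _; apply: (@limn_einf_ge _ _ _ (Num.truncn (h (G w))).+1) => M MN.
    rewrite lee_fin /psi le_min lexx andbT (le_trans (ltW (truncnS_gt _)))// ler_nat//.
apply: (le_trans (@fatou _ _ R P setT measurableT (fun M w => (psi M (G w))%:E) _ _)) => //.
- by move=> M; apply/measurable_EFinP; apply: measurableT_comp => //; exact: measurable_double_liminf.
- by move=> M w _; rewrite lee_fin.
by apply: (@limn_einf_le _ _ _ 0%N) => M _; exact: EM.
Qed.

(** The sixth moment gives uniform integrability: clamping at a level [M >= 1] moves a number by at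
    most its sixth power over [M], hence each expectation by at most [C / M]. The clamped variables
    fall under the bounded case. *)
Lemma double_limit_eq (C c : R) :
  (forall k (e : R), 0 < e -> exists n0, forall N, (n0 <= N)%N ->
     [/\ integ P (F k N), integ P (fun w => F k N w ^+ 6),
       \int[P]_w (F k N w ^+ 6) <= C & `|\int[P]_w F k N w - c| <= e]) ->
  integ P double_liminf /\ \int[P]_w double_liminf w = c.
Proof.
move=> H; set G := double_liminf.
have mG : measurable_fun setT G by exact: measurable_double_liminf.
have C0 : 0 <= C.
  have [n0 /(_ n0 (leqnn _))[_ _ E _]] := H 0%N 1 ltr01.
  by apply: le_trans E; apply: Rintegral_ge0 => w _; rewrite exprn_even_ge0.
have G6 : (\int[P]_w (G w ^+ 6)%:E <= C%:E)%E.
  apply: (@ge0_le_double_limit (fun x => x ^+ 6)).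
  - by move=> x; exact: exprn_continuous.
  - by move=> x; rewrite exprn_even_ge0.
  - move=> k e e0; have [n0 Hn] := H k e e0; exists n0 => N nN.
    by have [_ ? ? _] := Hn N nN; split => //; rewrite (le_trans (_ : _ <= C))// lerDl ltW.
have j6 : integ P (fun w => G w ^+ 6).
  apply: (ge0_integ_lty _ _ G6); first exact: measurable_funX.
  by move=> w; rewrite exprn_even_ge0.
have E6 : \int[P]_w (G w ^+ 6) <= C by rewrite -lee_fin -integral_expect.
have norm6 (x : R) : `|x| <= 1 + x ^+ 6.
  have -> : x ^+ 6 = `|x| ^+ 6 by rewrite -normrX ger0_norm// exprn_even_ge0.
  case: (lerP `|x| 1) => x1; first by rewrite (le_trans x1)// lerDl exprn_ge0.
  by apply: (@le_trans _ _ (`|x| ^+ 6)); [rewrite exprS ler_peMr// exprn_ege1// ltW|rewrite lerDr].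
have jG : integ P G.
  apply: (integ_le mG (integD (integ_cst P 1) j6)) => w.
  by rewrite (le_trans (norm6 _))// ler_norm.
split => //.
pose clamp (M x : R) := Num.max (- M) (Num.min M x).
have ccl M : continuous (clamp M).
  move=> x; apply: (@continuous_max _ _ (fun=> - M) (fun x => Num.min M x)); first exact: cvg_cst.
  by apply: (@continuous_min _ _ (fun=> M) (fun x => x)); [exact: cvg_cst|exact: cvg_id].
have bcl M x : 0 <= M -> `|clamp M x| <= M.
  move=> M0; rewrite ler_norml /clamp le_max lexx /= ge_max ge_min lexx /=.
  by rewrite andbT (le_trans _ M0)// oppr_le0.
have dcl M x : 1 <= M -> `|clamp M x - x| <= x ^+ 6 / M.
  move=> M1; have M0 : 0 < M by rewrite (lt_le_trans ltr01).
  have x60 : 0 <= x ^+ 6 / M by rewrite divr_ge0 ?exprn_even_ge0// ltW.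
  case: (lerP `|x| M) => xM.
    move: xM; rewrite ler_norml => /andP[A B].
    by rewrite /clamp (min_idPr B) (max_idPr A) subrr normr0.
  apply: (@le_trans _ _ `|x|).
    rewrite /clamp; case: (ltP x 0) xM => x0.
      rewrite ltr0_norm// => xM; have xM' : x <= M by rewrite (le_trans (ltW x0))// ltW.
      rewrite (min_idPr xM') (_ : Num.max _ _ = - M); last by apply/max_idPl; rewrite lerNr ltW.
      by rewrite ler_norml; apply/andP; split; lra.
    rewrite ger0_norm// => xM; rewrite (min_idPl (ltW xM)).
    have -> : Num.max (- M) M = M by apply/max_idPr; lra.
    by rewrite ler_norml; apply/andP; split; lra.
  have -> : x ^+ 6 = `|x| ^+ 6 by rewrite -normrX ger0_norm// exprn_even_ge0.
  rewrite ler_pdivlMr// exprS ler_wpM2l//.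
  rewrite (le_trans (ltW xM))// exprS ler_peMr// exprn_ege1//.
  by rewrite (le_trans M1)// ltW.
have diff M (X : Omega -> R) : 1 <= M -> integ P X -> integ P (fun w => X w ^+ 6) ->
    \int[P]_w (X w ^+ 6) <= C -> `|\int[P]_w clamp M (X w) - \int[P]_w X w| <= C / M.
  move=> M1 jX jX6 EX; have M0 : 0 < M by rewrite (lt_le_trans ltr01).
  have mX := integ_measurable jX.
  have jc : integ P (fun w => clamp M (X w)).
    apply: (integ_le _ (integ_cst P M)) => [|w].
      by apply: measurableT_comp => //; exact: continuous_measurable_fun.
    by rewrite (le_trans (bcl _ _ (ltW M0)))// ler_norm.
  rewrite -RintegralB//; apply: (le_trans (le_normr_Rintegral measurableT (integB jc jX))).
  apply: (@le_trans _ _ (\int[P]_w (M^-1 * X w ^+ 6))).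
    apply: le_Rintegral => //.
    - apply: (integ_le _ (integB jc jX)) => [|w]; last by rewrite normr_id.
      by apply: measurableT_comp => //; apply: measurable_funB => //; exact: integ_measurable jc.
    - exact: integZ.
    - by move=> w _; rewrite mulrC dcl.
  by rewrite RintegralZl// mulrC ler_wpM2r// invr_ge0 ltW.
have key (M : R) : 1 <= M -> `|\int[P]_w G w - c| <= 2 * C / M.
  move=> M1; have M0 : 0 < M by rewrite (lt_le_trans ltr01).
  apply/ler_addgt0Pr => e e0.
  have e20 : 0 < e / 2 by rewrite divr_gt0.
  have [k0 /(_ k0 (leqnn _))[n0 Hn]] := double_limit_expectation (ccl M) (fun x => bcl M x (ltW M0)) e20.
  have [n1 Hn1] := H k0 _ e20.
  have := Hn _ (leq_maxl n0 n1); have [jF jF6 EF6 EF] := Hn1 _ (leq_maxr n0 n1).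
  move: (diff M _ M1 jF jF6 EF6) (diff M G M1 jG j6 E6) EF.
  rewrite -/G -mulrA; move: (C / M) => q.
  move: (\int[P]_w clamp M (F _ _ w)) (\int[P]_w clamp M (G w)) (\int[P]_w G w) (\int[P]_w F _ _ w) => a b x y.
  rewrite !ler_norml => /andP[? ?] /andP[? ?] /andP[? ?] /andP[? ?]; apply/andP; split; lra.
apply/eqP; rewrite -subr_eq0 -normr_le0; apply/ler_addgt0Pr => e e0; rewrite add0r.
pose M := 1 + 2 * C / e.
have M1 : 1 <= M by rewrite lerDl divr_ge0 ?mulr_ge0// ltW.
have M0 : 0 < M by rewrite (lt_le_trans ltr01).
rewrite (le_trans (key _ M1))// ler_pdivrMr// /M mulrDr mulr1 mulrCA divff ?gt_eqF// mulr1.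
by rewrite lerDr ltW.
Qed.

End double_limit.

Section mesh.
Context {R : realType}.

(** The time step is the square, [1 / N.+1], so an integer horizon [K] is reached after exactly
    [K * N.+1] steps, whatever the value of [eps]. *)
Definition mesh (N : nat) : R := Num.sqrt (N.+1%:R^-1).

Lemma mesh_sqr N : mesh N ^+ 2 = N.+1%:R^-1.
Proof. by rewrite sqr_sqrtr// invr_ge0. Qed.

Lemma mesh01 N : 0 < mesh N <= 1.
Proof.
rewrite sqrtr_gt0 invr_gt0 ltr0n /=.
by rewrite -[leRHS]sqrtr1 ler_sqrt// invf_le1 ?ltr0n// ler1n.
Qed.

Lemma mesh_small (e : R) : 0 < e -> exists n0, forall N, (n0 <= N)%N -> mesh N <= e.
Proof.
move=> e0; have e20 : 0 < e ^+ 2 by rewrite exprn_gt0.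
exists (Num.truncn (e ^+ 2)^-1) => N nN.
rewrite -(ger0_norm (ltW e0)) -sqrtr_sqr ler_sqrt ?sqr_ge0//.
rewrite invf_ple ?posrE ?ltr0n// (le_trans (ltW (truncnS_gt _)))// ler_nat//.
Qed.

Lemma mesh_steps (K N : nat) : (K * N.+1)%:R * mesh N ^+ 2 = K%:R.
Proof. by rewrite mesh_sqr natrM mulfK// pnatr_eq0. Qed.

Lemma mesh_steps3 (K N : nat) : (K * N.+1)%:R * mesh N ^+ 3 = K%:R * mesh N.
Proof. by rewrite exprSr mulrA mesh_steps. Qed.

End mesh.

Section horizon.
Context d (Omega : measurableType d) (R : realType) (P : probability Omega R).
Variables (g : nat -> nat -> {RV P >-> R}) (M : nat -> R).
Hypothesis g_indep : forall nu k, mutually_independent P (fun j : 'I_k => g nu j : Omega -> R).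
Hypothesis g_moment : forall nu i k, (\int[P]_w ((1 + `|g nu i w|) ^+ k)%:E <= (M k)%:E)%E.
Hypothesis g_mean : forall nu i, (\int[P]_w (g nu i w)%:E = 0)%E.
Hypothesis g_variance : forall nu i, (\int[P]_w (g nu i w ^+ 2)%:E = 1)%E.
Variables (kappa : R) (n m : nat).
Let p := (n + (3 * m)./2)%N.
Hypotheses (k0 : 0 < kappa) (k4 : kappa < 4) (om : ~~ odd m) (kp : 0 < 8 - (2 * p + 1)%:R * kappa).
Local Notation state := (R * R * R * R)%type.

Let z0 : state := (0, 0, 0, 0).
Let eps (k : nat) : R := k.+1%:R^-1.
Let eps0 k : 0 < eps k. Proof. by rewrite invr_gt0 ltr0n. Qed.

Definition euler (K k N : nat) (w : Omega) : state :=
  proc (g N) kappa (eps k) (mesh N) z0 (K * N.+1) w.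

Definition phi_limit (K : nat) := double_liminf (fun k N w => phi kappa n m (euler K k N w)).
Definition time_limit (K : nat) := double_liminf (fun k N w => st_t (euler K k N w)).

Let measurable_euler K k N (f : state -> R) : measurable_fun setT f ->
  measurable_fun setT (fun w => f (euler K k N w)).
Proof. by move=> mf; exact: (@measurable_proc _ _ _ P (g N) kappa (eps k) (mesh N) z0). Qed.

Let steps_le K N : (K * N.+1)%:R * mesh N ^+ 2 <= K%:R :> R.
Proof. by rewrite mesh_steps. Qed.

Let mesh_eps k : exists n0, forall N, (n0 <= N)%N -> mesh N <= eps k.
Proof. exact: mesh_small. Qed.

Lemma euler_time K k N w : 0 <= st_t (euler K k N w) <= K%:R.
Proof.
have := @proc_time _ _ _ P (g N) kappa (eps k) (mesh N) z0 (K * N.+1) erefl w.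
by rewrite mesh_steps.
Qed.

Let phi_z0 : phi kappa n m z0 = 2 ^+ (3 * n + 3 * m) * (kappa / 6) ^+ (m %/ 2)
     * (m`!%:R / ((m %/ 2)`!)%:R)
   / \prod_(1 <= j < (n + (3 * m) %/ 2).+1) (8 - (2 * j + 1)%:R * kappa).
Proof.
apply: phi_start => //; rewrite /st_c /st_u /st_b /st_s /=; first by ring.
by field.
Qed.

Let lyapunov_z0 (K : R) : lyapunov kappa K z0 = (K + 4) ^+ 3.
Proof. by rewrite /lyapunov /weight /st_u /st_b /st_s /st_a/=; ring. Qed.

Let mphi : measurable_fun setT (phi kappa n m).
Proof.
(* Any [eps] and horizon would serve here: only the measurability contained in [tame] is
   extracted. *)
have [f1 [G [[]]]] := @ito_phi R kappa k0 k4 1 1 ltr01 (lexx _) n m om kp.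
by [].
Qed.

(** By homogeneity [phi ^+ 6] is at most a constant times [lyapunov ^+ (2 * p)], and at the start
    [lyapunov] equals [(K + 4) ^+ 3], the 4 being [u ^+ 2]. High powers [r] are wanted later to beat
    the growth in [K]. *)
Lemma phi_moment r : exists2 C : R, 0 <= C & forall K : nat, (0 < K)%N -> forall k N : nat,
  mesh N <= eps k ->
  integ P (fun w => phi kappa n m (euler K k N w) ^+ (6 * r)) /\
  \int[P]_w (phi kappa n m (euler K k N w) ^+ (6 * r)) <= C * (K%:R + 4) ^+ (6 * p * r).
Proof.
have [C C0 HC] := homog_phi k0 k4 n om.
have lL := lyap_exp (2 * p * r) (lyap_lyapunov k0 k4).
have [D D0 HD] := expect_lyap g_indep g_moment g_mean lL.
exists (C ^+ r * D); first by rewrite mulr_ge0// exprn_ge0.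
move=> K K0 k N mk; have K1 : 1 <= K%:R :> R by rewrite ler1n.
have [jL EL] := HD K%:R (eps k) (mesh N) z0 N (K * N.+1)%N K1 (eps0 k) (mesh01 N) mk
  (steps_le K N).
have le w : phi kappa n m (euler K k N w) ^+ (6 * r) <=
    C ^+ r * lyapunov kappa K%:R (euler K k N w) ^+ (2 * p * r).
  rewrite exprM (exprM _ (2 * p)) -exprMn lerXn2r ?nnegrE ?exprn_even_ge0//.
    by rewrite mulr_ge0// exprn_ge0// (le_trans ler01)// lyapunov_ge1.
  by have := HC _ _ K1 (euler_time K k N w); rewrite expr0 mulr1.
have jphi : integ P (fun w => phi kappa n m (euler K k N w) ^+ (6 * r)).
  apply: (integ_le _ (integZ (C ^+ r) jL)) => [|w].
    by apply: measurable_funX; exact: measurable_euler.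
  rewrite ger0_norm; last by rewrite exprM exprn_ge0// exprn_even_ge0.
  by rewrite (le_trans (le w))// ler_norm.
split => //; apply: (@le_trans _ _ (\int[P]_w (C ^+ r * lyapunov kappa K%:R (euler K k N w) ^+ (2 * p * r)))).
  by apply: le_Rintegral => //; exact: integZ.
rewrite RintegralZl// -mulrA ler_wpM2l ?exprn_ge0// (le_trans EL)//.
rewrite lyapunov_z0 -exprM (_ : (3 * (2 * p * r) = 6 * p * r)%N)//.
by rewrite !mulnA.
Qed.

Section fixed_horizon.
Variable (K : nat).
Hypothesis K0 : (0 < K)%N.
Let K1 : 1 <= K%:R :> R. Proof. by rewrite ler1n. Qed.
Variable Z : Omega -> state.
Hypothesis eulerZ : {ae P, forall w, forall U, nbhs (Z w) U -> exists k0, forall k, (k0 <= k)%N ->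
  exists n0, forall N, (n0 <= N)%N -> U (euler K k N w)}.

Let euler_cvg (h : state -> R) : continuous h ->
  {ae P, forall w, forall e : R, 0 < e -> exists k0, forall k, (k0 <= k)%N ->
    exists n0, forall N, (n0 <= N)%N -> `|h (euler K k N w) - h (Z w)| <= e}.
Proof.
move=> ch; apply: filterS eulerZ => w H e e0.
have := ch (Z w) => /cvgrPdist_le /(_ _ e0) /H [i Hi]; exists i => k ik.
have [n0 Hn] := Hi k ik; exists n0 => N nN; rewrite distrC; exact: Hn.
Qed.

Lemma phi_limitE : {ae P, forall w, phi_limit K w = phi kappa n m (Z w)}.
Proof.
apply: (double_liminfE (F := fun k N w => phi kappa n m (euler K k N w))
  (Z := fun w => phi kappa n m (Z w))).
apply: euler_cvg; exact: continuous_phi.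
Qed.

Lemma time_limitE : {ae P, forall w, time_limit K w = st_t (Z w)}.
Proof.
apply: (double_liminfE (F := fun k N w => st_t (euler K k N w)) (Z := fun w => st_t (Z w))).
apply: euler_cvg; exact: continuous_st_t.
Qed.

Lemma measurable_time_limit : measurable_fun setT (time_limit K).
Proof. by apply: measurable_double_liminf => k N; apply: measurable_euler; exact: measurable_st_t. Qed.

Lemma expect_phi_limit : integ P (phi_limit K) /\
  \int[P]_w phi_limit K w = 2 ^+ (3 * n + 3 * m) * (kappa / 6) ^+ (m %/ 2)
     * (m`!%:R / ((m %/ 2)`!)%:R)
   / \prod_(1 <= j < (n + (3 * m) %/ 2).+1) (8 - (2 * j + 1)%:R * kappa).
Proof.
rewrite -phi_z0; have [C C0 HC] := phi_moment 1.
apply: (@double_limit_eq _ _ _ P _ _ _ (euler_cvg (@continuous_phi R kappa n m)) (C * (K%:R + 4) ^+ (6 * p * 1))).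
  by move=> k N; exact: measurable_euler.
move=> k e e0.
have [f1 [G If G0]] := @ito_phi R kappa k0 k4 (eps k) K%:R (eps0 k) K1 n m om kp.
have [D D0 HD] := @ito_expect _ _ _ P g M g_indep g_moment g_mean g_variance kappa k0 k4
  (eps k) K%:R z0 (eps0 k) K1 erefl _ _ _ If G0.
have c0 : 0 < e / (D * K%:R + 1) by rewrite divr_gt0// ltr_wpDl// mulr_ge0.
have [n0 Hn] := mesh_eps k; have [n1 Hn1] := mesh_small c0.
exists (maxn n0 n1) => N; rewrite geq_max => /andP[N0 N1].
have [jphi Ephi] := HD (mesh N) N (K * N.+1)%N (mesh01 N) (Hn _ N0)
  (steps_le K N).
have [j6 E6] := HC K K0 k N (Hn _ N0).
split => //; rewrite (le_trans Ephi)// mesh_steps3.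
have := Hn1 _ N1; rewrite ler_pdivlMr ?ltr_wpDl ?mulr_ge0//.
have /andP[d0 _] := mesh01 (R := R) N; move: d0; move: (mesh N) => dl d0.
have : 0 <= K%:R :> R by []. 
move: (K%:R) => x x0; have : 0 <= D * x by rewrite mulr_ge0.
nra.
Qed.

Lemma phi_limit_moment r C : 0 <= C -> (forall k N : nat, mesh N <= eps k ->
    integ P (fun w => phi kappa n m (euler K k N w) ^+ (6 * r)) /\
    \int[P]_w (phi kappa n m (euler K k N w) ^+ (6 * r)) <= C) ->
  (\int[P]_w (phi_limit K w ^+ (6 * r))%:E <= C%:E)%E.
Proof.
move=> C0 H.
apply: (@ge0_le_double_limit _ _ _ P _ _ _ (euler_cvg (@continuous_phi R kappa n m)) (fun x => x ^+ (6 * r))).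
- by move=> k N; exact: measurable_euler.
- by move=> x; exact: exprn_continuous.
- by move=> x; rewrite exprM exprn_ge0// exprn_even_ge0.
move=> k e e0; have [n0 Hn] := mesh_eps k; exists n0 => N nN.
have [jphi Ephi] := H k N (Hn _ nN); split => //.
by rewrite (le_trans Ephi)// lerDl ltW.
Qed.

(** The supermartingale dominates the same expression in [t] alone, since [parabolic >= t]. The
    bound is the initial value of the supermartingale and is therefore uniform in [K]. *)
Lemma time_limit_moment j : (0 < p)%N -> 0 < 8 - (2 * (p%:R + 2 ^- j) + 1) * kappa ->
  (\int[P]_w (Num.max 0 (time_limit K w) ^+ p * iter j Num.sqrt (Num.max 0 (time_limit K w)))%:E
    <= (tail_function kappa p j z0)%:E)%E.
Proof.
move=> p0 kq.
have citer i : continuous (iter i Num.sqrt : R -> R).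
  elim: i => [|i IH] x /=; first exact: cvg_id.
  by apply: (continuous_comp (IH x)); exact: sqrt_continuous.
have iter0 i (x : R) : 0 <= x -> 0 <= iter i Num.sqrt x.
  by move=> x0; case: i => [|i] //=; exact: sqrtr_ge0.
have iter_le i (x y : R) : x <= y -> iter i Num.sqrt x <= iter i Num.sqrt y.
  by move=> xy; elim: i => //= i IH; exact: ler_wsqrtr.
pose h (x : R) := Num.max 0 x ^+ p * iter j Num.sqrt (Num.max 0 x).
have cmax : continuous (fun x : R => Num.max 0 x).
  by move=> x; apply: (@continuous_max _ _ (fun=> 0) (fun x => x)); [exact: cvg_cst|exact: cvg_id].
have c1 : continuous (fun x : R => Num.max 0 x ^+ p).
  by move=> x; exact: (continuous_comp (cmax x) (@exprn_continuous R p _)).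
have c2 : continuous (fun x : R => iter j Num.sqrt (Num.max 0 x)).
  by move=> x; exact: (continuous_comp (cmax x) (citer j _)).
have ch : continuous h by move=> x; exact: (cvgM (c1 x) (c2 x)).
apply: (@ge0_le_double_limit _ _ _ P _ _ _ (euler_cvg (@continuous_st_t R)) h).
- by move=> k N; apply: measurable_euler; exact: measurable_st_t.
- exact: ch.
- by move=> x; rewrite mulr_ge0 ?exprn_ge0 ?iter0// le_max lexx.
move=> k e e0.
have [f1 [G If G0]] := @ito_le_tail R kappa (eps k) K%:R k0 (eps0 k) K1 p j p0 kq.
have tail0 z : 0 <= tail_function kappa p j z.
  by rewrite mulr_ge0 ?exprn_ge0 ?iter0 ?parabolic_ge0.
have bs := bounded_ito_le_step K1 tail0 If.
have [[mt bt] _ _ _] := If.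
have [D D0 HD] := @ito_le_expect _ _ _ P g M g_indep g_moment g_mean g_variance kappa k0 k4
  (eps k) K%:R z0 (eps0 k) K1 erefl _ _ _ If bs G0.
have c0 : 0 < e / (D * K%:R + 1) by rewrite divr_gt0// ltr_wpDl// mulr_ge0.
have [n0 Hn] := mesh_eps k; have [n1 Hn1] := mesh_small c0.
exists (maxn n0 n1) => N; rewrite geq_max => /andP[N0 N1].
have iK := steps_le K N.
have Et := HD (mesh N) N (K * N.+1)%N (mesh01 N) (Hn _ N0) iK.
have jt := @proc_integrable _ _ _ P g M g_indep g_moment g_mean kappa k0 k4
  (eps k) K%:R z0 (eps0 k) K1 erefl _ mt bs (mesh N) N (K * N.+1)%N (mesh01 N) (Hn _ N0) iK.
have hle z : 0 <= st_t z -> h (st_t z) <= tail_function kappa p j z.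
  move=> t0; have le : Num.max 0 (st_t z) <= parabolic kappa p j z.
    by rewrite /parabolic lerDl mulr_ge0 ?sqr_ge0// invr_ge0 ltW.
  apply: ler_pM; rewrite ?exprn_ge0 ?iter0 ?le_max ?lexx//; last exact: iter_le.
  by rewrite lerXn2r ?nnegrE ?parabolic_ge0 ?le_max ?lexx.
have h0 x : 0 <= h x by rewrite mulr_ge0 ?exprn_ge0 ?iter0// le_max lexx.
have jh : integ P (fun w => h (st_t (euler K k N w))).
  apply: (integ_le _ jt) => [|w].
    apply: (@measurable_euler K k N (fun z => h (st_t z))).
    apply: (measurableT_comp (continuous_measurable_fun ch)); exact: measurable_st_t.
  rewrite !ger0_norm//; apply: hle.
  by have /andP[] := euler_time K k N w.
split => //; apply: (@le_trans _ _ (\int[P]_w tail_function kappa p j (euler K k N w))).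
  apply: le_Rintegral => // w _; apply: hle.
  by have /andP[] := euler_time K k N w.
rewrite (le_trans Et)// lerD2l mesh_steps3.
have := Hn1 _ N1; rewrite ler_pdivlMr ?ltr_wpDl ?mulr_ge0//.
have /andP[d0 _] := mesh01 (R := R) N; move: d0; move: (mesh N) => dl d0.
have : 0 <= K%:R :> R by []. 
move: (K%:R) => x x0; have : 0 <= D * x by rewrite mulr_ge0.
nra.
Qed.

End fixed_horizon.
End horizon.

(** * Pathwise convergence of the Euler scheme *)

Section uniform_continuity.
Context {R : realType}.

Lemma within_itvP (f : R -> R) (a b : R) : {within `[a, b], continuous f} <->
  forall x, a <= x <= b -> forall e : R, 0 < e -> exists2 r : R, 0 < r &
    forall y, a <= y <= b -> `|y - x| < r -> `|f y - f x| <= e.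
Proof.
rewrite subspace_continuousP; split => [H x xab e e0|H x /=].
  have := H x; rewrite /= in_itv/= => /(_ xab) /cvgrPdist_le /(_ e e0) /nbhs_ballP[r /= r0 Hr].
  exists r => // y yab yx.
  by rewrite distrC; apply: Hr; [rewrite /ball/= distrC|rewrite /= in_itv].
rewrite in_itv/= => xab; apply/cvgrPdist_le => e e0.
have [r r0 Hr] := H x xab e e0.
apply/nbhs_ballP; exists r => //= y; rewrite /ball/= distrC => yx; rewrite /= in_itv/= => yab.
by rewrite distrC; apply: Hr.
Qed.

Lemma uniformly_continuous_itv (f : R -> R) (a b : R) : {within `[a, b], continuous f} ->
  forall e : R, 0 < e -> exists2 r : R, 0 < r & forall x y, a <= x <= b -> a <= y <= b ->
    `|y - x| <= r -> `|f y - f x| <= e.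
Proof.
move=> cf e e0.
have /compact_near_coveringP/near_covering_withinP cpt := @segment_compact R a b.
pose Q (r x : R) := forall y, a <= y <= b -> `|y - x| <= r -> `|f y - f x| <= e.
have H : forall x, `[a, b]%classic x -> \forall x' \near x & r \near (0:R)^'+, `[a, b]%classic x' -> Q r x'.
  move=> x; rewrite /= in_itv/= => xab.
  have e20 : 0 < e / 2 by rewrite divr_gt0.
  have [r r0 Hr] := (iffLR (within_itvP f a b) cf) x xab _ e20.
  have r20 : 0 < r / 2 by rewrite divr_gt0.
  exists (ball x (r / 2), [set t | t < r / 2]) => /=.
    split; first exact: nbhsx_ballx.
    exact: nbhs_right_lt.
  move=> [x' t] /= [xx' tr]; rewrite in_itv/= => x'ab y yab yx'.
  have A : `|f y - f x| <= e / 2.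
    apply: Hr => //; rewrite -(subrK x' y) -addrA (le_lt_trans (ler_normD _ _))//.
    move: xx'; rewrite /ball/= distrC => xx'.
    by rewrite (splitr r) ltrD// (le_lt_trans yx').
  have B : `|f x' - f x| <= e / 2.
    apply: Hr => //; move: xx'; rewrite /ball/= distrC => /lt_trans; apply.
    by rewrite ltr_pdivrMr// ltr_pMr// ltr1n.
  rewrite -(subrK (f x) (f y)) -addrA (le_trans (ler_normD _ _))// (splitr e) lerD//.
  by rewrite distrC.
have FF := cpt R (0:R)^'+ Q _ H.
have GG : \forall r \near (0:R)^'+, (`[a, b]%classic `<=` Q r) /\ 0 < r.
  by apply: filterI; [exact: FF|exact: nbhs_right_gt].
have [r [Hr r0]] := filter_ex (FF := at_right_proper_filter 0) GG.
by exists r => // x y xab yab; apply: Hr => //=; rewrite in_itv.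
Qed.

End uniform_continuity.

Section euler_path.
Context {R : realType} (kappa T : R) (beta s a : R -> R).
Local Notation state := (R * R * R * R)%type.

Definition path_state (t : R) : state := (t, beta t, s t, a t).
Let u t := st_u kappa (path_state t).
Let x t := st_x kappa (path_state t).

Definition grid (N i : nat) : R := i%:R / N.+1%:R.

Definition euler_chain (eps : R) (N : nat) (z : nat -> state) :=
  z 0%N = (0, 0, 0, 0) /\ exists g : nat -> R, forall i,
    z i.+1 = next kappa eps (mesh N) (g i) (z i) /\
    mesh N * g i = beta (grid N i.+1) - beta (grid N i).

Lemma grid0 N : grid N 0 = 0. Proof. by rewrite /grid mul0r. Qed.
Lemma gridS N i : grid N i.+1 = grid N i + N.+1%:R^-1.
Proof. by rewrite /grid -natr1 mulrDl mul1r. Qed.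
Lemma grid_ge0 N i : 0 <= grid N i. Proof. by rewrite divr_ge0. Qed.
Lemma grid_le N i j : (i <= j)%N -> grid N i <= grid N j.
Proof. by move=> ij; rewrite ler_wpM2r ?invr_ge0// ler_nat. Qed.

Hypotheses (k0 : 0 < kappa) (k4 : kappa < 4) (T0 : 0 <= T).
Hypotheses (beta0 : beta 0 = 0) (s0 : s 0 = 0) (a0 : a 0 = 0).
Hypotheses (cbeta : {within `[0, T], continuous beta}) (cs : {within `[0, T], continuous s})
  (ca : {within `[0, T], continuous a}).
Hypothesis ds : forall t, 0 < t < T -> is_derive t 1 s (u t)^-1.
Hypothesis da : forall t, 0 < t < T -> is_derive t 1 a (2 * x t).

Lemma chain_frozen eps N z i j : euler_chain eps N z -> (i <= j)%N ->
  st_u kappa (z i) <= eps -> z j = z i.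
Proof.
move=> [_ [g Hg]] /subnK <- ui; elim: (j - i)%N => // l IH.
by rewrite addSn; have [-> _] := Hg (l + i)%N; rewrite /next IH ui.
Qed.

Let cu : {within `[0, T], continuous u}.
Proof.
move=> t; rewrite /u /st_u /path_state /st_b /st_s /=; apply: cvgB.
  apply: cvgD; first exact: cvg_cst.
  by apply: cvgM; [exact: cvg_cst|exact: cbeta].
by apply: cvgM; [exact: cvg_cst|exact: cs].
Qed.

Let cx : {within `[0, T], continuous x}.
Proof.
move=> t; rewrite /x /st_x; apply: cvgB; last first.
  by apply: cvgM; [exact: cvg_cst|exact: cs].
by apply: cvgB; [exact: cu|exact: cvg_cst].
Qed.

Let mean_value (f df : R -> R) (t t' : R) : 0 <= t -> t < t' -> t' <= T ->
  {within `[0, T], continuous f} -> (forall r, 0 < r < T -> is_derive r 1 f (df r)) ->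
  exists2 c, t < c < t' & f t' = f t + df c * (t' - t).
Proof.
move=> t0 tt' t'T cf dff.
have [c ctt' E] : exists2 c, c \in `]t, t'[%R & f t' - f t = df c * (t' - t).
  apply: (@MVT R f df t t') => //.
    move=> r; rewrite in_itv/= => /andP[tr rt']; apply: dff.
    by rewrite (le_lt_trans t0 tr) (lt_le_trans rt' t'T).
  apply: continuous_subspaceW cf => r /=; rewrite !in_itv/= => /andP[tr rt'].
  by rewrite (le_trans t0 tr) (le_trans rt' t'T).
by exists c; [rewrite in_itv/= in ctt'|rewrite -E addrC subrK].
Qed.

(** The noise coordinate is exact at the grid points, so the error of [u] is proportional to that of
    [s], and the latter obeys a discrete Gronwall inequality; the error of [a] follows by summation.
    Up to [T'] the path keeps a positive distance from the collision. *)
Lemma euler_converges (T' eps eta : R) : 0 <= T' <= T -> (forall t, 0 <= t <= T' -> 0 < u t) ->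
  0 < eps -> 0 < eta -> exists n0, forall N, (n0 <= N)%N -> forall z, euler_chain eps N z ->
  forall i, grid N i <= T' -> (forall j, (j < i)%N -> eps < st_u kappa (z j)) ->
  [/\ st_t (z i) = grid N i, st_b (z i) = beta (grid N i),
      `|st_s (z i) - s (grid N i)| <= eta & `|st_a (z i) - a (grid N i)| <= eta].
Proof.
move=> /andP[T'0 T'T] upos eps0 eta0.
have subT : `[0, T'] `<=` `[0, T].
  by move=> r /=; rewrite !in_itv/= => /andP[-> rT]; exact: le_trans rT T'T.
have [c0 c0T Hc0] := EVT_min T'0 (continuous_subspaceW subT cu).
pose mu := u c0.
have mu0 : 0 < mu by apply: upos; rewrite in_itv/= in c0T.
have umu t : 0 <= t <= T' -> mu <= u t by move=> tT; apply: Hc0; rewrite in_itv.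
have k40 : 0 < 4 - kappa by rewrite subr_gt0.
(* The chain is above [eps] and the path above [mu], so the two values of [1 / u] differ by at most
   [L'] times the difference of the values of [u], which is [4 - kappa] times the error of [s], up
   to the modulus of continuity [om]. *)
pose L' := (eps * mu)^-1; pose L := (4 - kappa) * L'.
have L'0 : 0 < L' by rewrite invr_gt0 mulr_gt0.
have L0 : 0 < L by rewrite mulr_gt0.
pose C := expR (L * T') * (T' * L').
have C0 : 0 <= C by rewrite mulr_ge0 ?expR_ge0// mulr_ge0// ltW.
(* With [om = eta / C'] both the error [C * om] of [s] and the accumulated error of [a] are at most
   [eta]; the 1 makes [C'] positive. *)
pose C' := 2 * T' * ((6 - kappa) * C + 1) + C + 1.
have C'0 : 0 < C'.
  by rewrite ltr_wpDl// addr_ge0// mulr_ge0 ?mulr_ge0// addr_ge0// mulr_ge0//; move: k4; lra.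
pose om := eta / C'.
have om0 : 0 < om by rewrite divr_gt0.
have [r1 r10 Hr1] := uniformly_continuous_itv cu om0.
have [r2 r20 Hr2] := uniformly_continuous_itv cx om0.
exists (Num.truncn (Num.min r1 r2)^-1) => N nN z [z0 [g Hg]].
have r0 : 0 < Num.min r1 r2 by rewrite lt_min r10 r20.
pose h : R := N.+1%:R^-1.
have h0 : 0 < h by rewrite invr_gt0 ltr0n.
have hr : h <= Num.min r1 r2.
  rewrite invf_ple ?posrE ?ltr0n// (le_trans (ltW (truncnS_gt _)))// ler_nat//.
have hm : mesh N ^+ 2 = h by rewrite mesh_sqr.
pose e i := st_s (z i) - s (grid N i).
have eC i : grid N i <= T' -> `|e i| <= (1 + L * h) ^+ i * (grid N i * L' * om) -> `|e i| <= C * om.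
  move=> iT eE; rewrite (le_trans eE)// /C -[leRHS]mulrA; apply: ler_pM.
  - by rewrite exprn_ge0// addr_ge0// mulr_ge0// ltW.
  - by apply: mulr_ge0; [apply: mulr_ge0; [exact: grid_ge0|exact: ltW]|exact: ltW].
  - apply: (@le_trans _ _ (expR (L * h) ^+ i)).
      rewrite lerXn2r ?nnegrE ?expR_ge0 ?expR_ge1Dx//.
      by rewrite addr_ge0// mulr_ge0// ltW.
    rewrite -expRM_natl ler_expR [leLHS](_ : _ = L * grid N i); last by rewrite /grid /h; ring.
    by rewrite ler_wpM2l// ltW.
  - by rewrite ler_wpM2r ?(ltW om0)// ler_wpM2r// ltW.
have main i : grid N i <= T' -> (forall j, (j < i)%N -> eps < st_u kappa (z j)) ->
  [/\ st_t (z i) = grid N i, st_b (z i) = beta (grid N i),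
      `|e i| <= (1 + L * h) ^+ i * (grid N i * L' * om) &
      `|st_a (z i) - a (grid N i)| <= grid N i * (2 * ((6 - kappa) * (C * om) + om))].
  elim: i => [|i IH] iT run.
    rewrite /e z0 grid0 beta0 s0 a0 /st_t /st_b /st_s /st_a/= subrr normr0 !mul0r mulr0.
    by split.
  have iT' : grid N i <= T' by rewrite (le_trans _ iT)// grid_le.
  have [tE bE eE aE] := IH iT' (fun j ji => run j (ltnW ji)).
  have ui : eps < st_u kappa (z i) by exact: run.
  have ui0 : 0 < st_u kappa (z i) by exact: lt_trans ui.
  have [zE gE] := Hg i.
  have {}zE : z i.+1 = step kappa (mesh N) (g i) (z i) by rewrite zE /next leNgt ui.
  have gi0 := grid_ge0 N i.
  have lti : grid N i < grid N i.+1 by rewrite gridS ltrDl.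
  have dif : grid N i.+1 - grid N i = h by rewrite gridS addrC addKr.
  have near c : grid N i < c < grid N i.+1 -> [/\ 0 <= c <= T', 0 <= c <= T &  `|c - grid N i| <= h].
    move=> /andP[c1 c2]; have cT' : c <= T' by rewrite (le_trans (ltW c2)).
    have c00 : 0 <= c by rewrite (le_trans gi0)// ltW.
    split; [by rewrite c00|by rewrite c00 (le_trans cT')|].
    by rewrite gtr0_norm ?subr_gt0// -dif lerD2r ltW.
  have giT : 0 <= grid N i <= T by rewrite gi0 (le_trans iT').
  have uE : st_u kappa (z i) - u (grid N i) = - (4 - kappa) * e i.
    by rewrite /u /st_u bE /e /path_state /st_b /st_s/=; ring.
  have xE : st_x kappa (z i) - x (grid N i) = - (6 - kappa) * e i.
    by rewrite /x /st_x /u /st_u bE /e /path_state /st_b /st_s/=; ring.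
  have [c cI sE] := mean_value gi0 lti (le_trans iT T'T) cs ds.
  have [c' c'I aE'] := mean_value gi0 lti (le_trans iT T'T) ca da.
  have [cT' cT ch] := near c cI; have [c'T' c'T c'h] := near c' c'I.
  have ucmu := umu c cT'; have uc0 : 0 < u c by rewrite (lt_le_trans mu0).
  have du : `|u c - u (grid N i)| <= om.
    by apply: Hr1 => //; rewrite (le_trans ch)// (le_trans hr)// ge_min lexx.
  have dx : `|x c' - x (grid N i)| <= om.
    by apply: Hr2 => //; rewrite (le_trans c'h)// (le_trans hr)// ge_min lexx orbT.
  have ei_le : `|e i| <= C * om.
    exact: eC.
  split.
  - by rewrite zE gridS -tE -/h -hm.
  - by rewrite zE {1}/st_b/= gE bE addrC subrK.
  - have -> : e i.+1 = e i + h * ((u c - st_u kappa (z i)) / (st_u kappa (z i) * u c)).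
      rewrite /e sE zE dif {1}/st_s/= hm.
      by field; rewrite !gt_eqF.
    have E1 : `|(u c - st_u kappa (z i)) / (st_u kappa (z i) * u c)| <= L * `|e i| + L' * om.
      rewrite normrM normfV (gtr0_norm (mulr_gt0 ui0 uc0)).
      have -> : L * `|e i| + L' * om = ((4 - kappa) * `|e i| + om) * L' by rewrite /L; ring.
      apply: ler_pM; [exact: normr_ge0|by rewrite invr_ge0 mulr_ge0// ltW| |]; last first.
        rewrite lef_pV2 ?posrE ?mulr_gt0//; apply: ler_pM; rewrite ?(ltW eps0) ?(ltW mu0)//.
        exact: ltW.
      have -> : u c - st_u kappa (z i) = (u c - u (grid N i)) + (4 - kappa) * e i.
        have -> : (4 - kappa) * e i = - (st_u kappa (z i) - u (grid N i)) by rewrite uE; ring.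
        by ring.
      by rewrite (le_trans (ler_normD _ _))// addrC lerD// normrM gtr0_norm.
    rewrite (le_trans (ler_normD _ _))// normrM (gtr0_norm h0).
    rewrite (le_trans (lerD (lexx _) (ler_wpM2l (ltW h0) E1)))//.
    rewrite gridS -/h exprS.
    have P1 : 1 <= (1 + L * h) ^+ i by rewrite exprn_ege1// lerDl mulr_ge0// ltW.
    have Lh : 0 <= L * h by rewrite mulr_ge0// ltW.
    have Lo : 0 <= h * L' * om by apply: mulr_ge0; [apply: mulr_ge0|]; exact: ltW.
    have -> : `|e i| + h * (L * `|e i| + L' * om) = (1 + L * h) * `|e i| + h * L' * om by ring.
    have -> : (1 + L * h) * (1 + L * h) ^+ i * ((grid N i + h) * L' * om) =
      (1 + L * h) * ((1 + L * h) ^+ i * (grid N i * L' * om)) + (1 + L * h) * (1 + L * h) ^+ i * (h * L' * om) by ring.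
    apply: lerD; first by rewrite ler_wpM2l// addr_ge0.
    rewrite ler_peMl// (le_trans P1)// ler_peMl// ?lerDl//.
    by rewrite (le_trans ler01).
  - have -> : st_a (z i.+1) - a (grid N i.+1) = st_a (z i) - a (grid N i)
       + 2 * h * (- (6 - kappa) * e i - (x c' - x (grid N i))).
      have -> : - (6 - kappa) * e i = st_x kappa (z i) - x (grid N i) by rewrite xE.
      by rewrite aE' zE dif {1}/st_a/= hm; ring.
    rewrite (le_trans (ler_normD _ _))// gridS -/h [leRHS]mulrDl lerD//.
    rewrite normrM (gtr0_norm (_ : 0 < 2 * h)) ?mulr_gt0//.
    rewrite [leRHS](_ : _ = 2 * h * ((6 - kappa) * (C * om) + om)); last by ring.
    rewrite ler_wpM2l ?mulr_ge0 ?(ltW h0)//.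
    have k60 : 0 <= 6 - kappa by move: k4; lra.
    rewrite (le_trans (ler_normB _ _))// lerD//.
    by rewrite normrM normrN (ger0_norm k60) ler_wpM2l.
move=> i iT run; have [tE bE eE aE] := main i iT run; split => //.
  apply: (@le_trans _ _ (C * om)); first exact: eC.
  rewrite /om mulrCA ler_piMr ?(ltW eta0)// ler_pdivrMr// mul1r /C' -addrA [leRHS]addrC -addrA lerDl.
  by rewrite addr_ge0// mulr_ge0 ?mulr_ge0// addr_ge0// mulr_ge0//; move: k4; lra.
have k60 : 0 <= 6 - kappa by move: k4; lra.
have Co : 0 <= C * om by rewrite mulr_ge0// ltW.
have q0 : 0 <= 2 * ((6 - kappa) * (C * om) + om).
  by apply: mulr_ge0 => //; apply: addr_ge0; [exact: mulr_ge0|exact: ltW].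
rewrite (le_trans aE)// (le_trans (ler_wpM2r q0 iT))//.
rewrite [leLHS](_ : _ = (2 * T' * ((6 - kappa) * C + 1)) * om); last by ring.
rewrite /om mulrCA ler_piMr ?(ltW eta0)// ler_pdivrMr// mul1r /C'.
by move: (2 * T' * _) => X; move: C0; lra.
Qed.

Definition close (eta : R) (z z' : state) :=
  [/\ `|st_t z - st_t z'| <= eta, `|st_b z - st_b z'| <= eta,
      `|st_s z - st_s z'| <= eta & `|st_a z - st_a z'| <= eta].

Let u_err (z : state) (t : R) : st_b z = beta t ->
  `|st_u kappa z - u t| <= 4 * `|st_s z - s t|.
Proof.
move=> bE; have -> : st_u kappa z - u t = - (4 - kappa) * (st_s z - s t).
  by rewrite /u /st_u bE /path_state /st_b /st_s/=; ring.
have k40 : 0 < 4 - kappa by rewrite subr_gt0.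
by rewrite normrM normrN (gtr0_norm k40) ler_wpM2r// gerBl ltW.
Qed.

(** Bootstrap on the index: as long as the chain is not stopped, its [u] errs by at most
    [4 * (mu / 16)], so it stays at or above [3 / 4 * mu], beyond the threshold [eps <= mu / 4]. *)
Lemma euler_survives (K : nat) (eta : R) : T = K%:R -> (forall t, 0 <= t <= T -> 0 < u t) ->
  0 < eta -> exists2 e0 : R, 0 < e0 & forall eps, 0 < eps -> eps <= e0 ->
    exists n0, forall N, (n0 <= N)%N -> forall z, euler_chain eps N z ->
      close eta (z (K * N.+1)%N) (path_state T).
Proof.
move=> TK upos eta0.
have [c0 c0T Hc0] := EVT_min T0 cu.
pose mu := u c0.
have mu0 : 0 < mu by apply: upos; rewrite in_itv/= in c0T.
have umu t : 0 <= t <= T -> mu <= u t by move=> tT; apply: Hc0; rewrite in_itv.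
exists (mu / 4) => [|eps eps0 epsmu]; first by rewrite divr_gt0.
have eta'0 : 0 < Num.min eta (mu / 16) by rewrite lt_min eta0 divr_gt0.
have TT : 0 <= T <= T by rewrite T0 lexx.
have [n0 Hn] := euler_converges TT upos eps0 eta'0.
exists n0 => N nN z cz; have {}Hn := Hn N nN z cz.
have gT i : (i <= K * N.+1)%N -> grid N i <= T.
  move=> iK; rewrite TK ler_pdivrMr ?ltr0n// -natrM ler_nat//.
have run i : (i <= K * N.+1)%N -> forall j, (j < i)%N -> eps < st_u kappa (z j).
  elim: i => // i IH iK j; rewrite ltnS leq_eqVlt => /predU1P[->|ji]; last first.
    by apply: IH => //; exact: ltnW.
  have [tE bE sE _] := Hn i (gT i (ltnW iK)) (IH (ltnW iK)).
  have := u_err bE; rewrite ler_norml => /andP[A _].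
  have gi : 0 <= grid N i <= T by rewrite grid_ge0 gT// ltnW.
  have := umu _ gi; move: sE; rewrite le_min => /andP[_ B].
  move: A B mu0 epsmu; move: (`|_ - _|) (st_u _ _) (u _) => ? ? ?; lra.
have [tE bE sE aE] := Hn (K * N.+1)%N (gT _ (leqnn _)) (run _ (leqnn _)).
have gE : grid N (K * N.+1) = T by rewrite /grid natrM mulfK// pnatr_eq0.
have le : Num.min eta (mu / 16) <= eta by rewrite ge_min lexx.
split; rewrite /path_state /st_t /st_b /st_s /st_a/= -?gE.
- by rewrite -/(st_t _) tE subrr normr0 ltW.
- by rewrite -/(st_b _) bE subrr normr0 ltW.
- exact: le_trans sE le.
- exact: le_trans aE le.
Qed.

(** The chain is frozen at a time close to [T]. When it stops, the path has [u <= 5 / 4 * eps],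
    which excludes times up to [T'], where [u >= mu >= 2 * eps]; and it must stop by time [T2 < T],
    at which the path is already below [eps / 4]. Between [T'] and [T] all coordinates are close to
    their final values. *)
Lemma euler_hits (K : nat) (eta : R) : 0 < T -> T <= K%:R -> (forall t, 0 <= t < T -> 0 < u t) ->
  u T = 0 ->
  0 < eta -> exists2 e0 : R, 0 < e0 & forall eps, 0 < eps -> eps <= e0 ->
    exists n0, forall N, (n0 <= N)%N -> forall z, euler_chain eps N z ->
      close eta (z (K * N.+1)%N) (path_state T).
Proof.
move=> T1 TK upos uT eta0.
have TT : 0 <= T <= T by rewrite T0 lexx.
have e20 : 0 < eta / 2 by rewrite divr_gt0.
have [rb rb0 Hb] := (iffLR (within_itvP _ _ _) cbeta) T TT _ e20.
have [rs rs0 Hs] := (iffLR (within_itvP _ _ _) cs) T TT _ e20.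
have [ra ra0 Ha] := (iffLR (within_itvP _ _ _) ca) T TT _ e20.
pose r := Num.min (eta / 2) (Num.min rb (Num.min rs ra)).
have r0 : 0 < r by rewrite !lt_min e20 rb0 rs0 ra0.
(* [r] is a common radius of continuity at [T] for [beta], [s], [a] and the time itself; the maximum
   with 0 covers [T < r / 2]. *)
pose T' := Num.max 0 (T - r / 2).
have T'0 : 0 <= T' by rewrite le_max lexx.
have T'T : T' < T by rewrite gt_max T1 ltrBlDr ltrDl divr_gt0.
have subT : `[0, T'] `<=` `[0, T].
  by move=> y /=; rewrite !in_itv/= => /andP[-> yT]; rewrite (le_trans yT)// ltW.
have [c0 c0T Hc0] := EVT_min T'0 (continuous_subspaceW subT cu).
pose mu := u c0.
have mu0 : 0 < mu.
  by apply: upos; move: c0T; rewrite in_itv/= => /andP[-> c0T]; rewrite (le_lt_trans c0T).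
have umu t : 0 <= t <= T' -> mu <= u t by move=> tT; apply: Hc0; rewrite in_itv.
exists (mu / 2) => [|eps eps0 epsmu]; first by rewrite divr_gt0.
have e40 : 0 < eps / 4 by rewrite divr_gt0.
have [ru ru0 Hu] := uniformly_continuous_itv cu e40.
pose T2 := Num.max T' (T - ru / 2).
have T20 : 0 <= T2 by rewrite le_max T'0.
have T2T : T2 < T by rewrite gt_max T'T ltrBlDr ltrDl divr_gt0.
have T2T' : 0 <= T2 <= T by rewrite T20 ltW.
have uT2 : u T2 <= eps / 4.
  have : `|u T2 - u T| <= eps / 4.
    apply: Hu => //; rewrite ltr0_norm ?subr_lt0// opprB lerBlDr -lerBlDl le_max.
    by apply/orP; right; lra.
  by rewrite uT subr0 => /(le_trans (ler_norm _)).
have upos2 t : 0 <= t <= T2 -> 0 < u t.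
  by move=> /andP[t0 tT]; apply: upos; rewrite t0 (le_lt_trans tT).
have eta'0 : 0 < Num.min (eta / 2) (eps / 16) by rewrite lt_min e20 divr_gt0.
have [n0 Hn] := euler_converges T2T' upos2 eps0 eta'0.
exists (maxn n0 (Num.truncn ru^-1)) => N; rewrite geq_max => /andP[nN nN'] z cz.
have {}Hn := Hn N nN z cz.
have N0 : 0 < N.+1%:R :> R by rewrite ltr0n.
have hr : N.+1%:R^-1 <= ru.
  by rewrite invf_ple ?posrE// (le_trans (ltW (truncnS_gt _)))// ler_nat.
(* The last grid point up to [T2]. The path there has [u <= eps / 2], so an unstopped chain would
   have [u <= 3 / 4 * eps], a contradiction. *)
pose i := Num.truncn (T2 * N.+1%:R).
have i1 : grid N i <= T2.
  by rewrite /grid ler_pdivrMr// truncn_le// mulr_ge0.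
have i2 : T2 - grid N i <= N.+1%:R^-1.
  by rewrite lerBlDl -gridS ler_pdivlMr// ltW// truncnS_gt.
have gi : 0 <= grid N i <= T by rewrite grid_ge0 (le_trans i1)// ltW.
have ui : u (grid N i) <= eps / 2.
  have : `|u (grid N i) - u T2| <= eps / 4.
    by apply: Hu => //; rewrite distrC ger0_norm ?subr_ge0// (le_trans i2).
  by rewrite ler_norml => /andP[_ A]; move: uT2 A; move: (u T2) (u (grid N i)) => ? ?; lra.
have err l : grid N l <= T2 -> (forall j, (j < l)%N -> eps < st_u kappa (z j)) ->
    `|st_u kappa (z l) - u (grid N l)| <= eps / 4.
  move=> lT run; have [tE bE sE _] := Hn l lT run.
  rewrite (le_trans (u_err bE))//; move: sE; rewrite le_min => /andP[_ B].
  by move: B; move: (`|_ - _|) => ?; lra.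
have ex : exists l, st_u kappa (z l) <= eps.
  apply: contrapT => nex; have run j : eps < st_u kappa (z j).
    by rewrite ltNge; apply/negP => h; apply: nex; exists j.
  have := err i i1 (fun j _ => run j); rewrite ler_norml => /andP[_ A].
  by move: A ui (run i); move: (u _) (st_u _ _) => ? ?; move: eps0; lra.
case: (ex_minnP ex) => l ul lmin.
have run j : (j < l)%N -> eps < st_u kappa (z j).
  by move=> jl; rewrite ltNge; apply/negP => /lmin; rewrite leqNgt jl.
have li : (l <= i)%N.
  rewrite leqNgt; apply/negP => il.
  have runi j : (j < i)%N -> eps < st_u kappa (z j) by move=> ji; apply: run; exact: ltn_trans il.
  have := err i i1 runi; rewrite ler_norml => /andP[_ A].
  by move: A ui (run i il); move: (u _) (st_u _ _) => ? ?; move: eps0; lra.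
have lT : grid N l <= T2 by rewrite (le_trans (grid_le _ li)).
have ult : u (grid N l) <= 5 / 4 * eps.
  have := err l lT run; rewrite ler_norml => /andP[A _].
  by move: A ul; move: (u _) (st_u _ _) => ? ?; lra.
have lT' : T' < grid N l.
  rewrite ltNge; apply/negP => h.
  have /umu : 0 <= grid N l <= T' by rewrite grid_ge0.
  by move: ult epsmu eps0; move: (u _) => ?; lra.
have gl : 0 <= grid N l <= T by rewrite grid_ge0 (le_trans lT)// ltW.
have lr : `|grid N l - T| < r.
  rewrite ler0_norm ?subr_le0; last by case/andP: gl.
  rewrite opprB; have : T - r / 2 <= T' by rewrite le_max lexx orbT.
  by move: lT' r0; lra.
have lK : (l <= K * N.+1)%N.
  rewrite -(ler_nat R) natrM -ler_pdivrMr//; apply: le_trans TK.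
  by case/andP: gl.
rewrite (chain_frozen cz lK ul).
have [tE bE sE aE] := Hn l lT run.
have le : Num.min (eta / 2) (eps / 16) <= eta / 2 by rewrite ge_min lexx.
have close2 (p q v : R) : `|p - q| <= eta / 2 -> `|q - v| <= eta / 2 -> `|p - v| <= eta.
  by move=> A B; rewrite -(subrKA q p) (le_trans (ler_normD _ _))// (splitr eta) lerD.
move: lr; rewrite !lt_min => /and4P[lre lrb lrs lra].
split.
- by rewrite tE /st_t/= (le_trans (ltW lre))// ler_pdivrMr// ler_peMr ?(ltW eta0)// ler1n.
- by rewrite bE /st_b/= (le_trans (Hb _ gl lrb))// ler_pdivrMr// ler_peMr ?(ltW eta0)// ler1n.
- by apply: (close2 _ (s (grid N l))); [exact: le_trans sE le|exact: Hs].
- by apply: (close2 _ (a (grid N l))); [exact: le_trans aE le|exact: Ha].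
Qed.

End euler_path.

(** * The SLE path in state coordinates *)

Section integral_function.
Context {R : realType}.

Lemma within_itv_sub (f : R -> R) (a b a' b' : R) : a <= a' -> b' <= b ->
  {within `[a, b], continuous f} -> {within `[a', b'], continuous f}.
Proof.
move=> aa bb; apply: continuous_subspaceW => t /=; rewrite !in_itv/= => /andP[at' tb].
by rewrite (le_trans aa at') (le_trans tb bb).
Qed.

Lemma continuous_integral (f : R -> R) (T : R) : 0 <= T -> {within `[0, T], continuous f} ->
  {within `[0, T], continuous (fun t => \int[lebesgue_measure]_(r in `[0, t]) f r)}.
Proof.
move=> T0 cf; apply: parameterized_integral_continuous => //.
by apply: continuous_compact_integrable => //; exact: segment_compact.
Qed.

Lemma is_derive_integral (f : R -> R) (T t : R) : {within `[0, T], continuous f} -> 0 < t < T ->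
  is_derive t 1 (fun t => \int[lebesgue_measure]_(r in `[0, t]) f r) (f t).
Proof.
move=> cf /andP[t0 tT].
have jf : lebesgue_measure.-integrable `[0, T] (EFin \o f).
  by apply: continuous_compact_integrable => //; exact: segment_compact.
have cft : {for t, continuous f}.
  apply: (within_continuous_continuous _ cf); first exact: lt_trans tT.
  by rewrite in_itv/= t0.
have [df dfE] := continuous_FTC1_closed tT jf t0 cft.
by apply: DeriveDef; [exact: df|rewrite -derive1E; exact: dfE].
Qed.

End integral_function.

Section sle_path.
Context {R : realType} (kappa sigma : R) (b X Y : R -> R).
Hypotheses (k0 : 0 < kappa) (k4 : kappa < 4) (sigma1 : sigma ^+ 2 = 1).
Hypotheses (b0 : b 0 = 0) (cb : {within `[0, +oo[, continuous b}).
Hypothesis sle : sle_kappa_rho kappa (kappa - 6) sigma (- sigma) b X Y.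
Let tau := collision_time X Y.

(** Collision times are positive, yet their infimum could be 0 were it not attained when finite. *)
Lemma collision_time_gt0 : (0 < tau)%E.
Proof.
have tau0 : (0 <= tau)%E.
  by apply: le_ereal_inf_tmp => _ [t [t0 _] <-]; rewrite lee_fin ltW.
have [_ _ _ _ att] := sle; have : (tau < +oo)%E \/ tau = +oo%E.
  by case: tau => [r||]; [left; rewrite ltry|right|left].
move=> [toy|-> //]; have [tt _] := att toy.
have tf : tau \is a fin_num by rewrite ge0_fin_numE.
by rewrite -(fineK tf) lte_fin.
Qed.

(** [X] and [Y] are arbitrary after the collision; the value 0 makes the gap continuous up to and
    including [tau]. *)
Definition gap (t : R) : R := if (t%:E < tau)%E then sigma * (X t - Y t) else 0.
(** Solved from the relation defining [st_u] rather than introduced as the integral of [1 / u]: its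
    continuity up to [tau] is then immediate, although the integrand blows up there. The integral
    form before [tau] is [sle_sE]. *)
Definition sle_s (t : R) : R := (2 + Num.sqrt kappa * (sigma * b t) - gap t) / (4 - kappa).
Definition sle_x (t : R) : R := gap t - 1 - 2 * sle_s t.
Definition sle_a (t : R) : R := 2 * \int[lebesgue_measure]_(r in `[0, t]) sle_x r.

Local Notation D := [set t : R | 0 <= t /\ (t%:E < tau)%E].

Let itvD (T : R) : (T%:E < tau)%E -> `[0, T] `<=` D.
Proof.
move=> Tt t /=; rewrite in_itv/= => /andP[t0 tT]; split => //.
by apply: le_lt_trans Tt; rewrite lee_fin.
Qed.

Let gapE t : (t%:E < tau)%E -> gap t = sigma * (X t - Y t).
Proof. by rewrite /gap => ->. Qed.

Let cXY (T : R) : (T%:E < tau)%E -> {within `[0, T], continuous (fun t => X t - Y t)}.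
Proof.
move=> Tt; have [cX cY _ _ _] := sle.
have cX' := continuous_subspaceW (itvD Tt) cX.
have cY' := continuous_subspaceW (itvD Tt) cY.
by move=> t; apply: cvgB; [exact: cX'|exact: cY'].
Qed.

Let cU (T : R) : (T%:E < tau)%E -> {within `[0, T], continuous (fun t => sigma * (X t - Y t))}.
Proof. by move=> Tt t; apply: cvgM; [exact: cvg_cst|exact: cXY]. Qed.

Let U0 : sigma * (X 0 - Y 0) = 2.
Proof.
have [_ _ eX eY _] := sle; have t0 := collision_time_gt0.
rewrite eX// eY// set_itv1 !Rintegral_set1 b0 mulr0 !addr0 opprK.
have -> : sigma * (sigma + sigma) = 2 * sigma ^+ 2 by ring.
by rewrite sigma1 mulr1.
Qed.

Lemma gap0 : gap 0 = 2.
Proof. by rewrite gapE ?U0//; exact: collision_time_gt0. Qed.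

Lemma gap_gt0 t : 0 <= t -> (t%:E < tau)%E -> 0 < gap t.
Proof.
move=> t0 tt; rewrite gapE// ltNge; apply/negP => Ut.
have [c cI Uc] : exists2 c, c \in `[0, t] & sigma * (X c - Y c) = 0.
  apply: IVT => //; first exact: cU.
  by rewrite U0 ge_min Ut orbT le_max ler0n.
move: cI; rewrite in_itv/= => /andP[c0 ct].
have c1 : 0 < c.
  rewrite lt_neqAle c0 andbT; apply/eqP => c0'; move: Uc; rewrite -c0' U0 => /eqP.
  by rewrite pnatr_eq0.
have ctau : (c%:E < tau)%E by apply: le_lt_trans tt; rewrite lee_fin.
have s0 : sigma != 0 by apply/eqP => s0; move: sigma1; rewrite s0 expr0n/= => /eqP; rewrite eq_sym oner_eq0.
have XYc : X c - Y c = 0 by apply/eqP; move/eqP: Uc; rewrite mulf_eq0 (negbTE s0).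
suff : collision_times X Y c.
  move=> cc; have : (tau <= c%:E)%E by apply: ereal_inf_lbound; exists c.
  by rewrite leNgt ctau.
split => //; have := cXY ctau; move=> /(continuous_within_itvP _ c1)[_ _ lim].
rewrite XYc in lim; under eq_fun do rewrite distrC.
by rewrite -(@normr0 _ R); apply: cvg_norm; exact: lim.
Qed.

Let cgap_lt (T : R) : (T%:E < tau)%E -> {within `[0, T], continuous gap}.
Proof.
move=> Tt; apply/within_itvP => x xT e e0.
have [r r0 Hr] := (iffLR (within_itvP _ _ _) (cU Tt)) x xT e e0.
exists r => // y yT yx; rewrite !gapE; first exact: Hr.
- by apply: le_lt_trans Tt; rewrite lee_fin; case/andP: xT.
- by apply: le_lt_trans Tt; rewrite lee_fin; case/andP: yT.
Qed.

(** At [T = tau] continuity at the right endpoint is the very property defining a collision time,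
    available because the infimum is attained. *)
Lemma continuous_gap (T : R) : 0 < T -> (T%:E <= tau)%E -> {within `[0, T], continuous gap}.
Proof.
move=> T0; rewrite le_eqVlt => /predU1P[Tt|]; last exact: cgap_lt.
apply/within_itvP => x /andP[x0 xT] e e0; case: (ltP x T) => xT'; last first.
  have xTE : x = T by apply/eqP; rewrite eq_le xT.
  have [_ _ _ _ att] := sle; have toy : (tau < +oo)%E by rewrite -Tt ltry.
  have [_] := att toy; rewrite -/tau -Tt /= => /cvgrPdist_le /(_ e e0).
  rewrite /at_left nearE /within/= => /nbhs_ballP[r /= r0 Hr].
  exists r => // y /andP[y0 yT]; rewrite xTE => yr.
  have gT : gap T = 0 by rewrite /gap -Tt ltxx.
  rewrite gT subr0; case: (ltP y T) => yT'; last first.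
    have -> : y = T by apply/eqP; rewrite eq_le yT.
    by rewrite gT normr0 ltW.
  have := Hr y; rewrite /ball/= distrC => /(_ yr yT'); rewrite sub0r normrN normr_id distrC.
  rewrite gapE -?Tt ?lte_fin// normrM.
  have -> : `|sigma| = 1; last by rewrite mul1r.
  by apply/eqP; rewrite -(@eqrXn2 _ 2)// real_normK ?num_real// sigma1 expr1n.
pose T' := (x + T) / 2.
have xT2 : x < T' by rewrite /T'; lra.
have T2 : T' < T by rewrite /T'; lra.
have Tt' : (T'%:E < tau)%E by rewrite -Tt lte_fin.
have xI : 0 <= x <= T' by rewrite x0 ltW.
have [r r0 Hr] := (iffLR (within_itvP _ _ _) (cgap_lt Tt')) x xI e e0.
exists (Num.min r (T' - x)); first by rewrite lt_min r0 subr_gt0.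
move=> y /andP[y0 yT]; rewrite lt_min => /andP[yr yx]; apply: Hr => //.
by rewrite y0 /=; have := le_lt_trans (ler_norm _) yx; rewrite ltrBlDr subrK => /ltW.
Qed.

Lemma continuous_sle_b (T : R) : {within `[0, T], continuous (fun t => sigma * b t)}.
Proof.
have cb' : {within `[0, T], continuous b}.
  by apply: continuous_subspaceW cb => t /=; rewrite !in_itv/= andbT => /andP[].
by move=> t; apply: cvgM; [exact: cvg_cst|exact: cb'].
Qed.

Section horizon_path.
Variable T : R.
Hypotheses (T0 : 0 < T) (Tt : (T%:E <= tau)%E).

Lemma continuous_sle_s : {within `[0, T], continuous sle_s}.
Proof.
move=> t; apply: cvgM; last exact: cvg_cst.
apply: cvgB; last exact: continuous_gap.
apply: cvgD; first exact: cvg_cst.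
by apply: cvgM; [exact: cvg_cst|exact: continuous_sle_b].
Qed.

Lemma continuous_sle_x : {within `[0, T], continuous sle_x}.
Proof.
move=> t; apply: cvgB; last by apply: cvgM; [exact: cvg_cst|exact: continuous_sle_s].
by apply: cvgB; [exact: continuous_gap|exact: cvg_cst].
Qed.

Lemma continuous_sle_a : {within `[0, T], continuous sle_a}.
Proof.
move=> t; apply: cvgM; first exact: cvg_cst.
by apply: continuous_integral; [exact: ltW|exact: continuous_sle_x].
Qed.

Lemma is_derive_sle_a t : 0 < t < T -> is_derive t 1 sle_a (2 * sle_x t).
Proof.
move=> tT; have dI := is_derive_integral continuous_sle_x tT.
exact: (is_deriveZ 2).
Qed.

End horizon_path.

Let cinv (T : R) : (T%:E < tau)%E -> {within `[0, T], continuous (fun t => (gap t)^-1)}.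
Proof.
move=> Tt; have cg := cgap_lt Tt.
rewrite continuous_subspace_in => t; rewrite inE/= in_itv/= => /andP[t0 tT].
apply: cvgV; last exact: cg.
rewrite gt_eqF// gap_gt0//.
by apply: le_lt_trans Tt; rewrite lee_fin.
Qed.

Let sle_solution t : 0 <= t -> (t%:E < tau)%E ->
  X t = sigma + Num.sqrt kappa * b t + sigma * (kappa - 6) * \int[lebesgue_measure]_(r in `[0, t]) (gap r)^-1 /\
  Y t = - sigma - 2 * sigma * \int[lebesgue_measure]_(r in `[0, t]) (gap r)^-1.
Proof.
move=> t0 tt; have [_ _ eX eY _] := sle.
have ji : lebesgue_measure.-integrable `[0, t] (EFin \o (fun r => (gap r)^-1)).
  by apply: continuous_compact_integrable; [exact: segment_compact|exact: cinv].
have s0 : sigma != 0 by apply/eqP => s0; move: sigma1; rewrite s0 expr0n/= => /eqP; rewrite eq_sym oner_eq0.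
have sV : sigma^-1 = sigma.
  by apply: (mulfI s0); rewrite divff// -expr2 sigma1.
have inv r : r \in `[0, t]%classic -> (X r - Y r)^-1 = sigma * (gap r)^-1.
  rewrite inE/= in_itv/= => /andP[r0 rt]; rewrite gapE ?invfM ?sV ?mulrA -?expr2 ?sigma1 ?mul1r//.
  by apply: le_lt_trans tt; rewrite lee_fin.
split.
  rewrite eX//; congr (_ + _).
  rewrite -RintegralZl//; apply: eq_Rintegral => r rI; rewrite inv//; ring.
rewrite eY//; rewrite -mulNr -RintegralZl//; congr (_ + _); apply: eq_Rintegral => r rI.
rewrite -opprB invrN inv//; ring.
Qed.

Lemma sle_sE t : 0 <= t -> (t%:E < tau)%E ->
  sle_s t = \int[lebesgue_measure]_(r in `[0, t]) (gap r)^-1.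
Proof.
move=> t0 tt; have [eX eY] := sle_solution t0 tt.
rewrite /sle_s gapE// {1}eX {1}eY; move: (\int[_]_(_ in _) _) => I.
have -> : sigma * (sigma + Num.sqrt kappa * b t + sigma * (kappa - 6) * I - (- sigma - 2 * sigma * I)) =
  2 * sigma ^+ 2 + Num.sqrt kappa * (sigma * b t) - sigma ^+ 2 * (4 - kappa) * I by ring.
by rewrite sigma1; field; rewrite subr_eq0 gt_eqF.
Qed.

Lemma sle_xE t : 0 <= t -> (t%:E < tau)%E -> X t = sigma * sle_x t.
Proof.
move=> t0 tt; have [eX eY] := sle_solution t0 tt.
rewrite /sle_x sle_sE// gapE//.
have -> : sigma * (sigma * (X t - Y t) - 1 - 2 * \int[lebesgue_measure]_(r in `[0, t]) (gap r)^-1) =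
  sigma ^+ 2 * (X t - Y t) - sigma - 2 * sigma * \int[lebesgue_measure]_(r in `[0, t]) (gap r)^-1 by ring.
by rewrite sigma1 eY; ring.
Qed.

Lemma is_derive_sle_s t : 0 < t -> (t%:E < tau)%E -> is_derive t 1 sle_s (gap t)^-1.
Proof.
move=> t0 tt.
have [T' tT' T't] : exists2 T', t < T' & (T'%:E < tau)%E.
  move: tt; case: tau => [r||//]; last by exists (t + 1); rewrite ?ltrDl ?ltry.
  rewrite lte_fin => tr; exists ((t + r) / 2); rewrite ?lte_fin; lra.
have dI : is_derive t 1 (fun t => \int[lebesgue_measure]_(r in `[0, t]) (gap r)^-1) (gap t)^-1.
  by apply: (is_derive_integral (cinv T't)); rewrite t0.
apply: (near_eq_is_derive _ dI); near=> r; rewrite sle_sE//.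
- by apply: ltW; near: r; exact: lt_nbhsr.
- apply: (@lt_trans _ _ T'%:E) => //; rewrite lte_fin; near: r; exact: lt_nbhsl.
Unshelve. all: by end_near. Qed.

Definition sle_state (t : R) := path_state (fun t => sigma * b t) sle_s sle_a t.
Definition sle_horizon (K : nat) : R := if (K%:R%:E < tau)%E then K%:R else fine tau.

Lemma st_u_sle t : st_u kappa (sle_state t) = gap t.
Proof.
rewrite /sle_state /path_state /st_u /st_b /st_s /= /sle_s; field.
by rewrite subr_eq0 gt_eqF.
Qed.

Lemma st_x_sle t : st_x kappa (sle_state t) = sle_x t.
Proof. by rewrite /st_x st_u_sle. Qed.

Lemma close_nbhs (z : R * R * R * R) U : nbhs z U -> exists2 eta : R, 0 < eta &
  forall z', close eta z' z -> U z'.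
Proof.
move=> /nbhs_ballP[r /= r0 rU]; exists (r / 2); first by rewrite divr_gt0.
move=> z' [A B C C']; apply: rU.
have lt : r / 2 < r by rewrite ltr_pdivrMr// ltr_pMr// ltr1n.
by split; [split; [split|]|]; rewrite /ball/= distrC; apply: le_lt_trans lt.
Qed.

Lemma sle_state_limit (K : nat) U : (0 < K)%N -> nbhs (sle_state (sle_horizon K)) U ->
  exists k0, forall k, (k0 <= k)%N -> exists n0, forall N, (n0 <= N)%N ->
    forall z, euler_chain kappa (fun t => sigma * b t) k.+1%:R^-1 N z -> U (z (K * N.+1)%N).
Proof.
move=> K0 /close_nbhs[eta eta0 HU].
have K0' : 0 < K%:R :> R by rewrite ltr0n.
suff [e0 e00 He] : exists2 e0 : R, 0 < e0 & forall eps, 0 < eps -> eps <= e0 ->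
    exists n0, forall N, (n0 <= N)%N -> forall z, euler_chain kappa (fun t => sigma * b t) eps N z ->
      close eta (z (K * N.+1)%N) (sle_state (sle_horizon K)).
  exists (Num.truncn e0^-1) => k kk.
  have ek : k.+1%:R^-1 <= e0.
    rewrite invf_ple ?posrE ?ltr0n// (le_trans (ltW (truncnS_gt _)))// ler_nat//.
  have ek0 : 0 < k.+1%:R^-1 :> R by rewrite invr_gt0 ltr0n.
  have [n0 Hn] := He _ ek0 ek; exists n0 => N nN z cz; apply: HU; exact: Hn.
have s00 : sle_s 0 = 0 by rewrite /sle_s gap0 b0 !mulr0 addr0 subrr mul0r.
have a00 : sle_a 0 = 0 by rewrite /sle_a set_itv1 Rintegral_set1 mulr0.
have b00 : sigma * b 0 = 0 by rewrite b0 mulr0.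
(* If the horizon precedes the collision the chain is never stopped; otherwise it is frozen near the
   collision time. *)
rewrite /sle_horizon; case: ifPn => Kt.
  have dsT (t : R) : 0 < t < K%:R -> is_derive t 1 sle_s (st_u kappa (sle_state t))^-1.
    move=> /andP[t0 tK]; rewrite st_u_sle; apply: is_derive_sle_s => //.
    by apply: lt_trans Kt; rewrite lte_fin.
  have daT (t : R) : 0 < t < K%:R -> is_derive t 1 sle_a (2 * st_x kappa (sle_state t)).
    by move=> tK; rewrite st_x_sle; exact: (is_derive_sle_a K0' (ltW Kt)).
  apply: (euler_survives k0 k4 (ltW K0') b00 s00 a00 (@continuous_sle_b _)
    (continuous_sle_s K0' (ltW Kt)) (continuous_sle_a K0' (ltW Kt)) dsT daT) => //.
  move=> t /andP[t0 tK]; rewrite -/(sle_state t) st_u_sle gap_gt0//.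
  by apply: le_lt_trans Kt; rewrite lee_fin.
have tau0 := collision_time_gt0.
have toy : (tau <= K%:R%:E)%E by rewrite leNgt.
have tf : tau \is a fin_num by rewrite ge0_fin_numE ?(ltW tau0)// (le_lt_trans toy)// ltry.
have tE := fineK tf; set T := fine tau in tE *.
have T0 : 0 < T by rewrite -lte_fin tE.
have Tt : (T%:E <= tau)%E by rewrite tE.
have dsT (t : R) : 0 < t < T -> is_derive t 1 sle_s (st_u kappa (sle_state t))^-1.
  move=> /andP[t0 tK]; rewrite st_u_sle; apply: is_derive_sle_s => //.
  by rewrite -tE lte_fin.
have daT (t : R) : 0 < t < T -> is_derive t 1 sle_a (2 * st_x kappa (sle_state t)).
  by move=> tK; rewrite st_x_sle; exact: (is_derive_sle_a T0 Tt).
apply: (euler_hits k0 k4 (ltW T0) b00 s00 a00 (@continuous_sle_b _)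
    (continuous_sle_s T0 Tt) (continuous_sle_a T0 Tt) dsT daT) => //.
- by rewrite -lee_fin tE.
- by move=> t /andP[t0 tK]; rewrite -/(sle_state t) st_u_sle gap_gt0// -tE lte_fin.
- by rewrite -/(sle_state T) st_u_sle /gap tE ltxx.
Qed.

End sle_path.

(** * Coefficients of the Loewner map *)

Section power_series_asymptotics.
Context {R : realType}.

Lemma geometric_sum_le2 (r : R) n : 0 <= r -> r <= 1 / 2 -> \sum_(0 <= k < n) r ^+ k <= 2.
Proof.
move=> r0 r1; elim: n => [|n IH]; first by rewrite big_geq.
rewrite big_nat_recl// expr0; under eq_bigr do rewrite exprS.
by rewrite -mulr_sumr; move: IH; move: (\sum_(_ <= _ < _) _) => s; nra.
Qed.

(** Convergence at one point [y0] bounds the terms [c k * y0 ^- k]; for [y >= 2 * y0] the terms from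
    the third on are then dominated by a geometric series of ratio at most [1 / 2]. *)
Lemma power_series_remainder (c : nat -> R) (q : R -> R) (M : R) :
  (forall y, M < y -> (fun N => \sum_(1 <= k < N) c k * y ^- k) @ \oo --> q y) ->
  exists C Y : R, [/\ 0 <= C, 1 <= Y, M < Y & forall y, Y <= y ->
    `|q y - c 1%N / y - c 2%N / y ^+ 2| <= C / y ^+ 3].
Proof.
move=> H; pose y0 := Num.max M 0 + 1.
have y0M : M < y0 by rewrite ltr_pwDr// le_max lexx.
have y01 : 1 <= y0 by rewrite lerDr le_max lexx orbT.
have y00 : 0 < y0 by rewrite (lt_le_trans ltr01).
pose S y N := \sum_(1 <= k < N) c k * y ^- k.
have [B1 B10 HB1] : exists2 B1 : R, 0 <= B1 & forall N, `|S y0 N| <= B1.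
  have [B' [_ HB']] := cvg_seq_bounded (cvgP _ (H _ y0M)).
  exists (Num.max 0 (B' + 1)) => [|N]; first by rewrite le_max lexx.
  by rewrite le_max (HB' (B' + 1)) ?orbT// ltrDl.
have cB k : (1 <= k)%N -> `|c k| <= 2 * B1 * y0 ^+ k.
  move=> k1; have E : c k * y0 ^- k = S y0 k.+1 - S y0 k.
    by rewrite /S big_nat_recr//= addrAC subrr add0r.
  have : `|c k * y0 ^- k| <= 2 * B1.
    by rewrite E (le_trans (ler_normB _ _))// mulr_natl mulr2n lerD.
  by rewrite normrM normfV normrX (gtr0_norm y00) ler_pdivrMr// exprn_gt0.
exists (4 * B1 * y0 ^+ 3), (2 * y0); split.
- by rewrite !mulr_ge0// ?exprn_ge0// ltW.
- by rewrite (le_trans y01)// ler_peMl ?ler1n// ltW.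
- by rewrite (lt_le_trans y0M)// ler_peMl ?ler1n// ltW.
move=> y yy; have yM : M < y by rewrite (lt_le_trans y0M)// (le_trans _ yy)// ler_peMl ?ler1n// ltW.
have y0' : 0 < y by rewrite (lt_le_trans _ yy)// mulr_gt0.
pose r := y0 / y; have r0 : 0 <= r by apply: divr_ge0; exact: ltW.
have r1 : r <= 1 / 2 by rewrite ler_pdivrMr// mulrC mulrA mulr1 ler_pdivlMr// mulrC.
have bound N : `|S y N.+3 - c 1%N / y - c 2%N / y ^+ 2| <= 4 * B1 * y0 ^+ 3 / y ^+ 3.
  have -> : S y N.+3 - c 1%N / y - c 2%N / y ^+ 2 = \sum_(0 <= k < N) c k.+3 * y ^- k.+3.
    rewrite /S big_ltn// big_ltn// (big_addn 0 N.+3 3) subSS subSS subSS subn0 expr1.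
    under [in RHS]eq_bigr do rewrite -addn3.
    ring.
  rewrite (le_trans (ler_norm_sum _ _ _))//.
  apply: (@le_trans _ _ (\sum_(0 <= k < N) (2 * B1 * r ^+ 3) * r ^+ k)).
    apply: ler_sum => k _; rewrite normrM normfV normrX (gtr0_norm y0').
    rewrite ler_pdivrMr ?exprn_gt0// (le_trans (cB _ _))//.
    have yE : y0 = r * y by rewrite divfK// gt_eqF.
    by rewrite {1}yE exprMn le_eqVlt; apply/orP; left; apply/eqP; rewrite -[k.+3]addn3 !exprD; ring.
  rewrite -mulr_sumr.
  have -> : 4 * B1 * y0 ^+ 3 / y ^+ 3 = 2 * B1 * r ^+ 3 * 2 by rewrite /r expr_div_n; ring.
  by rewrite ler_wpM2l ?geometric_sum_le2// mulr_ge0 ?exprn_ge0// mulr_ge0.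
apply/ler_addgt0Pr => e e0.
have := H y yM => /cvgrPdist_le /(_ e e0) [n _ Hn].
have := Hn n.+3; rewrite /= -/(S y n.+3) => /(_ (leq_trans (leqnSn _) (leq_trans (leqnSn _) (leqnSn _)))) A.
have -> : q y - c 1%N / y - c 2%N / y ^+ 2 = (S y n.+3 - c 1%N / y - c 2%N / y ^+ 2) + (q y - S y n.+3) by ring.
by rewrite (le_trans (ler_normD _ _))// lerD.
Qed.

Lemma eq_of_asymptotics (p q C Y : R) :
  (forall y, Y <= y -> `|p - q| <= C / y) -> p = q.
Proof.
move=> H; apply/eqP; rewrite -subr_eq0 -normr_le0; apply/ler_addgt0Pr => e e0; rewrite add0r.
pose y := Num.max Y (Num.max 1 (C / e)).
have y0 : 0 < y by rewrite !lt_max ltr01 orbT.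
rewrite (le_trans (H y _)) ?le_max ?lexx// ler_pdivrMr// -ler_pdivrMl// mulrC.
by rewrite !le_max lexx !orbT.
Qed.

End power_series_asymptotics.

Section expansion_on_axis.
Context {R : realType}.
Local Open Scope complex_scope.

Lemma Re_sum (I : Type) (r : seq I) (F : I -> R[i]) :
  complex.Re (\sum_(i <- r) F i) = \sum_(i <- r) complex.Re (F i).
Proof. exact: (raddf_sum (@complex.Re R : Rcomplex R -> R)). Qed.

Lemma Im_sum (I : Type) (r : seq I) (F : I -> R[i]) :
  complex.Im (\sum_(i <- r) F i) = \sum_(i <- r) complex.Im (F i).
Proof. exact: (raddf_sum (@complex.Im R : Rcomplex R -> R)). Qed.

Lemma cvg_Re (u : nat -> R[i]) (l : R[i]) : u @ \oo --> (l : R[i]^o) ->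
  (fun N => complex.Re (u N)) @ \oo --> complex.Re l.
Proof.
move=> /(@cvgrPdist_le _ (R[i]^o)) H; apply/cvgrPdist_le => e e0.
have e0' : 0 < e%:C by rewrite ltcR.
have [n _ Hn] := H _ e0'; exists n => // N nN; have := Hn N nN => /= h.
rewrite -lecR (le_trans _ h)//.
have -> : complex.Re l - complex.Re (u N) = complex.Re (l - u N) by case: (l) (u N) => ? ? [? ?].
exact: normc_ge_Re.
Qed.

Lemma cvg_Im (u : nat -> R[i]) (l : R[i]) : u @ \oo --> (l : R[i]^o) ->
  (fun N => complex.Im (u N)) @ \oo --> complex.Im l.
Proof.
move=> /(@cvgrPdist_le _ (R[i]^o)) H; apply/cvgrPdist_le => e e0.
have e0' : 0 < e%:C by rewrite ltcR.
have [n _ Hn] := H _ e0'; exists n => // N nN; have := Hn N nN => /= h.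
rewrite -lecR (le_trans _ h)//; move: (l) (u N) => [a b] [c d] /=.
rewrite normc_def lecR -sqrtr_sqr ler_sqrt ?addr_ge0 ?sqr_ge0//= lerDr sqr_ge0//.
Qed.

Let mi := (0 -i* 1 : R[i]).

Let axis_inv (y : R) k : 0 < y -> (0 +i* y) ^- k = (y ^- k)%:C * mi ^+ k.
Proof.
move=> y0; have -> : (0 +i* y) = y%:C * (0 +i* 1) by apply/eqP; rewrite eq_complex/= !mul0r !mulr0 !mulr1 subr0 addr0 !eqxx.
rewrite -[LHS]exprVn invfM exprMn -exprVn rmorphXn /= fmorphV; congr (_ * _ ^+ k).
by apply/eqP; rewrite eq_complex /= !expr0n /= expr1n add0r !mul0r divr1 !eqxx.
Qed.

(** On the imaginary axis [z ^- k] is [y ^- k] times a power of [mi], the inverse of the imaginary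
    unit. Odd coefficients thus enter the imaginary part and even ones the real part, so each of the
    two real series isolates one coefficient at leading order. *)
Lemma expansion_on_axis (f : R[i] -> R[i]) (a : nat -> R) : expansion_at_infinity f a ->
  exists C Y : R, [/\ 0 <= C, 1 <= Y & forall y, Y <= y ->
    `|y * (complex.Im (f (0 +i* y)) - y) + a 1%N| <= C / y /\
    `|y ^+ 2 * complex.Re (f (0 +i* y)) + a 2%N| <= C / y].
Proof.
move=> [M HM]; pose M' := Num.max 0 M.
pose cr k := a k * complex.Re (mi ^+ k); pose ci k := a k * complex.Im (mi ^+ k).
have ser (y : R) : M' < y -> (fun N : nat => (0 +i* y) + \sum_(1 <= k < N) (a k)%:C * (0 +i* y) ^- k) @ \oo
      --> (f (0 +i* y) : R[i]^o).
  rewrite gt_max => /andP[y0 My]; apply: HM => //=.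
  by rewrite normc_def /= expr0n /= add0r sqrtr_sqr ger0_norm ?ltcR// ltW.
have reE (y : R) N : 0 < y -> complex.Re ((0 +i* y) + \sum_(1 <= k < N) (a k)%:C * (0 +i* y) ^- k) =
    \sum_(1 <= k < N) cr k * y ^- k.
  move=> y0; have -> (z w : R[i]) : complex.Re (z + w) = complex.Re z + complex.Re w by case: z w => ? ? [? ?].
  rewrite /= add0r Re_sum; apply: eq_bigr => k _; rewrite axis_inv// /cr.
  by case: (mi ^+ k) => p q /=; rewrite !mul0r ?mulr0 ?subr0 ?addr0; ring.
have imE (y : R) N : 0 < y -> complex.Im ((0 +i* y) + \sum_(1 <= k < N) (a k)%:C * (0 +i* y) ^- k) =
    y + \sum_(1 <= k < N) ci k * y ^- k.
  move=> y0; have -> (z w : R[i]) : complex.Im (z + w) = complex.Im z + complex.Im w by case: z w => ? ? [? ?].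
  rewrite /= Im_sum; congr (_ + _); apply: eq_bigr => k _; rewrite axis_inv// /ci.
  by case: (mi ^+ k) => p q /=; rewrite !mul0r ?mulr0 ?subr0 ?addr0; ring.
have Hr (y : R) : M' < y -> (fun N => \sum_(1 <= k < N) cr k * y ^- k) @ \oo --> complex.Re (f (0 +i* y)).
  move=> yM; have y0 : 0 < y by move: yM; rewrite gt_max => /andP[].
  by have := cvg_Re (ser y yM); under eq_fun do rewrite reE//.
have Hi (y : R) : M' < y -> (fun N => \sum_(1 <= k < N) ci k * y ^- k) @ \oo --> complex.Im (f (0 +i* y)) - y.
  move=> yM; have y0 : 0 < y by move: yM; rewrite gt_max => /andP[].
  have := cvg_Im (ser y yM); under eq_fun do rewrite imE//.
  move=> h; have h' : (fun N => y + \sum_(1 <= k < N) ci k * y ^- k - y) @ \oo --> complex.Im (f (0 +i* y)) - y.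
    by apply: cvgB => //; exact: cvg_cst.
  by move: h'; under eq_fun do rewrite addrAC subrr add0r.
have [C1 [Y1 [C10 Y11 _ H1]]] := power_series_remainder Hr.
have [C2 [Y2 [C20 Y21 _ H2]]] := power_series_remainder Hi.
have m1 : mi ^+ 1 = 0 -i* 1 by [].
have m2 : mi ^+ 2 = (-1) +i* 0.
  by rewrite expr2; apply/eqP; rewrite eq_complex /= !mul0r !mulr0 mulrNN mulr1 sub0r addr0 !eqxx.
have e1 : cr 1%N = 0 by rewrite /cr m1 /= mulr0.
have e2 : cr 2%N = - a 2%N by rewrite /cr m2 /= mulrN1.
have e3 : ci 1%N = - a 1%N by rewrite /ci m1 /= mulrN1.
have e4 : ci 2%N = 0 by rewrite /ci m2 /= mulr0.
exists (C1 + C2), (Num.max Y1 Y2); split.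
- exact: addr_ge0.
- by rewrite le_max Y11.
move=> y; rewrite ge_max => /andP[yY1 yY2].
have y1 : 1 <= y by rewrite (le_trans Y11).
have y0 : 0 < y by rewrite (lt_le_trans ltr01).
split.
  have -> : y * (complex.Im (f (0 +i* y)) - y) + a 1%N =
      y * (complex.Im (f (0 +i* y)) - y - ci 1%N / y - ci 2%N / y ^+ 2).
    by rewrite e3 e4; field; rewrite gt_eqF.
  rewrite normrM gtr0_norm//; apply: (@le_trans _ _ (y * (C2 / y ^+ 3))).
    by rewrite ler_wpM2l ?(ltW y0)// H2.
  have -> : y * (C2 / y ^+ 3) = C2 / y ^+ 2 by field; rewrite gt_eqF.
  apply: ler_pM => //; first by rewrite invr_ge0 exprn_ge0// ltW.
    by rewrite lerDr.
  by rewrite lef_pV2 ?posrE ?exprn_gt0// expr2 ler_peMl// ltW.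
have -> : y ^+ 2 * complex.Re (f (0 +i* y)) + a 2%N =
    y ^+ 2 * (complex.Re (f (0 +i* y)) - cr 1%N / y - cr 2%N / y ^+ 2).
  by rewrite e1 e2; field; rewrite gt_eqF.
rewrite normrM gtr0_norm ?exprn_gt0//; apply: (@le_trans _ _ (y ^+ 2 * (C1 / y ^+ 3))).
  by rewrite ler_wpM2l ?exprn_ge0 ?(ltW y0)// H1.
have -> : y ^+ 2 * (C1 / y ^+ 3) = C1 / y by field; rewrite gt_eqF.
by rewrite ler_wpM2r ?invr_ge0 ?(ltW y0)// lerDl.
Qed.

End expansion_on_axis.

(** * Loewner flow on the imaginary axis *)

Section loewner.
Context {R : realType}.
Local Open Scope complex_scope.

Lemma Re_loewner_field (z : R[i]) (w : R) : complex.Re (2 / (z - w%:C)) =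
  2 * (complex.Re z - w) / ((complex.Re z - w) ^+ 2 + complex.Im z ^+ 2).
Proof.
by case: z => p q /=; rewrite !oppr0 !addr0 !mul0r subr0 mulrA.
Qed.

Lemma Im_loewner_field (z : R[i]) (w : R) : complex.Im (2 / (z - w%:C)) =
  - (2 * complex.Im z / ((complex.Re z - w) ^+ 2 + complex.Im z ^+ 2)).
Proof.
by case: z => p q /=; rewrite !oppr0 !addr0 !mul0r addr0 mulrN mulrA.
Qed.

(** With [r] and [v] the real and imaginary parts of the flow, [w = r - W] and
    [D = w ^+ 2 + v ^+ 2], the functions [y * v + 2 * t] and [y ^+ 2 * r + 2 * J] have derivatives
    [2 * (D - y * v) / D] and [2 * (y ^+ 2 * r + W * (D - y ^+ 2)) / D]. Since [D] differs from
    [y ^+ 2] and from [y * v] by a bounded amount and [r] is of order [1 / y], both derivatives are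
    at most of order [1 / y], and the mean value theorem concludes. *)
Lemma loewner_flow_on_axis (W J : R -> R) (T M : R) : 0 < T -> 0 <= M ->
  (forall t, 0 < t < T -> `|W t| <= M) ->
  {within `[0, T], continuous J} -> J 0 = 0 -> (forall t, 0 < t < T -> is_derive t 1 J (W t)) ->
  exists C Y : R, [/\ 0 <= C, 1 <= Y & forall (y : R) h, Y <= y -> loewner_flow W T (0 +i* y) h ->
    `|y * (complex.Im (h T) - y) + 2 * T| <= C / y /\
    `|y ^+ 2 * complex.Re (h T) + 2 * J T| <= C / y].
Proof.
move=> T0 M0 WM cJ J0 dJ.
(* The first term bounds [w ^+ 2], as [|r| <= 1], and the second bounds [y ^+ 2 - v ^+ 2]. *)
pose M1 := (M + 1) ^+ 2 + 4 * T.
have M10 : 0 <= M1 by rewrite addr_ge0 ?sqr_ge0// mulr_ge0// ltW.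
pose C := 8 * T * M1 + 8 * (2 * T + M * M1) * T.
have C0 : 0 <= C by rewrite addr_ge0// ?mulr_ge0// ?addr_ge0// ?mulr_ge0// ltW.
exists C, (2 + 8 * T); split => //; first by move: T0; lra.
move=> y h yY [h0 hpos cRe cIm dh].
have y1 : 1 <= y by move: T0; lra.
have y0 : 0 < y by rewrite (lt_le_trans ltr01).
pose r t := complex.Re (h t); pose v t := complex.Im (h t).
pose w t := r t - W t; pose D t := w t ^+ 2 + v t ^+ 2.
have r00 : r 0 = 0 by rewrite /r h0.
have v00 : v 0 = y by rewrite /v h0.
have vpos t : 0 <= t <= T -> 0 < v t by exact: hpos.
have dr (t : R) : 0 < t < T -> is_derive t 1 r (2 * w t / D t).
  by move=> tT; have [d _] := dh t tT; rewrite Re_loewner_field in d; exact: d.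
have dv (t : R) : 0 < t < T -> is_derive t 1 v (- (2 * v t / D t)).
  by move=> tT; have [_ d] := dh t tT; rewrite Im_loewner_field in d; exact: d.
have mv (f df : R -> R) (t : R) : 0 <= t <= T -> {within `[0, T], continuous f} ->
    (forall x : R, 0 < x < T -> is_derive x 1 f (df x)) ->
    exists2 c, 0 < c < T & f t - f 0 = df c * t.
  move=> /andP[t0 tT] cf dff; move: t0; rewrite le_eqVlt => /predU1P[<-|t0].
    by exists (T / 2); [apply/andP; split; lra|rewrite subrr mulr0].
  have [||c] := @MVT R f df 0 t t0.
  - by move=> x; rewrite in_itv/= => /andP[x0 xt]; apply: dff; rewrite x0 (lt_le_trans xt).
  - by apply: within_itv_sub cf.
  rewrite in_itv/= subr0 => /andP[c0 ct] E; exists c => //.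
  by rewrite c0 (lt_le_trans ct).
have inT t : 0 < t < T -> 0 <= t <= T by move=> /andP[? ?]; rewrite !ltW.
have Dpos t : 0 < t < T -> 0 < D t.
  by move=> /inT tT; rewrite /D ltr_wpDl ?sqr_ge0// exprn_gt0// vpos.
(* The derivative of [v ^+ 2] is [- 4 * v ^+ 2 / D], which lies between -4 and 0. *)
have v2 t : 0 <= t <= T -> y ^+ 2 - 4 * T <= v t ^+ 2 <= y ^+ 2.
  move=> tT.
  have [|x xT|c cT] := mv (fun t => v t * v t) (fun t => - (4 * v t ^+ 2 / D t)) t tT.
  - by move=> x; apply: cvgM; exact: cIm.
  - have dvx := dv x xT; have := is_deriveM dvx dvx.
    by move=> /is_derive_eq; apply; rewrite /GRing.scale/=; field; rewrite gt_eqF// Dpos.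
  rewrite v00 -!expr2 => E.
  have q0 : 0 <= v c ^+ 2 / D c by rewrite divr_ge0 ?sqr_ge0// ltW// Dpos.
  have q1 : v c ^+ 2 / D c <= 1 by rewrite ler_pdivrMr ?Dpos// mul1r /D lerDr sqr_ge0.
  move: E; have -> : - (4 * v c ^+ 2 / D c) * t = - 4 * (v c ^+ 2 / D c * t) by ring.
  case/andP: tT => t0 tT; have a1 : v c ^+ 2 / D c * t <= T.
    by rewrite -[leRHS]mul1r ler_pM.
  have a2 : 0 <= v c ^+ 2 / D c * t by rewrite mulr_ge0.
  by move: a1 a2; move: (_ / _ * t) (v t ^+ 2) (y ^+ 2) => ? ? ? ? ? ?; apply/andP; split; lra.
have vle t : 0 <= t <= T -> y / 2 <= v t <= y.
  move=> tT; have /andP[A B] := v2 t tT; have vt := vpos t tT.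
  have v0 := ltW vt; apply/andP; split.
    rewrite -(ler_sqr (_ : y / 2 \is Num.nneg)) ?nnegrE//; last by rewrite divr_ge0// ltW.
    by rewrite (le_trans _ A)// expr_div_n; nra.
  by rewrite -ler_sqr ?nnegrE// ltW.
have Dge t : 0 < t < T -> y ^+ 2 / 4 <= D t.
  move=> tT; have /andP[A _] := vle t (inT _ tT).
  have : (y / 2) ^+ 2 <= v t ^+ 2 by rewrite lerXn2r ?nnegrE ?divr_ge0 ?(ltW y0) ?(ltW (vpos _ (inT _ tT))).
  rewrite expr_div_n (_ : 2 ^+ 2 = 4 :> R); last by rewrite -natrX.
  by move=> /le_trans; apply; rewrite /D lerDr sqr_ge0.
have rle t : 0 <= t <= T -> `|r t| <= 2 * T / y.
  move=> tT; have [c cT E] := mv r (fun t => 2 * w t / D t) t tT cRe dr.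
  move: E; rewrite r00 subr0 => ->; rewrite normrM.
  have vc : 0 < v c by apply: vpos; exact: inT.
  have : `|2 * w c / D c| <= (v c)^-1.
    rewrite normrM normfV (gtr0_norm (Dpos _ cT)) ler_pdivrMr ?Dpos// ler_pdivlMl//.
    rewrite /D -[w c ^+ 2]real_normK ?num_real// normrM (ger0_norm (_ : 0 <= 2))//.
    by have := sqr_ge0 (`|w c| - v c); move: (`|w c|) (v c) => ? ?; nra.
  have : (v c)^-1 <= 2 / y.
    have /andP[A _] := vle c (inT _ cT).
    by rewrite -[leRHS]invf_div lef_pV2// posrE divr_gt0.
  move=> A B; have {A}B := le_trans B A.
  rewrite (_ : 2 * T / y = 2 / y * T); last by ring.
  case/andP: tT => t0 tT; rewrite (ger0_norm t0).
  by apply: ler_pM.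
have r1 t : 0 <= t <= T -> `|r t| <= 1.
  move=> tT; rewrite (le_trans (rle t tT))// ler_pdivrMr// mul1r.
  by move: T0 yY; lra.
have wle t : 0 < t < T -> w t ^+ 2 <= (M + 1) ^+ 2.
  move=> tT; rewrite -[w t ^+ 2]real_normK ?num_real// lerXn2r ?nnegrE ?addr_ge0//.
  by rewrite (le_trans (ler_normB _ _))// addrC lerD ?WM ?r1// inT.
have Dy t : 0 < t < T -> `|D t - y ^+ 2| <= M1.
  move=> tT; have /andP[A B] := v2 t (inT _ tT); have E := wle t tT.
  have := sqr_ge0 (w t); have := T0; move: A B E; rewrite /D /M1.
  move: (w t ^+ 2) (v t ^+ 2) (y ^+ 2) ((M + 1) ^+ 2) => ? ? ? ? ? ? ? ? ?.
  by rewrite ler_norml; apply/andP; split; lra.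
have Dv t : 0 < t < T -> `|D t - y * v t| <= M1.
  move=> tT; have /andP[A B] := v2 t (inT _ tT); have E := wle t tT.
  have /andP[A' B'] := vle t (inT _ tT); have vt := vpos t (inT _ tT).
  have F1 : v t ^+ 2 <= y * v t by rewrite expr2 ler_wpM2r// ltW.
  have F2 : y * v t <= y ^+ 2 by rewrite expr2 ler_wpM2l// ltW.
  have := sqr_ge0 (w t); have := T0; move: A B E F1 F2; rewrite /D /M1.
  move: (w t ^+ 2) (v t ^+ 2) (y ^+ 2) ((M + 1) ^+ 2) (y * v t) => ? ? ? ? ? ? ? ? ? ? ? ?.
  by rewrite ler_norml; apply/andP; split; lra.
have TT : 0 <= T <= T by rewrite lexx ltW.
have yy : y <= y ^+ 2 by rewrite expr2 ler_peMl// ltW.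
have y20 : 0 < y ^+ 2 by rewrite exprn_gt0.
have iD t : 0 < t < T -> (D t)^-1 <= 4 / y ^+ 2.
  by move=> tT; rewrite -[leRHS]invf_div lef_pV2 ?posrE ?divr_gt0 ?Dpos// Dge.
have i4 : 4 / y ^+ 2 <= 4 / y.
  by rewrite ler_pM2l// lef_pV2 ?posrE.
split.
  have [|x xT|c cT] := mv (fun t => y * v t + 2 * t) (fun t => 2 * ((D t - y * v t) / D t)) T TT.
  - move=> x; apply: cvgD; apply: cvgM; [exact: cvg_cst|exact: cIm|exact: cvg_cst|].
    by apply: continuous_subspaceT => ?; exact: cvg_id.
  - have d1 := is_deriveZ y (dv x xT); have d2 := is_deriveZ (2 : R) (is_derive_id x (1 : R)).
    have := is_deriveD d1 d2.
    by move=> /is_derive_eq; apply; rewrite /GRing.scale/=; field; rewrite gt_eqF// Dpos.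
  rewrite v00 mulr0 addr0 -/(v T) => E.
  rewrite (_ : y * (v T - y) + 2 * T = y * v T + 2 * T - y * y); last by ring.
  rewrite E !normrM (gtr0_norm T0) normfV (gtr0_norm (Dpos _ cT)) ger0_norm//.
  apply: (@le_trans _ _ (2 * (M1 * (4 / y)) * T)).
    rewrite ler_wpM2r ?(ltW T0)// ler_wpM2l// ler_pM ?invr_ge0 ?(ltW (Dpos _ cT)) ?Dv//.
    exact: le_trans (iD _ cT) i4.
  rewrite (_ : _ * T = 8 * T * M1 / y); last by ring.
  rewrite ler_wpM2r ?invr_ge0 ?(ltW y0)// /C lerDl.
  by rewrite !mulr_ge0 ?addr_ge0 ?mulr_ge0// ltW.
have [|x xT|c cT] := mv (fun t => y ^+ 2 * r t + 2 * J t)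
   (fun t => 2 * ((y ^+ 2 * r t + W t * (D t - y ^+ 2)) / D t)) T TT.
- by move=> x; apply: cvgD; apply: cvgM; [exact: cvg_cst|exact: cRe|exact: cvg_cst|exact: cJ].
- have d1 := is_deriveZ (y ^+ 2) (dr x xT); have d2 := is_deriveZ (2 : R) (dJ x xT).
  have := is_deriveD d1 d2.
  by move=> /is_derive_eq; apply; rewrite /GRing.scale/= /w; field; rewrite gt_eqF// Dpos.
rewrite r00 J0 !mulr0 addr0 subr0 -/(r T) => ->.
rewrite !normrM (gtr0_norm T0) normfV (gtr0_norm (Dpos _ cT)) ger0_norm//.
have N1 : `|y ^+ 2 * r c + W c * (D c - y ^+ 2)| <= y * (2 * T + M * M1).
  rewrite (le_trans (ler_normD _ _))// [leRHS]mulrDr lerD//.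
    rewrite normrM (gtr0_norm y20) (le_trans (ler_wpM2l (ltW y20) (rle _ (inT _ cT))))//.
    by rewrite le_eqVlt; apply/orP; left; apply/eqP; field; rewrite gt_eqF.
  apply: (@le_trans _ _ (M * M1)); last by rewrite ler_peMl// mulr_ge0.
  by rewrite normrM ler_pM// ?WM ?Dy.
apply: (@le_trans _ _ (2 * (y * (2 * T + M * M1) * (4 / y ^+ 2)) * T)).
  by rewrite ler_wpM2r ?(ltW T0)// ler_wpM2l// ler_pM ?invr_ge0 ?(ltW (Dpos _ cT)) ?iD.
rewrite (_ : _ * T = 8 * (2 * T + M * M1) * T / y); last by field; rewrite gt_eqF.
rewrite ler_wpM2r ?invr_ge0 ?(ltW y0)// /C lerDr.
by rewrite !mulr_ge0// ltW.
Qed.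

(** Comparison of two asymptotics on the axis, those of the flow and those of the expansion. That
    the flow from a high point of the axis exists up to [T] is read off from the expansion itself,
    so no differential equation has to be solved. *)
Lemma loewner_coefficients (W J : R -> R) (T M : R) (a : nat -> R) : 0 < T -> 0 <= M ->
  (forall t, 0 < t < T -> `|W t| <= M) ->
  {within `[0, T], continuous J} -> J 0 = 0 -> (forall t, 0 < t < T -> is_derive t 1 J (W t)) ->
  expansion_at_infinity (loewner_map W T) a -> a 1%N = 2 * T /\ a 2%N = 2 * J T.
Proof.
move=> T0 M0 WM cJ J0 dJ ex.
have [C1 [Y1 [C10 Y11 H1]]] := loewner_flow_on_axis T0 M0 WM cJ J0 dJ.
have [C2 [Y2 [C20 Y21 H2]]] := expansion_on_axis ex.
pose Y := Num.max (Num.max Y1 Y2) (`|a 1%N| + C2 + 1).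
have HY y : Y <= y -> [/\ Y1 <= y, Y2 <= y & `|a 1%N| + C2 + 1 <= y].
  by rewrite !ge_max => /andP[/andP[-> ->] ->].
have flow y : Y <= y -> exists2 h, loewner_flow W T (0 +i* y) h & loewner_map W T (0 +i* y) = h T.
  move=> /HY[yY1 yY2 ya]; have y1 : 1 <= y by rewrite (le_trans Y11).
  case: (pselect (exists h, loewner_flow W T (0 +i* y) h)) => [[h hf]|nex].
    have [h' hf' <-] : [set h T | h in loewner_flow W T (0 +i* y)] (loewner_map W T (0 +i* y)).
      by rewrite /loewner_map; apply: (xgetPex 0); exists (h T), h.
    by exists h'.
  (* Without a solution the map takes its default value 0, whereas the expansion puts the imaginary
     part close to [y]; this is absurd once [y] exceeds [|a_1| + C2 + 1]. *)
  have E : loewner_map W T (0 +i* y) = 0.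
    by rewrite /loewner_map xgetPN// => z [h hf _]; apply: nex; exists h.
  have [] := H2 y yY2; rewrite E /= sub0r => B _.
  have : C2 / y <= C2 by rewrite ler_pdivrMr ?(lt_le_trans ltr01)// ler_peMr.
  have := ler_norm (a 1%N); move: B; rewrite ler_norml => /andP[B _].
  move: B ya y1 C20; move: (C2 / y) => q; move: (a 1%N) (`|a 1%N|) => p p'.
  nra.
have Y0 y : Y <= y -> 0 < y by move=> /HY[yY1 _ _]; rewrite (lt_le_trans ltr01)// (le_trans Y11).
split.
  apply: (@eq_of_asymptotics _ _ _ (C1 + C2) Y) => y yY.
  have [h hf E] := flow y yY; have [yY1 yY2 _] := HY y yY.
  have [A _] := H1 y h yY1 hf; have [B _] := H2 y yY2; rewrite E in B.
  have -> : a 1%N - 2 * T = (y * (complex.Im (h T) - y) + a 1%N) - (y * (complex.Im (h T) - y) + 2 * T) by ring.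
  by rewrite (le_trans (ler_normB _ _))// [leRHS]mulrDl [leRHS]addrC lerD.
apply: (@eq_of_asymptotics _ _ _ (C1 + C2) Y) => y yY.
have [h hf E] := flow y yY; have [yY1 yY2 _] := HY y yY.
have [_ A] := H1 y h yY1 hf; have [_ B] := H2 y yY2; rewrite E in B.
have -> : a 2%N - 2 * J T = (y ^+ 2 * complex.Re (h T) + a 2%N) - (y ^+ 2 * complex.Re (h T) + 2 * J T) by ring.
by rewrite (le_trans (ler_normB _ _))// [leRHS]mulrDl [leRHS]addrC lerD.
Qed.

End loewner.

(** * The horizon tends to infinity *)

Section nonmeasurable_integral.
Import HBNNSimple.
Context d (T : measurableType d) (R : realType) (mu : {measure set T -> \bar R}).
Local Open Scope ereal_scope.

(** A simple function below [f], cut to 0 on the exceptional null set, is below [g] everywhere and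
    has the same integral. *)
Lemma ge0_le_integral_ae_nonmeasurable (f g : T -> \bar R) : (forall x, 0 <= f x) -> (forall x, 0 <= g x) ->
  {ae mu, forall x, f x = g x} -> \int[mu]_x f x <= \int[mu]_x g x.
Proof.
move=> f0 g0 [N [mN N0 fgN]].
rewrite !ge0_integralTE//; apply: ge_ereal_sup => _ [h /= hf <-].
have mNC : measurable (~` N) by exact: measurableC.
pose h' : {nnsfun T >-> R} := proj_nnsfun h mNC.
apply: ereal_sup_ge; exists (sintegral mu h'); last first.
  rewrite -!integralT_nnsfun; apply: ae_ge0_le_integral => //.
  - by move=> x _; rewrite lee_fin.
  - exact/measurable_EFinP.
  - by move=> x _; rewrite lee_fin.
  - exact/measurable_EFinP.
  - exists N; split => // x /=; apply: contra_notP => xN _.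
    rewrite /h' /= /proj_nnsfun /= /mindic indicE.
    by rewrite mem_set//= mulr1.
exists h' => // x /=; rewrite /h' /= /mindic indicE.
case: (pselect (N x)) => xN.
  by rewrite memNset ?mulr0 ?g0//=.
rewrite mem_set//= mulr1 (le_trans (hf x))//.
suff -> : f x = g x by [].
by apply: contrapT => nfg; apply: xN; apply: fgN.
Qed.

(* No measurability is assumed: a null set carries no mass under any simple
   function below the integrand. *)
Lemma ae_eq_integral_nonmeasurable (f g : T -> \bar R) :
  {ae mu, forall x, f x = g x} -> \int[mu]_x f x = \int[mu]_x g x.
Proof.
move=> fg; have gf : {ae mu, forall x, g x = f x} by apply: filterS fg.
have part (h : (T -> \bar R) -> T -> \bar R) : (forall f x, 0 <= h f x) ->
    (forall f g x, f x = g x -> h f x = h g x) -> \int[mu]_x h f x = \int[mu]_x h g x.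
  move=> h0 hE; apply/eqP; rewrite eq_le !ge0_le_integral_ae_nonmeasurable//.
    by apply: filterS gf => x; exact: hE.
  by apply: filterS fg => x; exact: hE.
rewrite integralE [in RHS]integralE; congr (_ - _).
  by apply: (part (fun f => f^\+)) => // f' g' x; rewrite !funeposE => ->.
by apply: (part (fun f => f^\-)) => // f' g' x; rewrite !funenegE => ->.
Qed.

End nonmeasurable_integral.

(** * Normalised Brownian increments as noise *)

Section brownian_noise.
Context d (Omega : measurableType d) (R : realType) (P : probability Omega R).
Variables (B : R -> {RV P >-> R}) (sigma : R).
Hypotheses (hB : brownian_motion B) (sigma1 : sigma ^+ 2 = 1).

Definition increment (N i : nat) (w : Omega) : R := B (grid N i.+1) w - B (grid N i) w.

Lemma measurable_increment N i : measurable_fun setT (increment N i).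
Proof. exact: measurable_funB. Qed.

HB.instance Definition _ N i := isMeasurableFun.Build _ _ _ _ (increment N i) (measurable_increment N i).

Definition noise (N i : nat) (w : Omega) : R := sigma * increment N i w / mesh N.

Lemma measurable_noise N i : measurable_fun setT (noise N i).
Proof. by apply: measurable_funM => //; apply: measurable_funM. Qed.

HB.instance Definition _ N i := isMeasurableFun.Build _ _ _ _ (noise N i) (measurable_noise N i).

Let mesh0 N : 0 < mesh N :> R. Proof. by case/andP: (mesh01 (R := R) N). Qed.

Let increment_law N i (A : set R) : measurable A ->
  P (increment N i @^-1` A) = normal_prob 0 (mesh N) A.
Proof.
move=> mA; have [_ _ law _] := hB.
have lt : grid N i < grid N i.+1 :> R by rewrite gridS ltrDl invr_gt0 ltr0n.
have := law _ _ (grid_ge0 N i) lt A mA.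
have -> : grid N i.+1 - grid N i = N.+1%:R^-1 :> R by rewrite gridS addrC addKr.
by [].
Qed.

Lemma noise_indep N k : mutually_independent P (fun j : 'I_k => noise N j : Omega -> R).
Proof.
move=> A mA; have [_ _ _ ind] := hB.
pose A' (j : 'I_k) := (fun x : R => sigma * x / mesh N) @^-1` A j.
have mA' j : measurable (A' j).
  rewrite -[X in measurable X]setTI.
  have m : measurable_fun setT (fun x : R => sigma * x / mesh N).
    by apply: measurable_funM => //; apply: measurable_funM.
  exact: m.
have g0 : 0 <= grid N 0 :> R by exact: grid_ge0.
exact: (ind k (grid N) g0 (fun i => grid_le N (leqnSn i)) A' mA').
Qed.

Lemma noise_mean N i : (\int[P]_w (noise N i w)%:E = 0)%E.
Proof.
have iX := gaussian_integrable (mesh0 N) (@increment_law N i) 1.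
have -> : (\int[P]_w (noise N i w)%:E = \int[P]_w ((sigma / mesh N)%:E * (increment N i w ^+ 1)%:E))%E.
  by apply: eq_integral => w _; rewrite -EFinM /noise expr1; congr (_%:E); ring.
rewrite integralZl//; under eq_integral do rewrite expr1.
by rewrite (gaussian_mean (mesh0 N) (@increment_law N i)) mule0.
Qed.

Let noise_sqr N i w k : noise N i w ^+ k.*2 = increment N i w ^+ k.*2 / mesh N ^+ k.*2.
Proof.
rewrite /noise expr_div_n exprMn -muln2 mulnC (exprM sigma) sigma1 expr1n mul1r//.
Qed.

Lemma noise_variance N i : (\int[P]_w (noise N i w ^+ 2)%:E = 1)%E.
Proof.
have iX := gaussian_integrable (mesh0 N) (@increment_law N i) 2.
have -> : (\int[P]_w (noise N i w ^+ 2)%:E = \int[P]_w ((mesh N ^- 2)%:E * (increment N i w ^+ 2)%:E))%E.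
  by apply: eq_integral => w _; rewrite -EFinM (noise_sqr N i w 1); congr (_%:E); rewrite mulrC.
rewrite integralZl// (gaussian_variance (mesh0 N) (@increment_law N i)) -EFinM mulVf//.
by rewrite gt_eqF// exprn_gt0.
Qed.

(** From [(1 + x) ^+ k <= 2 ^+ k * (2 + x ^+ k.*2)] for [x >= 0] and the moments of the standard
    normal law; after normalisation the bound is the same for all meshes. *)
Definition noise_bound (k : nat) : R := 2 ^+ k * (2 + (\prod_(i < k) i.*2.+1)%:R).

Lemma noise_moment N i k : (\int[P]_w ((1 + `|noise N i w|) ^+ k)%:E <= (noise_bound k)%:E)%E.
Proof.
have iX := gaussian_integrable (mesh0 N) (@increment_law N i) k.*2.
have EX := gaussian_even_moment_le (mesh0 N) (@increment_law N i) k.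
have mk0 : 0 < mesh N ^+ k.*2 :> R by rewrite exprn_gt0.
have jX : integ P (fun w => noise N i w ^+ k.*2).
  have -> : (fun w => noise N i w ^+ k.*2) = (fun w => (mesh N ^+ k.*2)^-1 * increment N i w ^+ k.*2).
    by apply/funext => w; rewrite noise_sqr mulrC.
  exact: integZ.
have jc : integ P (fun w => 2 ^+ k * (2 + noise N i w ^+ k.*2)).
  by apply: integZ; apply: integD => //; exact: integ_cst.
have le w : (1 + `|noise N i w|) ^+ k <= 2 ^+ k * (2 + noise N i w ^+ k.*2).
  have -> : noise N i w ^+ k.*2 = `|noise N i w| ^+ k.*2.
    by rewrite -normrX ger0_norm// -muln2 exprM sqr_ge0.
  move: (normr_ge0 (noise N i w)); move: (`|_|) => x x0.
  have x2 : 0 <= x ^+ k.*2 by rewrite exprn_ge0.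
  case: (lerP x 1) => x1.
    apply: (@le_trans _ _ (2 ^+ k)); first by rewrite lerXn2r ?nnegrE ?addr_ge0//; lra.
    by rewrite ler_peMr ?exprn_ge0//; lra.
  apply: (@le_trans _ _ ((2 * x) ^+ k)).
    by rewrite lerXn2r ?nnegrE ?addr_ge0 ?mulr_ge0//; lra.
  rewrite exprMn ler_wpM2l ?exprn_ge0// (@le_trans _ _ (x ^+ k.*2))//.
    by rewrite ler_eXn2l// -addnn leq_addr.
  by rewrite lerDr.
apply: (@le_trans _ _ (\int[P]_w (2 ^+ k * (2 + noise N i w ^+ k.*2))%:E)%E).
  apply: ge0_le_integral => //.
  - apply/measurable_EFinP; apply: measurable_funX; apply: measurable_funD => //.
    by apply: measurableT_comp => //; exact: measurable_noise.
  - by apply/measurable_EFinP; exact: integ_measurable jc.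
  - by move=> w _; rewrite lee_fin.
rewrite integral_expect// lee_fin RintegralZl//; last by apply: integD => //; exact: integ_cst.
rewrite ler_wpM2l ?exprn_ge0// RintegralD//; last exact: integ_cst.
rewrite expect_cst lerD2l.
have -> : \int[P]_w noise N i w ^+ k.*2 = (mesh N ^+ k.*2)^-1 * \int[P]_w increment N i w ^+ k.*2.
  by rewrite -RintegralZl//; apply: eq_Rintegral => w _; rewrite noise_sqr mulrC.
rewrite ler_pdivrMl// mulrC -lee_fin -integral_expect//.
Qed.

End brownian_noise.

Lemma leq_pred6 (i : nat) : (i.+1 <= (6 * i.+1).-1)%N. Proof. lia. Qed.

(** * Removal of the time horizon *)

Section horizon_to_infinity.
Context d (Omega : measurableType d) (R : realType) (P : probability Omega R).
Variables (G T : nat -> Omega -> R) (V : Omega -> R) (tau : Omega -> \bar R).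
Variables (p j : nat) (c Ct : R).
Hypothesis mT : forall K, (0 < K)%N -> measurable_fun setT (T K).
Hypothesis jG : forall K, (0 < K)%N -> integ P (G K).
Hypothesis EG : forall K, (0 < K)%N -> \int[P]_w G K w = c.
Hypothesis TE : forall K, (0 < K)%N -> {ae P, forall w,
  T K w = if (K%:R%:E < tau w)%E then K%:R else fine (tau w)}.
Hypothesis tau0 : {ae P, forall w, (0 < tau w)%E}.
Hypothesis GE : forall K, (0 < K)%N -> {ae P, forall w, (tau w <= K%:R%:E)%E -> G K w = V w}.
Hypothesis V0 : {ae P, forall w, (tau w < +oo)%E -> 0 <= V w}.
Hypothesis tail : forall K, (0 < K)%N ->
  (\int[P]_w (Num.max 0 (T K w) ^+ p * iter j Num.sqrt (Num.max 0 (T K w)))%:E <= Ct%:E)%E.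
Hypothesis moment : forall r, exists2 C : R, 0 <= C & forall K, (0 < K)%N ->
  (\int[P]_w (G K w ^+ (6 * r))%:E <= (C * (K%:R + 4) ^+ (6 * p * r))%:E)%E.

(* With horizons s ^ (2 ^ j.+1) the gain K ^ (2 ^- j) in the tail estimate is
   s ^+ 2. *)
Let ex : nat := (2 ^ j.+1)%N.
Let K (s : nat) : nat := (s ^ ex)%N.

Let K0 s : (0 < s)%N -> (0 < K s)%N. Proof. by move=> s0; rewrite expn_gt0 s0. Qed.

Let iter_sqrt i (x : R) : 0 <= x -> iter i Num.sqrt (x ^+ (2 ^ i)) = x.
Proof.
move=> x0; elim: i => [|i IH] /=; first by rewrite expn0 expr1.
by rewrite -iterS iterSr expnS mulnC exprM sqrtr_sqr ger0_norm ?exprn_ge0.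
Qed.

(** By the description of [T], almost surely this says that [tau] is at least [K s]. *)
Let late s (w : Omega) : bool := (K s)%:R <= T (K s) w.
Let ind s (w : Omega) : R := (late s w)%:R.

Let mind s : (0 < s)%N -> measurable_fun setT (ind s).
Proof.
move=> s0; have -> : ind s = (fun w => if (K s)%:R <= T (K s) w then 1 else 0).
  by apply/funext => w; rewrite /ind /late; case: ifP.
apply: measurable_fun_ifT => //; apply: measurable_fun_ler => //.
exact: mT (K0 s0).
Qed.

Let ind01 s w : 0 <= ind s w <= 1.
Proof. by rewrite /ind; case: (late s w); rewrite ?lexx ?ler01. Qed.

Let jind s : (0 < s)%N -> integ P (ind s).
Proof.
move=> s0; apply: (integ_le (mind s0) (integ_cst P 1)) => w.
by have /andP[A B] := ind01 s w; rewrite normr1 ger0_norm.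
Qed.

Let Ks (s : nat) : (K s)%:R = (s%:R ^+ 2) ^+ (2 ^ j) :> R.
Proof. by rewrite /K /ex natrX -exprM -expnS. Qed.

Let late_prob s : (0 < s)%N -> (K s)%:R ^+ p * s%:R ^+ 2 * \int[P]_w ind s w <= Ct.
Proof.
move=> s0; have k0 := K0 s0.
rewrite -lee_fin -RintegralZl//; last exact: jind.
rewrite -integral_expect; last by apply: integZ; exact: jind.
apply: le_trans (tail k0); apply: ge0_le_integral => //.
- by move=> w _; rewrite lee_fin mulr_ge0 ?mulr_ge0 ?exprn_ge0//; case/andP: (ind01 s w).
- by apply/measurable_EFinP; apply: measurable_funM => //; exact: mind.
- have m0 : measurable_fun setT (fun w => Num.max 0 (T (K s) w)).
    by apply: measurable_maxr => //; exact: mT.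
  apply/measurable_EFinP; apply: measurable_funM; first exact: measurable_funX.
  elim: (j) => [|i IH] /=; first exact: m0.
  by apply: (measurableT_comp _ IH); apply: continuous_measurable_fun; exact: sqrt_continuous.
move=> w _; rewrite lee_fin /ind /late; case: (leP (K s)%:R (T (K s) w)) => KT; last first.
  rewrite mulr0 mulr_ge0 ?exprn_ge0 ?le_max ?lexx//.
  by case: (j) => [|i] /=; [rewrite le_max lexx|exact: sqrtr_ge0].
have T0 : 0 <= T (K s) w by rewrite (le_trans _ KT).
rewrite mulr1 (max_idPr T0) ler_pM ?exprn_ge0//.
  by rewrite lerXn2r ?nnegrE.
rewrite -[leLHS](iter_sqrt j) ?sqr_ge0// -Ks.
by elim: (j) => //= i IH; exact: ler_wsqrtr.
Qed.

(** Split at the level [lam]. Below it the tail estimate gives [Ct / s]. Above it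
    [|G| <= lam ^- q * G ^+ (6 * r)] with [q = 6 * r - 1], and a large [r] beats the polynomial
    growth of the moments in [K]; the 5 comes from [K + 4 <= 5 * K]. *)
Let late_mean : exists2 C : R, 0 <= C & forall s, (0 < s)%N ->
  \int[P]_w (`|G (K s) w| * ind s w) <= C / s%:R.
Proof.
(* For this choice [K ^+ p * s] equals [s ^+ r], and [r <= q] makes the contribution above [lam] of
   order [1 / s]. *)
pose r := (ex * p).+1.
have [C C0 HC] := moment r.
have Ct0 : 0 <= Ct.
  apply: le_trans (late_prob (ltnSn 0)); rewrite mulr_ge0 ?mulr_ge0 ?exprn_ge0//.
  by apply: Rintegral_ge0 => w _; case/andP: (ind01 1 w).
exists (Ct + C * 5 ^+ (6 * p * r)) => [|s s0]; first by rewrite addr_ge0// mulr_ge0// exprn_ge0.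
have k0 := K0 s0; have s1 : 1 <= s%:R :> R by rewrite ler1n.
have s0' : 0 < s%:R :> R by rewrite ltr0n.
have k1 : 1 <= (K s)%:R :> R by rewrite ler1n.
have k0' : 0 < (K s)%:R :> R by rewrite ltr0n.
have mG := integ_measurable (jG k0).
have G6 (w : Omega) : 0 <= G (K s) w ^+ (6 * r) by rewrite exprM exprn_ge0// exprn_even_ge0.
have j6 : integ P (fun w => G (K s) w ^+ (6 * r)).
  by apply: (ge0_integ_lty _ G6 (HC _ k0)); exact: measurable_funX.
have E6 : \int[P]_w (G (K s) w ^+ (6 * r)) <= C * ((K s)%:R + 4) ^+ (6 * p * r).
  by rewrite -lee_fin -integral_expect//; exact: HC.
pose lam := (K s)%:R ^+ p * s%:R : R.
have lam0 : 0 < lam by rewrite mulr_gt0// exprn_gt0.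
pose q := (6 * r).-1.
have qE : (6 * r = q.+1)%N by rewrite /q prednK.
have le w : `|G (K s) w| * ind s w <= lam * ind s w + lam ^- q * G (K s) w ^+ (6 * r).
  have /andP[i0 i1] := ind01 s w.
  have -> : G (K s) w ^+ (6 * r) = `|G (K s) w| ^+ (6 * r) by rewrite -normrX ger0_norm.
  case: (lerP `|G (K s) w| lam) => Gl.
    rewrite (le_trans (ler_wpM2r i0 Gl))// lerDl.
    by rewrite mulr_ge0 ?exprn_ge0// invr_ge0 exprn_ge0// ltW.
  apply: (@le_trans _ _ `|G (K s) w|); first by rewrite ler_piMr.
  rewrite -[leLHS]add0r lerD//; first by rewrite mulr_ge0// ltW.
  rewrite qE exprS mulrCA ler_peMr// mulrC ler_pdivlMr ?exprn_gt0// mul1r.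
  by rewrite lerXn2r ?nnegrE ?(ltW lam0)// ltW.
have jGi : integ P (fun w => `|G (K s) w| * ind s w).
  apply: (integ_le _ (jG k0)) => [|w].
    by apply: measurable_funM; [exact: measurableT_comp|exact: mind].
  have /andP[i0 i1] := ind01 s w.
  by rewrite normrM normr_id (ger0_norm i0) ler_piMr.
have jR : integ P (fun w => lam * ind s w + lam ^- q * G (K s) w ^+ (6 * r)).
  by apply: integD; apply: integZ => //; exact: jind.
apply: (@le_trans _ _ (\int[P]_w (lam * ind s w + lam ^- q * G (K s) w ^+ (6 * r)))).
  by apply: le_Rintegral => // w _.
rewrite RintegralD//; [|by apply: integZ; exact: jind|exact: integZ].
rewrite RintegralZl//; last exact: jind.
rewrite RintegralZl// mulrDl lerD//.
  rewrite ler_pdivlMr// (le_trans _ (late_prob s0))// le_eqVlt; apply/orP; left; apply/eqP.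
  by rewrite /lam; ring.
rewrite (le_trans (ler_wpM2l _ E6)) ?invr_ge0 ?exprn_ge0 ?(ltW lam0)//.
rewrite mulrCA -mulrA ler_wpM2l// mulrC ler_pdivrMr ?exprn_gt0// mulrAC ler_pdivlMr//.
have B1 : ((K s)%:R + 4) ^+ (6 * p * r) <= 5 ^+ (6 * p * r) * (K s)%:R ^+ (6 * p * r) :> R.
  rewrite -exprMn lerXn2r ?nnegrE ?addr_ge0 ?mulr_ge0//; move: k1; lra.
rewrite (le_trans (ler_wpM2r (ltW s0') B1))// -!mulrA ler_wpM2l ?exprn_ge0//.
have -> : (6 * p * r = p * q + p)%N by rewrite -mulnA mulnCA qE mulnS addnC.
rewrite exprD -mulrA /lam exprMn -exprM ler_wpM2l ?exprn_ge0//.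
have -> : (K s)%:R ^+ p * s%:R = s%:R ^+ (ex * p).+1 :> R.
  by rewrite /K natrX -exprM exprSr.
have le' : ((ex * p).+1 <= q)%N by exact: leq_pred6.
exact: (ler_weXn2l s1 le').
Qed.

(** The product is nonnegative only almost surely; the positive part makes it so at every sample
    point, for the use of Fatou's lemma. *)
Let early s (w : Omega) : R := Num.max 0 (G (K s) w * (1 - ind s w)).

Let earlyE : {ae P, forall w s, (0 < s)%N -> G (K s) w * (1 - ind s w) =
  if T (K s) w < (K s)%:R then V w else 0}.
Proof.
have TE' s : {ae P, forall w, (0 < s)%N -> T (K s) w =
    if ((K s)%:R%:E < tau w)%E then (K s)%:R else fine (tau w)}.
  by case: s => [|s]; [apply: aeW|apply: filterS (TE (K0 (ltn0Sn s)))].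
have GE' s : {ae P, forall w, (0 < s)%N -> (tau w <= (K s)%:R%:E)%E -> G (K s) w = V w}.
  by case: s => [|s]; [apply: aeW|apply: filterS (GE (K0 (ltn0Sn s))) => w H _].
have A := ae_foralln TE'; have B := ae_foralln GE'.
apply: filterS2 A B => w hT hG s s0; rewrite /ind /late leNgt.
case: ifPn => KT; last by rewrite /= subrr mulr0.
rewrite subr0 mulr1 hG// leNgt; apply/negP => h.
by move: KT; rewrite hT// h ltxx.
Qed.

(** The tail bound drives the probability of [late s] to 0; this is how the collision time is seen
    to be almost surely finite. *)
Let early_sometime : {ae P, forall w, exists2 s, (0 < s)%N & T (K s) w < (K s)%:R}.
Proof.
pose N := \bigcap_s [set w | late s.+1 w].
have mL s : measurable [set w | late s.+1 w].
  have := @mind s.+1 isT measurableT [set 1] (measurable_set1 _); rewrite setTI.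
  congr measurable; apply/seteqP; split => w /=; rewrite /ind; first by case: (late s.+1 w) => // /eqP; rewrite eq_sym oner_eq0.
  by move=> ->.
exists N; split.
- exact: bigcapT_measurable.
- apply/eqP; rewrite eq_le measure_ge0 andbT; apply/lee_addgt0Pr => e e0; rewrite add0e.
  have Ct0 : 0 <= Ct.
    apply: le_trans (late_prob (ltnSn 0)); rewrite mulr_ge0 ?mulr_ge0 ?exprn_ge0//.
    by apply: Rintegral_ge0 => w _; case/andP: (ind01 1 w).
  pose s := Num.truncn (Ct / e).
  apply: (@le_trans _ _ (P [set w | late s.+1 w])).
    by apply: le_measure; rewrite ?inE//; [exact: bigcapT_measurable|move=> w; exact].
  have -> : P [set w | late s.+1 w] = (\int[P]_w ind s.+1 w)%:E.
    rewrite -integral_expect; last exact: jind.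
    rewrite -[LHS]mul1e -integral_cst// integral_mkcond; apply: eq_integral => w _.
    rewrite patchE /ind; case: ifPn; rewrite ?inE /= => lw; first by rewrite lw.
    by rewrite notin_setE/= in lw; move/negP/negbTE : lw => ->.
  rewrite lee_fin; have := late_prob (ltn0Sn s).
  have A : s.+1%:R <= (K s.+1)%:R ^+ p * s.+1%:R ^+ 2 :> R.
    rewrite -[leLHS]mul1r ler_pM// ?exprn_ege1 ?ler1n ?K0//.
    by rewrite expr2 ler_peMr// ler1n.
  have I0 : 0 <= \int[P]_w ind s.+1 w by apply: Rintegral_ge0 => w _; case/andP: (ind01 s.+1 w).
  move=> /(le_trans (ler_wpM2r I0 A)) B.
  have : Ct <= e * s.+1%:R by rewrite -ler_pdivrMl// mulrC ltW// truncnS_gt.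
  move=> /(le_trans B); rewrite mulrC ler_pM2r// ltr0n//.
- move=> w /= h s _ /=; rewrite /late leNgt; apply/negP => lt; apply: h.
  by exists s.+1.
Qed.

(** On early sample points the value is already the final one, so almost surely [F s] never exceeds
    [V] and equals it once the horizon has passed [tau]. Fatou's lemma bounds the integral of [V]
    from above and comparison with [F s] from below; the measurable [V'] replaces [V] in both. *)
Lemma expectation_horizon_limit : (\int[P]_w (V w)%:E = c%:E)%E.
Proof.
have [C C0 HC] := late_mean.
pose F s w := early s.+1 w.
have mGi s : measurable_fun setT (fun w => G (K s.+1) w * (1 - ind s.+1 w)).
  apply: measurable_funM; first exact: integ_measurable (jG (K0 (ltn0Sn s))).
  by apply: measurable_funB => //; exact: mind.
have mF s : measurable_fun setT (F s) by apply: measurable_maxr.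
have F0 s w : 0 <= F s w by rewrite /F /early le_max lexx.
pose V' w := limn_einf (fun s => (F s w)%:E).
have mV' : measurable_fun setT V'.
  by apply: (measurable_limn_einf (f := fun s w => (F s w)%:E)) => s; exact/measurable_EFinP.
have V'0 w : (0 <= V' w)%E by apply: (@limn_einf_ge _ _ _ 0%N) => s _; rewrite lee_fin.
have TE' s : {ae P, forall w, (0 < s)%N -> T (K s) w =
    if ((K s)%:R%:E < tau w)%E then (K s)%:R else fine (tau w)}.
  by case: s => [|s]; [apply: aeW|apply: filterS (TE (K0 (ltn0Sn s)))].
have AT := ae_foralln TE'.
have main : {ae P, forall w, [/\ 0 <= V w, forall s, F s w <= V w,
    forall s, F s w = G (K s.+1) w * (1 - ind s.+1 w) & V' w = (V w)%:E]}.
  apply: filterS3 (filterI earlyE early_sometime) (filterI tau0 V0) AT => w [hE [s0 s00 hs]] [t0 hV] hT.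
  have tK : (tau w <= (K s0)%:R%:E)%E.
    by rewrite leNgt; apply/negP => h; move: hs; rewrite hT// h ltxx.
  have toy : (tau w < +oo)%E by rewrite (le_lt_trans tK)// ltry.
  have Vw := hV toy.
  have FE s : F s w = if T (K s.+1) w < (K s.+1)%:R then V w else 0.
    by rewrite /F /early hE//; case: ifP => _; apply/max_idPr.
  split => //.
  - by move=> s; rewrite FE; case: ifP.
  - by move=> s; rewrite FE hE.
  have tf : tau w \is a fin_num by rewrite ge0_fin_numE// ltW.
  have ev s : (s0 <= s)%N -> F s w = V w.
    move=> ss; have lt : (tau w < (K s.+1)%:R%:E)%E.
      rewrite (le_lt_trans tK)// lte_fin ltr_nat /K ltn_exp2r ?ltnS//.
      by rewrite /ex expn_gt0.
    have nlt : ((K s.+1)%:R%:E < tau w)%E = false by apply/negbTE; rewrite -leNgt ltW.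
    by rewrite FE hT ?K0// nlt -lte_fin fineK// lt.
  apply/eqP; rewrite eq_le; apply/andP; split.
    by apply: (@limn_einf_le _ _ _ s0) => s ss; rewrite ev.
  by apply: (@limn_einf_ge _ _ _ s0) => s ss; rewrite ev.
have jF s : integ P (fun w => G (K s.+1) w * (1 - ind s.+1 w)).
  apply: (integ_le _ (jG (K0 (ltn0Sn s)))) => // w.
  have /andP[i0 i1] := ind01 s.+1 w.
  by rewrite normrM ler_piMr// ger0_norm ?subr_ge0// gerBl.
have EF s : (\int[P]_w (F s w)%:E = (\int[P]_w (G (K s.+1) w * (1 - ind s.+1 w)))%:E)%E.
  rewrite -integral_expect//; apply: ae_eq_integral => //; try exact/measurable_EFinP.
  by apply: filterS main => w [_ _ -> _].
have near s : `|\int[P]_w (G (K s.+1) w * (1 - ind s.+1 w)) - c| <= C / s.+1%:R.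
  have k0 := K0 (ltn0Sn s).
  have jGi : integ P (fun w => G (K s.+1) w * ind s.+1 w).
    apply: (integ_le _ (jG k0)) => [|w].
      by apply: measurable_funM; [exact: integ_measurable (jG k0)|exact: mind].
    have /andP[i0 i1] := ind01 s.+1 w.
    by rewrite normrM ler_piMr// ger0_norm.
  have -> : \int[P]_w (G (K s.+1) w * (1 - ind s.+1 w)) = c - \int[P]_w (G (K s.+1) w * ind s.+1 w).
    rewrite -(EG k0) -RintegralB//; last exact: jG.
    by apply: eq_Rintegral => w _; rewrite mulrBr mulr1.
  rewrite addrAC subrr add0r normrN (le_trans (le_normr_Rintegral measurableT jGi))//.
  apply: le_trans (HC _ (ltn0Sn s)); rewrite le_eqVlt; apply/orP; left; apply/eqP.
  apply: eq_Rintegral => w _; have /andP[i0 i1] := ind01 s.+1 w.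
  by rewrite normrM (ger0_norm i0).
have small (e : R) : 0 < e -> exists n0, forall s, (n0 <= s)%N -> C / s.+1%:R <= e.
  move=> e0; exists (Num.truncn (C / e)) => s ss.
  rewrite ler_pdivrMr ?ltr0n// -ler_pdivrMl// mulrC ltW// (lt_le_trans (truncnS_gt _))//.
  by rewrite ler_nat.
have VV' : {ae P, forall w, (V w)%:E = V' w} by apply: filterS main => w [].
rewrite (ae_eq_integral_nonmeasurable VV').
apply/eqP; rewrite eq_le; apply/andP; split; apply/lee_addgt0Pr => e e0; have [n0 Hn] := small e e0.
  have F1 := @fatou _ _ R P setT measurableT (fun s w => (F s w)%:E) (fun s => iffRL (measurable_EFinP _ _) (mF s)) (fun s w _ => F0 s w).
  apply: (le_trans F1); apply: (@limn_einf_le _ _ _ n0) => s ss.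
  rewrite EF -EFinD lee_fin -lerBlDl (le_trans (ler_norm _))// (le_trans (near s))// Hn//.
apply: (@le_trans _ _ ((\int[P]_w (F n0 w)%:E) + e%:E)%E).
  rewrite EF -EFinD lee_fin; have := near n0; rewrite ler_norml => /andP[h _].
  have := Hn n0 (leqnn _); move: h; move: (\int[P]_w _) (C / _) => x y; lra.
rewrite leeD2r//; apply: ae_ge0_le_integral => //.
- by move=> w _; rewrite lee_fin.
- exact/measurable_EFinP.
- by apply: filterS main => w [_ h _ ->] _; rewrite lee_fin.
Qed.

End horizon_to_infinity.

Lemma exp2V_small {R : realType} (a e : R) : 0 < a -> 0 < e -> exists j : nat, a * 2 ^- j < e.
Proof.
move=> a0 e0; pose j := (Num.truncn (a / e)).+1; exists j.
have j2 : j%:R < 2 ^+ j :> R by rewrite -natrX ltr_nat ltn_expl.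
rewrite ltr_pdivrMr ?exprn_gt0// mulrC -ltr_pdivrMr//.
exact: lt_trans (truncnS_gt _) j2.
Qed.

(** * The coefficients in terms of the state at the collision *)

Section sle_endpoint.
Context {R : realType} (kappa sigma : R) (b X Y : R -> R).
Hypotheses (k4 : kappa < 4) (sigma1 : sigma ^+ 2 = 1).
Hypotheses (b0 : b 0 = 0) (cb : {within `[0, +oo[, continuous b}).
Hypothesis sle : sle_kappa_rho kappa (kappa - 6) sigma (- sigma) b X Y.
Let tau := collision_time X Y.
Hypothesis tau_fin : (tau < +oo)%E.
Let T := fine tau.

Let tau0 : (0 < tau)%E. Proof. exact: (collision_time_gt0 sle). Qed.

Let tauE : T%:E = tau.
Proof. by rewrite fineK// ge0_fin_numE// ltW. Qed.

Let T0 : 0 < T. Proof. by rewrite -lte_fin tauE. Qed.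

Let Tt : (T%:E <= tau)%E. Proof. by rewrite tauE. Qed.

Lemma sle_coefficients (a : nat -> R) : expansion_at_infinity (loewner_map X T) a ->
  a 1%N = 2 * T /\ a 2%N = sigma * sle_a kappa sigma b X Y T.
Proof.
move=> ex.
have cx := continuous_sle_x sigma1 cb sle T0 Tt.
have ca := continuous_sle_a sigma1 cb sle T0 Tt.
have da t := @is_derive_sle_a _ _ _ _ _ _ sigma1 cb sle _ T0 Tt t.
set x := sle_x kappa sigma b X Y in cx da *.
set A := sle_a kappa sigma b X Y in ca da *.
have [c1 _ M1] := EVT_max (ltW T0) cx.
have [c2 _ M2] := EVT_min (ltW T0) cx.
have sigma_norm : `|sigma| = 1.
  by apply/eqP; rewrite -(@eqrXn2 _ 2%N)// expr1n -normrX sigma1 normr1.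
have M0 : 0 <= `|x c1| + `|x c2| by rewrite addr_ge0.
have XE (t : R) : 0 < t < T -> X t = sigma * x t.
  move=> /andP[t0 tT]; apply: (sle_xE k4 sigma1 b0 sle (ltW t0)).
  by rewrite -/tau -tauE lte_fin.
have XM (t : R) : 0 < t < T -> `|X t| <= `|x c1| + `|x c2|.
  move=> tT; rewrite XE// normrM sigma_norm mul1r.
  have it : t \in `[0, T] by have /andP[t0 t1] := tT; rewrite in_itv/= !ltW.
  have := M1 _ it; have := M2 _ it; have := ler_norm (x c1); have := ler_norm (- x c2).
  rewrite normrN; have := normr_ge0 (x c1); have := normr_ge0 (x c2).
  rewrite ler_norml; move: (x t) (x c1) (x c2) `|x c1| `|x c2| => y y1 y2 z1 z2.
  by move=> *; apply/andP; split; lra.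
(* The antiderivative of the driving function: [sle_a] is twice the integral of [sigma X], and
   [sigma] is its own inverse. *)
have cJ : {within `[0, T], continuous (fun t => sigma / 2 * A t)}.
  by move=> t; apply: cvgM; [exact: cvg_cst|exact: ca].
have J0 : sigma / 2 * A 0 = 0 by rewrite /A /sle_a set_itv1 Rintegral_set1 !mulr0.
have dJ (t : R) : 0 < t < T -> is_derive t 1 (fun t => sigma / 2 * A t) (X t).
  move=> tT; have dA := da t tT.
  have -> : X t = sigma / 2 *: (2 * x t) by rewrite XE// /GRing.scale/=; field.
  exact: (@is_deriveZ _ _ _ A (sigma / 2)).
have [-> ->] := loewner_coefficients T0 M0 XM cJ J0 dJ ex; split => //.
by field.
Qed.

Lemma sle_coefficients_phi (n m : nat) (a : nat -> R) : ~~ odd m ->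
  expansion_at_infinity (loewner_map X T) a ->
  phi kappa n m (sle_state kappa sigma b X Y T) = a 1%N ^+ n * a 2%N ^+ m.
Proof.
move=> om /sle_coefficients[-> ->].
rewrite phi_collision; last by rewrite (st_u_sle _ _ _ _ k4) /gap -/tau tauE ltxx.
rewrite [in RHS](exprMn _ sigma); have -> : sigma ^+ m = 1; last by rewrite mul1r.
by rewrite -(odd_double_half m) (negbTE om) add0n -mul2n exprM sigma1 expr1n.
Qed.

Lemma sle_coefficients_ge0 (n m : nat) (a : nat -> R) : ~~ odd m ->
  expansion_at_infinity (loewner_map X T) a -> 0 <= a 1%N ^+ n * a 2%N ^+ m.
Proof.
move=> om /sle_coefficients[-> _].
by apply: mulr_ge0; [rewrite exprn_ge0// mulr_ge0// ltW|exact: exprn_even_ge0].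
Qed.

End sle_endpoint.

(** * The expectation in positive degree *)

Section positive_degree.
Context (R : realType) (d : measure_display) (Omega : measurableType d) (P : probability Omega R).
Variables (n m : nat) (kappa sigma : R).
Hypotheses (om : ~~ odd m) (k0 : 0 < kappa) (k4 : kappa < 4) (sigma1 : sigma ^+ 2 = 1).
Let p := (n + (3 * m)./2)%N.
Hypotheses (p0 : (0 < p)%N) (kp : 0 < 8 - (2 * p + 1)%:R * kappa).
Variable B : R -> {RV P >-> R}.
Hypothesis hB : brownian_motion B.
Variables X Y : R -> Omega -> R.
Hypothesis hXY : {ae P, forall w,
    sle_kappa_rho kappa (kappa - 6) sigma (- sigma) (B^~ w) (X^~ w) (Y^~ w)}.
Variable a : nat -> Omega -> R.
Let tau (w : Omega) := collision_time (X^~ w) (Y^~ w).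
Hypothesis ha : {ae P, forall w, (tau w < +oo)%E ->
  expansion_at_infinity (loewner_map (X^~ w) (fine (tau w))) (a^~ w)}.

Let g (N i : nat) : {RV P >-> R} := noise B sigma N i.
Let g_indep N k : mutually_independent P (fun j : 'I_k => g N j : Omega -> R).
Proof. exact: noise_indep. Qed.
Let g_moment N i k : (\int[P]_w ((1 + `|g N i w|) ^+ k)%:E <= (noise_bound R k)%:E)%E.
Proof. exact: noise_moment. Qed.
Let g_mean N i : (\int[P]_w (g N i w)%:E = 0)%E.
Proof. exact: noise_mean. Qed.
Let g_variance N i : (\int[P]_w (g N i w ^+ 2)%:E = 1)%E.
Proof. exact: noise_variance. Qed.

Let Z (K : nat) (w : Omega) := sle_state kappa sigma (B^~ w) (X^~ w) (Y^~ w)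
  (sle_horizon (X^~ w) (Y^~ w) K).

Let eulerZ (K : nat) : (0 < K)%N -> {ae P, forall w, forall U, nbhs (Z K w) U ->
  exists k0, forall k, (k0 <= k)%N -> exists n0, forall N, (n0 <= N)%N -> U (euler g kappa K k N w)}.
Proof.
move=> K0; have [hB0 hBc _ _] := hB.
apply: filterS3 hB0 hBc hXY => w b0 cb sle U nU.
have [i0 Hi] := sle_state_limit k0 k4 sigma1 b0 cb sle K0 nU.
exists i0 => k ik; have [n0 Hn] := Hi k ik; exists n0 => N nN.
apply: (Hn N nN (fun i => proc (g N) kappa k.+1%:R^-1 (mesh N) (0, 0, 0, 0) i w)).
split => //; exists (fun i => g N i w) => i; split => //.
have mN : mesh N != 0 :> R by rewrite gt_eqF//; case/andP: (mesh01 (R := R) N).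
by rewrite /g /= /noise /increment mulrC mulfVK// mulrBr.
Qed.

Lemma positive_degree_expectation :
  (\int[P]_w (a 1%N w ^+ n * a 2%N w ^+ m)%:E)%E =
  (2 ^+ (3 * n + 3 * m) * (kappa / 6) ^+ (m %/ 2)
     * (m`!%:R / ((m %/ 2)`!)%:R)
   / \prod_(1 <= j < (n + (3 * m) %/ 2).+1) (8 - (2 * j + 1)%:R * kappa))%:E.
Proof.
have [hB0 hBc _ _] := hB.
(* The strict inequality [kp] leaves room for the exponent [p + 2 ^- j] with [j] large. *)
have [j kq] : exists j, 0 < 8 - (2 * (p%:R + 2 ^- j) + 1) * kappa.
  have k20 : 0 < 2 * kappa by rewrite mulr_gt0.
  have [j Hj] := exp2V_small k20 kp; exists j; move: Hj.
  by rewrite natrD natrM; move: (2 ^- j) p%:R => x y; lra.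
apply: (@expectation_horizon_limit _ _ _ P (phi_limit g kappa n m) (time_limit g kappa) _ tau
  p j _ (tail_function kappa p j (0, 0, 0, 0))).
- by move=> K K0; exact: measurable_time_limit.
- by move=> K K0; have [] := expect_phi_limit g_indep g_moment g_mean g_variance k0 k4 om kp K0 (eulerZ K0).
- by move=> K K0; have [] := expect_phi_limit g_indep g_moment g_mean g_variance k0 k4 om kp K0 (eulerZ K0).
- by move=> K K0; exact: (time_limitE (eulerZ K0)).
- apply: filterS3 hB0 hBc hXY => w b0 cb sle; exact: (collision_time_gt0 sle).
- move=> K K0; have GZ := phi_limitE n m (eulerZ K0).
  apply: filterS3 (filterI hB0 hBc) (filterI hXY ha) GZ => w [b0 cb] [sle ex] -> tK.
  have tf : (tau w < +oo)%E by rewrite (le_lt_trans tK)// ltry.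
  have -> : Z K w = sle_state kappa sigma (B^~ w) (X^~ w) (Y^~ w) (fine (tau w)).
    by rewrite /Z /sle_horizon -/(tau w) ltNge tK.
  exact: (sle_coefficients_phi k4 sigma1 b0 cb sle tf n om (ex tf)).
- apply: filterS3 (filterI hB0 hBc) hXY ha => w [b0 cb] sle ex tf.
  exact: (sle_coefficients_ge0 k4 sigma1 b0 cb sle tf n om (ex tf)).
- by move=> K K0; exact: (time_limit_moment g_indep g_moment g_mean g_variance k0 k4 K0 (eulerZ K0) p0 kq).
move=> r; have [C C0 HC] := phi_moment g_indep g_moment g_mean k0 k4 om kp r.
exists C => // K K0; apply: (phi_limit_moment k0 k4 om kp (eulerZ K0)).
  by rewrite mulr_ge0// exprn_ge0// addr_ge0.
by move=> k N mk; exact: HC.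
Qed.

End positive_degree.

Theorem mainTheorem3 (R : realType) (d : measure_display)
  (Omega : measurableType d) (P : probability Omega R)
  (n m : nat) (hm : ~~ odd m)
  (kappa : R) (hkappa0 : 0 < kappa)
  (hkappa : kappa < 8 / (2 * n + 3 * m + 1)%:R)
  (sigma : R) (hsigma : sigma = -1 \/ sigma = 1)
  (B : R -> {RV P >-> R}) (hB : brownian_motion B)
  (X Y : R -> Omega -> R)
  (hXY : {ae P, forall w,
    sle_kappa_rho kappa (kappa - 6) sigma (- sigma) (B^~ w) (X^~ w) (Y^~ w)})
  (a : nat -> Omega -> R)
  (ha : {ae P, forall w,
    (collision_time (X^~ w) (Y^~ w) < +oo)%E ->
    expansion_at_infinity
      (loewner_map (X^~ w) (fine (collision_time (X^~ w) (Y^~ w))))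
      (a^~ w)}) :
  ('E_P[(fun w => a 1%N w ^+ n * a 2%N w ^+ m)%R])%E =
  (2 ^+ (3 * n + 3 * m) * (kappa / 6) ^+ (m %/ 2)
     * (m`!%:R / ((m %/ 2)`!)%:R)
   / \prod_(1 <= j < (n + (3 * m) %/ 2).+1) (8 - (2 * j + 1)%:R * kappa))%:E.
Proof.
(* In degree 0 [kappa] may be anywhere below 8, outside the range [kappa < 4] of the construction,
   but the random variable is the constant 1. In positive degree the hypothesis gives
   [3 * kappa < 8]. *)
have [p0|p0] := posnP (n + (3 * m)./2)%N.
  have [-> ->] : n = 0%N /\ m = 0%N by move: hm p0; lia.
  rewrite [RHS](_ : _ = 1%E); last by rewrite !muln0 div0n big_geq// fact0 !divr1 !mul1r.
  rewrite (_ : (fun w => _) = cst 1); first exact: expectation_cst.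
  by apply/funext => w /=; rewrite !expr0 mulr1.
have dE : (2 * n + 3 * m + 1 = 2 * (n + (3 * m)./2) + 1)%N by move: hm; lia.
have kp : 0 < 8 - (2 * (n + (3 * m)./2) + 1)%:R * kappa.
  by rewrite -dE subr_gt0 mulrC -ltr_pdivlMr// ltr0n addn1.
have k4 : kappa < 4.
  have : 3%:R <= (2 * (n + (3 * m)./2) + 1)%:R :> R by rewrite ler_nat; move: p0; lia.
  by move: kp; move: ((_ + 1)%:R : R) => x; move: hkappa0; clear; nra.
have sigma1 : sigma ^+ 2 = 1 by case: hsigma => ->; rewrite ?sqrrN expr1n.
rewrite unlock; exact: (positive_degree_expectation hm hkappa0 k4 sigma1 p0 kp hB hXY ha).
Qed.
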